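(* Let $A$ be a sequence algebra and let $X\in\overline{\mathcal H}$. Then $X$ is extremely projective with respect to $\overline{\mathcal H}$ if and only if for every $n\in\mathbb N$ the coordinate subspace $X_n$ is isometrically isomorphic to $l_1(\Lambda_n)$ for some index set $\Lambda_n$ (equivalently, each $X_n$ is extremely projective in $\mathbf{Ban}$).
   Context: All normed algebras and modules are contractive: $\|ab\|\le\|a\|\|b\|$ and $\|a\cdot x\|\le\|a\|\|x\|$; morphisms are bounded $A$-module maps. A morphism $\tau:Y\to X$ is coisometric if $\|\tau\|\le1$ and for every $x\in X$, $\varepsilon>0$ there is $y\in Y$ with $\tau(y)=x$, $\|y\|<\|x\|+\varepsilon$. A lifting of $\varphi:P\to X$ with respect to $\tau:Y\to X$ is a morphism $\psi:P\to Y$ with $\tau\psi=\varphi$. For a full subcategory $\mathcal K$ of normed $A$-modules, $P$ is extremely projective with respect to $\mathcal K$ if for every coisometric morphism $\tau:Y\to X$ with $X,Y\in\mathcal K$, every bounded morphism $\varphi:P\to X$ and every $\varepsilon>0$ there is a lifting $\psi$ with $\|\psi\|<\|\varphi\|+\varepsilon$. A Banach space is extremely projective in $\mathbf{Ban}$ if it is extremely projective with respect to the category of Banach spaces (over $A=\mathbb C$). A sequence algebra is a normed algebra of complex sequences with coordinatewise operations that contains $c_{00}$ (finite sequences) as a dense subalgebra and with $\|\mathbf p^n\|=1$, where $\mathbf p^n$ has $1$ in place $n$ and $0$ elsewhere. For an $A$-module $X$, $x_n:=\mathbf p^n\cdot x$ and $X_n:=\{\mathbf p^n\cdot x:x\in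 X\}$. $X$ is essential if the closed linear span of $\{a\cdot x\}$ is $X$; homogeneous if $\|x_n\|\le\|y_n\|$ for all $n$ implies $\|x\|\le\|y\|$. $\overline{\mathcal H}$ is the full subcategory of essential homogeneous Banach (complete) $A$-modules. *)

(* Defs.v *)
From Stdlib Require Import Reals List.
Import ListNotations.
Open Scope R_scope.
Set Implicit Arguments.

Definition Cpx : Type := (R * R)%type.
Definition C0 : Cpx := (0, 0).
Definition C1 : Cpx := (1, 0).
Definition Cadd (z w : Cpx) : Cpx := (fst z + fst w, snd z + snd w).
Definition Copp (z : Cpx) : Cpx := (- fst z, - snd z).
Definition Cmul (z w : Cpx) : Cpx :=
  (fst z * fst w - snd z * snd w, fst z * snd w + snd z * fst w).
Definition Cnorm (z : Cpx) : R := sqrt (fst z * fst z + snd z * snd z).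

Record NormedSpace : Type := {
  carrier :> Type;
  vzero : carrier;
  vadd : carrier -> carrier -> carrier;
  vopp : carrier -> carrier;
  vscal : Cpx -> carrier -> carrier;
  vnorm : carrier -> R;
  vadd_assoc : forall x y z, vadd x (vadd y z) = vadd (vadd x y) z;
  vadd_comm : forall x y, vadd x y = vadd y x;
  vadd_zero : forall x, vadd x vzero = x;
  vadd_opp : forall x, vadd x (vopp x) = vzero;
  vscal_one : forall x, vscal C1 x = x;
  vscal_assoc : forall a b x, vscal a (vscal b x) = vscal (Cmul a b) x;
  vscal_distr_l : forall a x y, vscal a (vadd x y) = vadd (vscal a x) (vscal a y);
  vscal_distr_r : forall a b x, vscal (Cadd a b) x = vadd (vscal a x) (vscal b x);
  vnorm_nonneg : forall x, 0 <= vnorm x;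
  vnorm_zero : forall x, vnorm x = 0 -> x = vzero;
  vnorm_scal : forall a x, vnorm (vscal a x) = Cnorm a * vnorm x;
  vnorm_triangle : forall x y, vnorm (vadd x y) <= vnorm x + vnorm y
}.

Arguments vzero {n}.
Definition vsub (V : NormedSpace) (x y : V) : V := vadd V x (vopp V y).

Definition complete (V : NormedSpace) : Prop :=
  forall u : nat -> V,
    (forall eps, eps > 0 -> exists N, forall m k, (m >= N)%nat -> (k >= N)%nat ->
        vnorm V (vsub V (u m) (u k)) < eps) ->
    exists l : V, forall eps, eps > 0 -> exists N, forall m, (m >= N)%nat ->
        vnorm V (vsub V (u m) l) < eps.

Definition cseq : Type := nat -> Cpx.
Definition sadd (a b : cseq) : cseq := fun n => Cadd (a n) (b n).
Definition sopp (a : cseq) : cseq := fun n => Copp (a n).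
Definition smul (a b : cseq) : cseq := fun n => Cmul (a n) (b n).
Definition sscal (c : Cpx) (a : cseq) : cseq := fun n => Cmul c (a n).
Definition szero : cseq := fun _ => C0.
Definition pvec (n : nat) : cseq := fun k => if Nat.eqb k n then C1 else C0.
Definition finite_seq (a : cseq) : Prop := exists N, forall k, (k >= N)%nat -> a k = C0.

Record SeqAlg : Type := {
  inA : cseq -> Prop;
  normA : cseq -> R;
  inA_zero : inA szero;
  inA_add : forall a b, inA a -> inA b -> inA (sadd a b);
  inA_scal : forall c a, inA a -> inA (sscal c a);
  inA_mul : forall a b, inA a -> inA b -> inA (smul a b);
  inA_c00 : forall a, finite_seq a -> inA a;
  normA_nonneg : forall a, inA a -> 0 <= normA a;
  normA_zero : forall a, inA a -> normA a = 0 -> a = szero;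
  normA_scal : forall c a, inA a -> normA (sscal c a) = Cnorm c * normA a;
  normA_triangle : forall a b, inA a -> inA b -> normA (sadd a b) <= normA a + normA b;
  normA_mul : forall a b, inA a -> inA b -> normA (smul a b) <= normA a * normA b;
  c00_dense : forall a, inA a -> forall eps, eps > 0 ->
      exists b, finite_seq b /\ normA (sadd a (sopp b)) < eps;
  normA_pvec : forall n, normA (pvec n) = 1
}.

Record AModule (A : SeqAlg) : Type := {
  msp :> NormedSpace;
  act : cseq -> msp -> msp;
  act_add_r : forall a x y, inA A a -> act a (vadd msp x y) = vadd msp (act a x) (act a y);
  act_scal_r : forall a c x, inA A a -> act a (vscal msp c x) = vscal msp c (act a x);
  act_add_l : forall a b x, inA A a -> inA A b ->
      act (sadd a b) x = vadd msp (act a x) (act b x);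
  act_scal_l : forall c a x, inA A a -> act (sscal c a) x = vscal msp c (act a x);
  act_mul : forall a b x, inA A a -> inA A b -> act (smul a b) x = act a (act b x);
  act_contractive : forall a x, inA A a -> vnorm msp (act a x) <= normA A a * vnorm msp x
}.

Section ModuleNotions.
Variable A : SeqAlg.

Definition coord (X : AModule A) (n : nat) (x : X) : X := act X (pvec n) x.
Definition in_coord_subspace (X : AModule A) (n : nat) (y : X) : Prop :=
  exists x : X, y = coord X n x.

Fixpoint act_sum (X : AModule A) (l : list (cseq * X)) : X :=
  match l with
  | [] => vzero
  | (a, x) :: l' => vadd X (act X a x) (act_sum X l')
  end.
Definition essential (X : AModule A) : Prop :=
  forall x : X, forall eps, eps > 0 ->
    exists l : list (cseq * X), Forall (fun p => inA A (fst p)) l /\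
      vnorm X (vsub X x (act_sum X l)) < eps.
(* (linear combinations sum c_i a_i.x_i are absorbed as sum a_i.(c_i x_i)) *)

Definition homogeneous (X : AModule A) : Prop :=
  forall x y : X, (forall n, vnorm X (coord X n x) <= vnorm X (coord X n y)) ->
    vnorm X x <= vnorm X y.

Definition in_Hbar (X : AModule A) : Prop :=
  complete X /\ essential X /\ homogeneous X.

Definition op_bound {X Y : NormedSpace} (f : X -> Y) (M : R) : Prop :=
  0 <= M /\ forall x, vnorm Y (f x) <= M * vnorm X x.
Definition is_opnorm {X Y : NormedSpace} (f : X -> Y) (r : R) : Prop :=
  op_bound f r /\ forall M, op_bound f M -> r <= M.

Definition morphism {X Y : AModule A} (f : X -> Y) : Prop :=
  (forall x y, f (vadd X x y) = vadd Y (f x) (f y)) /\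
  (forall c x, f (vscal X c x) = vscal Y c (f x)) /\
  (forall a x, inA A a -> f (act X a x) = act Y a (f x)) /\
  (exists M, op_bound f M).

Definition coisometric {Y X : AModule A} (tau : Y -> X) : Prop :=
  op_bound tau 1 /\
  forall x : X, forall eps, eps > 0 ->
    exists y : Y, tau y = x /\ vnorm Y y < vnorm X x + eps.

Definition extremely_projective_Hbar (P : AModule A) : Prop :=
  forall (Y X : AModule A), in_Hbar Y -> in_Hbar X ->
  forall tau : Y -> X, morphism tau -> coisometric tau ->
  forall phi : P -> X, morphism phi ->
  forall eps, eps > 0 ->
    exists psi : P -> Y, morphism psi /\ (forall p, tau (psi p) = phi p) /\
      forall rphi, is_opnorm phi rphi ->
        exists rpsi, is_opnorm psi rpsi /\ rpsi < rphi + eps.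
End ModuleNotions.

Fixpoint fsum {Lam : Type} (f : Lam -> Cpx) (l : list Lam) : R :=
  match l with [] => 0 | i :: l' => Cnorm (f i) + fsum f l' end.
Definition l1_bound {Lam : Type} (f : Lam -> Cpx) (B : R) : Prop :=
  forall l : list Lam, NoDup l -> fsum f l <= B.
Definition in_l1 {Lam : Type} (f : Lam -> Cpx) : Prop := exists B, l1_bound f B.
Definition is_l1norm {Lam : Type} (f : Lam -> Cpx) (r : R) : Prop :=
  l1_bound f r /\ forall B, l1_bound f B -> r <= B.
Definition fadd {Lam : Type} (f g : Lam -> Cpx) : Lam -> Cpx := fun i => Cadd (f i) (g i).
Definition fscal {Lam : Type} (c : Cpx) (f : Lam -> Cpx) : Lam -> Cpx := fun i => Cmul c (f i).

Definition coord_iso_l1 {A : SeqAlg} (X : AModule A) (n : nat) {Lam : Type}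
    (T : (Lam -> Cpx) -> X) : Prop :=
  (forall f g, in_l1 f -> in_l1 g -> T (fadd f g) = vadd X (T f) (T g)) /\
  (forall c f, in_l1 f -> T (fscal c f) = vscal X c (T f)) /\
  (forall f, in_l1 f -> in_coord_subspace X n (T f)) /\
  (forall y, in_coord_subspace X n y -> exists f, in_l1 f /\ T f = y) /\
  (forall f r, in_l1 f -> is_l1norm f r -> vnorm X (T f) = r).

(* Main.v *)
(* Necessity.  The coordinate space E = X_n is an A-module through the n-th coefficient, and so is
   l1(E); lifting the projection X -> E along the canonical coisometry l1(E) -> E gives, for every
   eps, a section of norm < 1 + eps.  That such a Banach space E is isometric to an l1-space is
   Grothendieck's theorem, obtained here without duality: call a unit vector e a d-near-atom if some
   functional f satisfies f(e) ~ 1 and |f(x)| + |x - f(x) e| <= (1 + d) |x|.  A section writes each x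
   as a sum of multiples phi_s(x) s of total mass <= (1 + eps) |x|.  Almost maximising a strictly
   convex functional over all decompositions of x into a sum of vectors forces most pieces v to be
   split by any further section into multiples of vectors close to the line of v, and grouping these
   gives the functional f that makes v / |v| a near-atom.  Near-atoms converge to exact atoms, and
   atoms on distinct lines are isometrically l1-independent.

   Sufficiency.  A lifting is prescribed on the l1-bases of all the X_n.  Given a finite combination
   x, replace each coordinate of x by the multiple, of the same norm, of a basis vector at which phi
   almost attains its norm on X_n; homogeneity of X keeps the norm of the new vector x' below that of
   x, and homogeneity of Y bounds the lifting at x by any lift of phi(x'). *)

From Stdlib Require Import Reals List FinFun Lra Lia Psatz Classical ClassicalEpsilon  FunctionalExtensionality PropExtensionality.
Require Import Defs.
Import ListNotations.
Open Scope R_scope.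

(** * Complex scalars *)

(** The obstacle is that the sections for different [eps] are unrelated, and no compactness is
    available to pass to an exact one. Every structural statement therefore carries an error, and
    atoms arise as limits of vectors only, never of sections or functionals. The order of choices
    matters: the accuracy [d] determines a section of accuracy [theta], this one a finite set [F] of
    coordinates that almost exhausts [x], and [F] a stability threshold; the further section is
    chosen last and may be as fine as the threshold demands. The earlier section measures, through
    the Euclidean norm of the [F]-coordinates; the later one splits and supplies the functional.
    That Euclidean norm is blind to everything outside [F]. The rest is controlled by counting
    l1-mass, so a usable piece must also have nearly full mass on [F]. The convex functional carries
    a penalty, a large multiple of the norm: it makes the functional nonpositive, hence suprema
    finite, and keeps the total mass of the pieces close to the norm of [x]. *)

Definition Csub (z w : Cpx) : Cpx := Cadd z (Copp w).
Definition Cre (t : R) : Cpx := (t, 0).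
Definition Cinv (z : Cpx) : Cpx :=
  (fst z / (fst z * fst z + snd z * snd z), - snd z / (fst z * fst z + snd z * snd z)).

Lemma Cpx_eq (z w : Cpx) : fst z = fst w -> snd z = snd w -> z = w.
Proof. destruct z, w; simpl; intros -> ->; reflexivity. Qed.

Ltac cpx := intros; apply Cpx_eq; unfold Csub, Cadd, Copp, Cmul, C0, C1, Cre; simpl; try ring.

Lemma Cpx_ring : ring_theory C0 C1 Cadd Cmul Csub Copp (@eq Cpx).
Proof. constructor; cpx. Qed.
Add Ring Cpx_ring_inst : Cpx_ring.

Lemma Cinv_r (z : Cpx) : z <> C0 -> Cmul z (Cinv z) = C1.
Proof.
  intros Hz.
  assert (fst z * fst z + snd z * snd z <> 0) as Hn.
  { intros H. apply Hz, Cpx_eq; simpl; nra. }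
  apply Cpx_eq; unfold Cmul, Cinv, C1; simpl; field; exact Hn.
Qed.

Lemma Cnorm_nonneg (z : Cpx) : 0 <= Cnorm z.
Proof. apply sqrt_pos. Qed.

Lemma Cnorm_sq (z : Cpx) : Cnorm z * Cnorm z = fst z * fst z + snd z * snd z.
Proof. apply sqrt_sqrt; nra. Qed.

Lemma Cnorm_le_iff (z : Cpx) (t : R) : 0 <= t ->
  fst z * fst z + snd z * snd z <= t * t -> Cnorm z <= t.
Proof. intros Ht H. pose proof (Cnorm_nonneg z). pose proof (Cnorm_sq z). nra. Qed.

Lemma Cnorm_eq (z : Cpx) (t : R) : 0 <= t ->
  fst z * fst z + snd z * snd z = t * t -> Cnorm z = t.
Proof. intros Ht H. pose proof (Cnorm_nonneg z). pose proof (Cnorm_sq z). nra. Qed.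

Lemma Cnorm_mul (z w : Cpx) : Cnorm (Cmul z w) = Cnorm z * Cnorm w.
Proof.
  pose proof (Cnorm_nonneg z). pose proof (Cnorm_nonneg w).
  apply Cnorm_eq; [nra|].
  replace (Cnorm z * Cnorm w * (Cnorm z * Cnorm w))
    with ((Cnorm z * Cnorm z) * (Cnorm w * Cnorm w)) by ring.
  rewrite !Cnorm_sq. unfold Cmul; simpl; ring.
Qed.

Lemma Cnorm_re_le (z : Cpx) : Rabs (fst z) <= Cnorm z.
Proof.
  pose proof (Cnorm_nonneg z). pose proof (Cnorm_sq z).
  apply Rabs_le; nra.
Qed.

Lemma Cnorm_im_le (z : Cpx) : Rabs (snd z) <= Cnorm z.
Proof.
  pose proof (Cnorm_nonneg z). pose proof (Cnorm_sq z).
  apply Rabs_le; nra.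
Qed.

Lemma Cnorm_le_abs (z : Cpx) : Cnorm z <= Rabs (fst z) + Rabs (snd z).
Proof.
  pose proof (Rabs_pos (fst z)). pose proof (Rabs_pos (snd z)).
  apply Cnorm_le_iff; [lra|].
  assert (forall t, t * t = Rabs t * Rabs t) as Hsq.
  { intros t. rewrite <- Rabs_mult. symmetry; apply Rabs_pos_eq; nra. }
  rewrite (Hsq (fst z)), (Hsq (snd z)). nra.
Qed.

Lemma Cnorm_triangle (z w : Cpx) : Cnorm (Cadd z w) <= Cnorm z + Cnorm w.
Proof.
  pose proof (Cnorm_nonneg z). pose proof (Cnorm_nonneg w).
  pose proof (Cnorm_sq z). pose proof (Cnorm_sq w).
  apply Cnorm_le_iff; [lra|]. unfold Cadd; simpl.
  assert (fst z * fst w + snd z * snd w <= Cnorm z * Cnorm w); [|nra].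
  destruct (Rle_lt_dec (fst z * fst w + snd z * snd w) 0); [nra|].
  apply Rsqr_incr_0_var; [|nra]. unfold Rsqr.
  replace (Cnorm z * Cnorm w * (Cnorm z * Cnorm w))
    with ((Cnorm z * Cnorm z) * (Cnorm w * Cnorm w)) by ring.
  rewrite !Cnorm_sq. pose proof (Rle_0_sqr (fst z * snd w - snd z * fst w)).
  unfold Rsqr in *. nra.
Qed.

Lemma Cnorm_opp (z : Cpx) : Cnorm (Copp z) = Cnorm z.
Proof. unfold Cnorm, Copp; simpl; f_equal; ring. Qed.

Lemma Cnorm_re (t : R) : Cnorm (Cre t) = Rabs t.
Proof.
  apply Cnorm_eq; [apply Rabs_pos|]. simpl.
  rewrite <- Rabs_mult, Rabs_pos_eq; nra.
Qed.

Lemma Cnorm_0 : Cnorm C0 = 0.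
Proof. apply Cnorm_eq; simpl; lra. Qed.

Lemma Cnorm_1 : Cnorm C1 = 1.
Proof. apply Cnorm_eq; simpl; lra. Qed.

Lemma Cnorm_eq_0 (z : Cpx) : Cnorm z = 0 -> z = C0.
Proof. intros H. pose proof (Cnorm_sq z). rewrite H in *. apply Cpx_eq; simpl; nra. Qed.

Lemma Cnorm_inv (z : Cpx) : z <> C0 -> Cnorm (Cinv z) = / Cnorm z.
Proof.
  intros Hz. pose proof (Cnorm_mul z (Cinv z)) as H. rewrite Cinv_r, Cnorm_1 in H by assumption.
  assert (Cnorm z <> 0) by (intros H0; apply Hz, Cnorm_eq_0, H0).
  field_simplify_eq; [lra|assumption].
Qed.

(** * Reflexive linear algebra in a normed space *)

Lemma vadd_zero_l {V : NormedSpace} (x : V) : vadd V vzero x = x.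
Proof. rewrite vadd_comm. apply vadd_zero. Qed.

Lemma vadd_cancel_l {V : NormedSpace} (x y z : V) : vadd V x y = vadd V x z -> y = z.
Proof.
  intros H. rewrite <- (vadd_zero_l y), <- (vadd_zero_l z), <- (vadd_opp V x), (vadd_comm V x).
  rewrite <- !vadd_assoc, H. reflexivity.
Qed.

Lemma vscal_C0 {V : NormedSpace} (x : V) : vscal V C0 x = vzero.
Proof.
  apply (vadd_cancel_l (vscal V C0 x)). rewrite <- vscal_distr_r, vadd_zero. f_equal. ring.
Qed.

Lemma vscal_vzero {V : NormedSpace} (c : Cpx) : vscal V c vzero = vzero.
Proof.
  rewrite <- (vscal_C0 (@vzero V)), vscal_assoc. f_equal. ring.
Qed.

Lemma vopp_scal {V : NormedSpace} (x : V) : vopp V x = vscal V (Copp C1) x.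
Proof.
  apply (vadd_cancel_l x). rewrite vadd_opp.
  rewrite <- (vscal_one V x) at 1. rewrite <- vscal_distr_r.
  replace (Cadd C1 (Copp C1)) with C0 by ring. now rewrite vscal_C0.
Qed.

Section LinearReflection.
Variable V : NormedSpace.

Inductive vexp : Type :=
| EAtom (n : nat) | EZero | EAdd (a b : vexp) | EOpp (a : vexp) | EScal (c : Cpx) (a : vexp).

Fixpoint veval (env : list V) (e : vexp) : V :=
  match e with
  | EAtom n => nth n env vzero
  | EZero => vzero
  | EAdd a b => vadd V (veval env a) (veval env b)
  | EOpp a => vopp V (veval env a)
  | EScal c a => vscal V c (veval env a)
  end.

Fixpoint vcoef (e : vexp) (k : nat) : Cpx :=
  match e with
  | EAtom n => if Nat.eqb n k then C1 else C0
  | EZero => C0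
  | EAdd a b => Cadd (vcoef a k) (vcoef b k)
  | EOpp a => Copp (vcoef a k)
  | EScal c a => Cmul c (vcoef a k)
  end.

Fixpoint venv_comb (env : list V) (f : nat -> Cpx) : V :=
  match env with
  | [] => vzero
  | v :: env' => vadd V (vscal V (f O) v) (venv_comb env' (fun k => f (S k)))
  end.

Lemma venv_comb_zero env f : (forall k, f k = C0) -> venv_comb env f = vzero.
Proof.
  revert f; induction env as [|v env IH]; intros f Hf; simpl; [reflexivity|].
  rewrite IH by (intros; apply Hf). rewrite Hf, vscal_C0. apply vadd_zero.
Qed.

Lemma venv_comb_atom env n :
  nth n env vzero = venv_comb env (fun k => if Nat.eqb n k then C1 else C0).
Proof.
  revert n; induction env as [|v env IH]; intros [|n]; simpl; try reflexivity.
  - rewrite venv_comb_zero by reflexivity. now rewrite vscal_one, vadd_zero.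
  - rewrite vscal_C0, vadd_zero_l. apply IH.
Qed.

Lemma venv_comb_add env f g :
  vadd V (venv_comb env f) (venv_comb env g) = venv_comb env (fun k => Cadd (f k) (g k)).
Proof.
  revert f g; induction env as [|v env IH]; intros f g; simpl; [apply vadd_zero|].
  rewrite <- IH, vscal_distr_r, <- !vadd_assoc. f_equal.
  rewrite !vadd_assoc. f_equal. apply vadd_comm.
Qed.

Lemma venv_comb_scal env c f :
  vscal V c (venv_comb env f) = venv_comb env (fun k => Cmul c (f k)).
Proof.
  revert f; induction env as [|v env IH]; intros f; simpl; [apply vscal_vzero|].
  now rewrite <- IH, vscal_distr_l, vscal_assoc.
Qed.

Lemma veval_comb env e : veval env e = venv_comb env (vcoef e).
Proof.
  induction e as [n| |a IHa b IHb|a IHa|c a IHa]; simpl.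
  - apply venv_comb_atom.
  - now rewrite venv_comb_zero.
  - now rewrite IHa, IHb, venv_comb_add.
  - rewrite IHa, vopp_scal, venv_comb_scal. f_equal.
    apply functional_extensionality; intros k. ring.
  - now rewrite IHa, venv_comb_scal.
Qed.

Lemma venv_comb_ext env f g :
  map f (seq 0 (length env)) = map g (seq 0 (length env)) -> venv_comb env f = venv_comb env g.
Proof.
  revert f g; induction env as [|v env IH]; intros f g H; simpl; [reflexivity|].
  simpl in H. injection H as H0 H. rewrite H0. f_equal. apply IH.
  rewrite <- seq_shift, !map_map in H. exact H.
Qed.

(** Coefficients are compared as lists over the atoms of [env], so that the goal splits into one
    scalar identity per atom; scalars stay opaque to the reflection and are left to [ring]. *)
Lemma veval_eq env e1 e2 :
  map (vcoef e1) (seq 0 (length env)) = map (vcoef e2) (seq 0 (length env)) ->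
  veval env e1 = veval env e2.
Proof. rewrite !veval_comb. apply venv_comb_ext. Qed.
End LinearReflection.

Ltac vmem x l :=
  lazymatch l with
  | nil => constr:(false)
  | x :: _ => constr:(true)
  | _ :: ?l' => vmem x l'
  end.
Ltac vindex x l :=
  lazymatch l with
  | x :: _ => constr:(O)
  | _ :: ?l' => let n := vindex x l' in constr:(S n)
  end.
Ltac vatoms V e l :=
  lazymatch e with
  | vzero => l
  | vadd _ ?a ?b => let l1 := vatoms V a l in vatoms V b l1
  | vsub _ ?a ?b => let l1 := vatoms V a l in vatoms V b l1
  | vopp _ ?a => vatoms V a l
  | vscal _ _ ?a => vatoms V a l
  | ?x => let m := vmem x l in
          lazymatch m with true => l | false => constr:(@cons (carrier V) x l) end
  end.
Ltac vreify e l :=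
  lazymatch e with
  | vzero => constr:(EZero)
  | vadd _ ?a ?b => let a' := vreify a l in let b' := vreify b l in constr:(EAdd a' b')
  | vsub _ ?a ?b => let a' := vreify a l in let b' := vreify b l in constr:(EAdd a' (EOpp b'))
  | vopp _ ?a => let a' := vreify a l in constr:(EOpp a')
  | vscal _ ?c ?a => let a' := vreify a l in constr:(EScal c a')
  | ?x => let n := vindex x l in constr:(EAtom n)
  end.
(* Reduces an identity between linear combinations to one identity per coefficient. *)
Ltac vcoeffs V :=
  lazymatch goal with
  | |- ?a = ?b =>
    let l1 := vatoms V a (@nil (carrier V)) in
    let l := vatoms V b l1 in
    let ea := vreify a l in
    let eb := vreify b l in
    change (veval V l ea = veval V l eb); apply veval_eq;
    cbn [map seq length vcoef Nat.eqb]; repeat (apply (f_equal2 (@cons Cpx))); [..|reflexivity]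
  end.
Ltac vring V := vcoeffs V; try ring.

Lemma vnorm_vzero {V : NormedSpace} : vnorm V vzero = 0.
Proof. rewrite <- (vscal_C0 (@vzero V)), vnorm_scal, Cnorm_0. ring. Qed.

Lemma vnorm_opp {V : NormedSpace} (x : V) : vnorm V (vopp V x) = vnorm V x.
Proof. rewrite vopp_scal, vnorm_scal, Cnorm_opp, Cnorm_1. ring. Qed.

Lemma vnorm_sub_sym {V : NormedSpace} (x y : V) : vnorm V (vsub V x y) = vnorm V (vsub V y x).
Proof. rewrite <- vnorm_opp. f_equal. vring V. Qed.

Lemma vnorm_sub_le {V : NormedSpace} (x y : V) : vnorm V (vsub V x y) <= vnorm V x + vnorm V y.
Proof. rewrite <- (vnorm_opp y). apply vnorm_triangle. Qed.

Lemma vnorm_le_sub {V : NormedSpace} (x y : V) : vnorm V x <= vnorm V y + vnorm V (vsub V x y).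
Proof. replace x with (vadd V y (vsub V x y)) at 1 by vring V. apply vnorm_triangle. Qed.

Lemma vnorm_sub_trans {V : NormedSpace} (x y z : V) :
  vnorm V (vsub V x z) <= vnorm V (vsub V x y) + vnorm V (vsub V y z).
Proof.
  replace (vsub V x z) with (vadd V (vsub V x y) (vsub V y z)) by vring V.
  apply vnorm_triangle.
Qed.

Lemma vsub_diag {V : NormedSpace} (x : V) : vsub V x x = vzero.
Proof. apply vadd_opp. Qed.

Lemma vsub_eq_zero {V : NormedSpace} (x y : V) : vsub V x y = vzero -> x = y.
Proof.
  intros H. replace x with (vadd V (vsub V x y) y) by vring V. rewrite H. apply vadd_zero_l.
Qed.

Lemma vnorm_small_eq {V : NormedSpace} (x y : V) (C : R) :
  (forall eps, eps > 0 -> vnorm V (vsub V x y) <= C * eps) -> x = y.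
Proof.
  intros H. apply vsub_eq_zero, vnorm_zero.
  pose proof (vnorm_nonneg V (vsub V x y)) as Hn.
  destruct (Req_dec (vnorm V (vsub V x y)) 0) as [|Hne]; [assumption|exfalso].
  set (d := vnorm V (vsub V x y)) in *.
  assert (0 < 2 * (Rabs C + 1)) as HC by (pose proof (Rabs_pos C); lra).
  assert (d / (2 * (Rabs C + 1)) > 0) as Hp by (apply Rdiv_lt_0_compat; lra).
  specialize (H _ Hp).
  assert (d / (2 * (Rabs C + 1)) * (2 * (Rabs C + 1)) = d) by (field; lra).
  pose proof (Rle_abs C). nra.
Qed.

(** The restriction [eps <= 1] lets callers use estimates that hold only for small errors, such as
    those on near-atoms. *)
Lemma le_of_small (a b C : R) : (forall eps, 0 < eps <= 1 -> a <= b + C * eps) -> a <= b.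
Proof.
  intros H. apply Rnot_lt_le; intros Hab.
  pose proof (Rle_abs C). pose proof (Rabs_pos C).
  set (e := Rmin 1 ((a - b) / (2 * (Rabs C + 1)))).
  assert (0 < (a - b) / (2 * (Rabs C + 1))) by (apply Rdiv_lt_0_compat; lra).
  assert (0 < e <= 1) as He.
  { split; [apply Rmin_glb_lt; lra|apply Rmin_l]. }
  specialize (H e He).
  assert (e <= (a - b) / (2 * (Rabs C + 1))) as He2 by apply Rmin_r.
  assert ((a - b) / (2 * (Rabs C + 1)) * (2 * (Rabs C + 1)) = a - b) by (field; lra).
  nra.
Qed.

Definition vlinear {V W : NormedSpace} (f : V -> W) : Prop :=
  (forall x y, f (vadd V x y) = vadd W (f x) (f y)) /\
  (forall c x, f (vscal V c x) = vscal W c (f x)).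

Definition clinear {V : NormedSpace} (f : V -> Cpx) : Prop :=
  (forall x y, f (vadd V x y) = Cadd (f x) (f y)) /\
  (forall c x, f (vscal V c x) = Cmul c (f x)).

Lemma vlinear_zero {V W : NormedSpace} (f : V -> W) : vlinear f -> f vzero = vzero.
Proof. intros [_ Hs]. rewrite <- (vscal_C0 vzero), Hs. apply vscal_C0. Qed.

Lemma vlinear_sub {V W : NormedSpace} (f : V -> W) : vlinear f ->
  forall x y, f (vsub V x y) = vsub W (f x) (f y).
Proof. intros [Ha Hs] x y. unfold vsub. now rewrite Ha, !vopp_scal, Hs. Qed.

Lemma clinear_zero {V : NormedSpace} (f : V -> Cpx) : clinear f -> f vzero = C0.
Proof. intros [_ Hs]. rewrite <- (vscal_C0 vzero), Hs. ring. Qed.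

Lemma clinear_sub {V : NormedSpace} (f : V -> Cpx) : clinear f ->
  forall x y, f (vsub V x y) = Csub (f x) (f y).
Proof. intros [Ha Hs] x y. unfold vsub. rewrite Ha, !vopp_scal, Hs. ring. Qed.

(** * Finite sums *)

Fixpoint vsum {I : Type} {V : NormedSpace} (g : I -> V) (l : list I) : V :=
  match l with [] => vzero | i :: l' => vadd V (g i) (vsum g l') end.

Fixpoint rsum {I : Type} (g : I -> R) (l : list I) : R :=
  match l with [] => 0 | i :: l' => g i + rsum g l' end.

Lemma rsum_le {I : Type} (g h : I -> R) (l : list I) :
  (forall i, In i l -> g i <= h i) -> rsum g l <= rsum h l.
Proof.
  induction l as [|i l IH]; simpl; intros H; [lra|].
  apply Rplus_le_compat; auto.
Qed.

Lemma rsum_nonneg {I : Type} (g : I -> R) (l : list I) :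
  (forall i, In i l -> 0 <= g i) -> 0 <= rsum g l.
Proof.
  induction l as [|i l IH]; simpl; intros H; [lra|].
  pose proof (H i (or_introl eq_refl)). assert (0 <= rsum g l) by auto. lra.
Qed.

Lemma rsum_lin {I : Type} (a b : R) (g h : I -> R) (l : list I) :
  rsum (fun i => a * g i + b * h i) l = a * rsum g l + b * rsum h l.
Proof. induction l as [|i l IH]; simpl; [ring|rewrite IH; ring]. Qed.

Lemma rsum_scal {I : Type} (a : R) (g : I -> R) (l : list I) :
  rsum (fun i => a * g i) l = a * rsum g l.
Proof. induction l as [|i l IH]; simpl; [ring|rewrite IH; ring]. Qed.

Lemma rsum_ext {I : Type} (g h : I -> R) (l : list I) :
  (forall i, In i l -> g i = h i) -> rsum g l = rsum h l.
Proof. induction l as [|i l IH]; simpl; intros H; [reflexivity|f_equal; auto]. Qed.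

Lemma rsum_app {I : Type} (g : I -> R) (l l' : list I) : rsum g (l ++ l') = rsum g l + rsum g l'.
Proof. induction l as [|i l IH]; simpl; [ring|rewrite IH; ring]. Qed.

Lemma rsum_map {I K : Type} (h : K -> I) (g : I -> R) (l : list K) :
  rsum g (map h l) = rsum (fun k => g (h k)) l.
Proof. induction l as [|i l IH]; simpl; [reflexivity|now rewrite IH]. Qed.

Lemma rsum_term_le {I : Type} (g : I -> R) (l : list I) (i : I) :
  (forall j, In j l -> 0 <= g j) -> In i l -> g i <= rsum g l.
Proof.
  induction l as [|j l IH]; simpl; [easy|]; intros H [->|Hi].
  - assert (0 <= rsum g l) by (apply rsum_nonneg; auto). lra.
  - assert (g i <= rsum g l) by auto. specialize (H j (or_introl eq_refl)). lra.
Qed.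

Lemma rsum_filter {I : Type} (p : I -> bool) (g : I -> R) (l : list I) :
  rsum g l = rsum g (filter p l) + rsum g (filter (fun i => negb (p i)) l).
Proof.
  induction l as [|i l IH]; simpl; [ring|]. rewrite IH. destruct (p i); simpl; ring.
Qed.

Lemma rsum_const_le {I : Type} (g : I -> R) (t : R) (l : list I) :
  (forall i, In i l -> g i <= t) -> rsum g l <= INR (length l) * t.
Proof.
  induction l as [|i l IH]; intros H; [simpl; lra|].
  change (length (i :: l)) with (S (length l)). rewrite S_INR.
  assert (rsum g l <= INR (length l) * t) by (apply IH; intros; apply H; now right).
  specialize (H i (or_introl eq_refl)). simpl. lra.
Qed.

Lemma fsum_rsum {I : Type} (f : I -> Cpx) (l : list I) : fsum f l = rsum (fun i => Cnorm (f i)) l.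
Proof. induction l as [|i l IH]; simpl; [reflexivity|now rewrite IH]. Qed.

Section VectorSums.
Context {I : Type} {V : NormedSpace}.
Implicit Types (g h : I -> V) (l : list I).

Lemma vsum_app g l l' : vsum g (l ++ l') = vadd V (vsum g l) (vsum g l').
Proof.
  induction l as [|i l IH]; simpl; [now rewrite vadd_zero_l|]. now rewrite IH, vadd_assoc.
Qed.

Lemma vsum_ext g h l : (forall i, In i l -> g i = h i) -> vsum g l = vsum h l.
Proof. induction l as [|i l IH]; simpl; intros H; [reflexivity|f_equal; auto]. Qed.

Lemma vsum_zero g l : (forall i, In i l -> g i = vzero) -> vsum g l = vzero.
Proof.
  induction l as [|i l IH]; simpl; intros H; [reflexivity|].
  rewrite H, IH by auto. apply vadd_zero.
Qed.

Lemma vsum_add g h l : vsum (fun i => vadd V (g i) (h i)) l = vadd V (vsum g l) (vsum h l).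
Proof. induction l as [|i l IH]; simpl; [|rewrite IH]; vring V. Qed.

Lemma vsum_sub g h l : vsum (fun i => vsub V (g i) (h i)) l = vsub V (vsum g l) (vsum h l).
Proof. induction l as [|i l IH]; simpl; [|rewrite IH]; vring V. Qed.

Lemma vsum_scal c g l : vsum (fun i => vscal V c (g i)) l = vscal V c (vsum g l).
Proof. induction l as [|i l IH]; simpl; [|rewrite IH]; vring V. Qed.

Lemma vnorm_vsum g l : vnorm V (vsum g l) <= rsum (fun i => vnorm V (g i)) l.
Proof.
  induction l as [|i l IH]; simpl; [rewrite vnorm_vzero; lra|].
  eapply Rle_trans; [apply vnorm_triangle|lra].
Qed.

Lemma vsum_filter (p : I -> bool) g l :
  vsum g l = vadd V (vsum g (filter p l)) (vsum g (filter (fun i => negb (p i)) l)).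
Proof. induction l as [|i l IH]; simpl; [|rewrite IH; destruct (p i); simpl]; vring V. Qed.

Lemma vlinear_vsum {W : NormedSpace} (f : V -> W) g l : vlinear f ->
  f (vsum g l) = vsum (fun i => f (g i)) l.
Proof.
  intros Hf. induction l as [|i l IH]; simpl; [now apply vlinear_zero|].
  rewrite (proj1 Hf). now rewrite IH.
Qed.
End VectorSums.

Lemma vsum_map {I K : Type} {V : NormedSpace} (h : K -> I) (g : I -> V) (l : list K) :
  vsum g (map h l) = vsum (fun k => g (h k)) l.
Proof. induction l as [|i l IH]; simpl; [reflexivity|now rewrite IH]. Qed.

Lemma vsum_flat_map {I K : Type} {V : NormedSpace} (h : K -> list I) (g : I -> V) (l : list K) :
  vsum g (flat_map h l) = vsum (fun k => vsum g (h k)) l.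
Proof. induction l as [|i l IH]; simpl; [reflexivity|now rewrite vsum_app, IH]. Qed.

Lemma rsum_flat_map {I K : Type} (h : K -> list I) (g : I -> R) (l : list K) :
  rsum g (flat_map h l) = rsum (fun k => rsum g (h k)) l.
Proof. induction l as [|i l IH]; simpl; [reflexivity|now rewrite rsum_app, IH]. Qed.

Definition lcomb {I : Type} {V : NormedSpace} (v : I -> V) (l : list (Cpx * I)) : V :=
  vsum (fun p => vscal V (fst p) (v (snd p))) l.

Definition wsum {I : Type} {V : NormedSpace} (v : I -> V) (f : I -> Cpx) (l : list I) : V :=
  vsum (fun i => vscal V (f i) (v i)) l.

Lemma lcomb_scal {I : Type} {V : NormedSpace} (v : I -> V) c (l : list (Cpx * I)) :
  lcomb v (map (fun p => (Cmul c (fst p), snd p)) l) = vscal V c (lcomb v l).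
Proof.
  unfold lcomb. rewrite vsum_map, <- vsum_scal. apply vsum_ext; intros; simpl.
  symmetry; apply vscal_assoc.
Qed.

Lemma wsum_lcomb {I : Type} {V : NormedSpace} (v : I -> V) (f : I -> Cpx) (l : list I) :
  wsum v f l = lcomb v (map (fun i => (f i, i)) l).
Proof. unfold lcomb, wsum. now rewrite vsum_map. Qed.

Lemma vnorm_wsum {I : Type} {V : NormedSpace} (v : I -> V) (f : I -> Cpx) (l : list I) :
  (forall i, In i l -> vnorm V (v i) <= 1) -> vnorm V (wsum v f l) <= fsum f l.
Proof.
  intros Hv. unfold wsum. eapply Rle_trans; [apply vnorm_vsum|]. rewrite fsum_rsum.
  apply rsum_le; intros i Hi. rewrite vnorm_scal.
  pose proof (Cnorm_nonneg (f i)). specialize (Hv i Hi). nra.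
Qed.

Lemma wsum_add_at {I : Type} (L : list I) (f : I -> Cpx) (i : I) (c : Cpx) :
  NoDup L -> In i L ->
  exists f' : I -> Cpx, forall (V : NormedSpace) (v : I -> V),
    wsum v f' L = vadd V (vscal V c (v i)) (wsum v f L).
Proof.
  intros HL Hi.
  exists (fun j => if excluded_middle_informative (j = i) then Cadd c (f j) else f j).
  intros V v. unfold wsum. induction HL as [|j L Hj HL IH]; [easy|]; simpl.
  destruct (excluded_middle_informative (j = i)) as [->|Hji].
  - rewrite (vsum_ext _ (fun k => vscal V (f k) (v k)) L).
    + vring V.
    + intros k Hk. destruct (excluded_middle_informative (k = i)) as [->|]; [contradiction|reflexivity].
  - destruct Hi as [->|Hi]; [contradiction|]. rewrite IH by assumption. vring V.
Qed.

(** Repeated indices are merged before [V] and [v] are given. Two families over the same index set,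
    one in the source and one in the target of an operator, are thus rewritten with the same
    duplicate-free list and coefficients. *)
Lemma lcomb_collect {I : Type} (P : I -> Prop) (l : list (Cpx * I)) :
  (forall p, In p l -> P (snd p)) ->
  exists (L : list I) (f : I -> Cpx), NoDup L /\ (forall i, In i L -> P i) /\
    forall (V : NormedSpace) (v : I -> V), lcomb v l = wsum v f L.
Proof.
  induction l as [|[c i] l IH]; intros HP.
  - exists [], (fun _ => C0). repeat split; [constructor|easy].
  - destruct IH as (L & f & HL & HLP & Heq); [intros; apply HP; now right|].
    destruct (classic (In i L)) as [Hi|Hi].
    + destruct (wsum_add_at L f i c HL Hi) as [f' Hf'].
      exists L, f'. repeat split; [assumption..|]. intros V v. rewrite Hf', <- Heq. reflexivity.
    + exists (i :: L), (fun j => if excluded_middle_informative (j = i) then c else f j).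
      repeat split.
      * now constructor.
      * intros j [<-|Hj]; [apply (HP (c, i)); now left|auto].
      * intros V v. unfold lcomb, wsum in *; simpl. rewrite Heq.
        destruct (excluded_middle_informative (i = i)) as [_|]; [|easy]. f_equal.
        apply vsum_ext; intros j Hj.
        destruct (excluded_middle_informative (j = i)) as [->|]; [contradiction|reflexivity].
Qed.

(** * Closed linear spans *)

Definition in_closed_span {V : NormedSpace} (B : V -> Prop) (x : V) : Prop :=
  forall eps, eps > 0 -> exists l : list (Cpx * V),
    (forall p, In p l -> B (snd p)) /\ vnorm V (vsub V x (lcomb (fun v => v) l)) < eps.

Section ClosedSpan.
Context {V : NormedSpace} (B : V -> Prop).

Lemma closed_span_add x y :
  in_closed_span B x -> in_closed_span B y -> in_closed_span B (vadd V x y).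
Proof.
  intros Hx Hy eps He.
  destruct (Hx (eps / 2)) as (l & Hl & Hlx); [lra|].
  destruct (Hy (eps / 2)) as (l' & Hl' & Hly); [lra|].
  exists (l ++ l'). split.
  - intros p Hp. apply in_app_or in Hp. destruct Hp; auto.
  - unfold lcomb in *. rewrite vsum_app. set (a := vsum _ l) in *. set (b := vsum _ l') in *.
    replace (vsub V (vadd V x y) (vadd V a b)) with (vadd V (vsub V x a) (vsub V y b)) by vring V.
    pose proof (vnorm_triangle V (vsub V x a) (vsub V y b)). lra.
Qed.

Lemma closed_span_scal c x : in_closed_span B x -> in_closed_span B (vscal V c x).
Proof.
  intros Hx eps He. pose proof (Cnorm_nonneg c).
  destruct (Hx (eps / (Cnorm c + 1))) as (l & Hl & Hlx); [apply Rdiv_lt_0_compat; lra|].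
  exists (map (fun p => (Cmul c (fst p), snd p)) l). split.
  - intros p Hp. apply in_map_iff in Hp. destruct Hp as (q & <- & Hq). exact (Hl q Hq).
  - rewrite lcomb_scal. set (a := lcomb _ l) in *.
    replace (vsub V (vscal V c x) (vscal V c a)) with (vscal V c (vsub V x a)) by vring V.
    rewrite vnorm_scal. pose proof (vnorm_nonneg V (vsub V x a)).
    assert (eps / (Cnorm c + 1) * (Cnorm c + 1) = eps) by (field; lra). nra.
Qed.

Lemma closed_span_zero : in_closed_span B vzero.
Proof.
  intros eps He. exists []. split; [easy|]. unfold lcomb; simpl.
  now rewrite vsub_diag, vnorm_vzero.
Qed.

Lemma closed_span_elem v : B v -> in_closed_span B v.
Proof.
  intros Hv eps He. exists [(C1, v)]. split; [now intros p [<-|[]]|].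
  unfold lcomb; simpl. rewrite vadd_zero, vscal_one, vsub_diag. now rewrite vnorm_vzero.
Qed.

Lemma closed_span_lim x :
  (forall eps, eps > 0 -> exists y, in_closed_span B y /\ vnorm V (vsub V x y) < eps) ->
  in_closed_span B x.
Proof.
  intros H eps He. destruct (H (eps / 2)) as (y & Hy & Hxy); [lra|].
  destruct (Hy (eps / 2)) as (l & Hl & Hly); [lra|].
  exists l; split; [assumption|].
  pose proof (vnorm_sub_trans x y (lcomb (fun v => v) l)). lra.
Qed.

Lemma closed_span_vsum {I : Type} (g : I -> V) l :
  (forall i, In i l -> in_closed_span B (g i)) -> in_closed_span B (vsum g l).
Proof.
  induction l as [|i l IH]; simpl; intros H; [apply closed_span_zero|].
  apply closed_span_add; auto.
Qed.
End ClosedSpan.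

Lemma closed_span_trans {V : NormedSpace} (B B' : V -> Prop) :
  (forall v, B v -> in_closed_span B' v) ->
  forall x, in_closed_span B x -> in_closed_span B' x.
Proof.
  intros HB x Hx. apply closed_span_lim. intros eps He. destruct (Hx eps He) as (l & Hl & Hlx).
  exists (lcomb (fun v => v) l). split; [|assumption].
  apply closed_span_vsum. intros p Hp. apply closed_span_scal, HB, Hl, Hp.
Qed.

(** * Extension of a bounded densely defined operator given by its graph *)

Lemma inv_INR_small (eps : R) : eps > 0 -> exists N, forall n, (n >= N)%nat -> / INR (S n) < eps.
Proof.
  intros He. destruct (archimed_cor1 eps He) as (N & HN & HN0). exists N. intros n Hn.
  eapply Rle_lt_trans; [|exact HN]. apply Rinv_le_contravar; [apply lt_0_INR; lia|].
  apply le_INR; lia.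
Qed.

Section Extension.
Context {V W : NormedSpace} (G : V -> W -> Prop) (C : R).
Hypotheses (HC : 0 <= C) (HW : complete W)
  (Gadd : forall x y x' y', G x y -> G x' y' -> G (vadd V x x') (vadd W y y'))
  (Gscal : forall c x y, G x y -> G (vscal V c x) (vscal W c y))
  (Gbound : forall x y, G x y -> vnorm W y <= C * vnorm V x)
  (Gdense : forall x eps, eps > 0 -> exists x' y', G x' y' /\ vnorm V (vsub V x x') < eps).

Let H (x : V) (y : W) : Prop := forall eps, eps > 0 -> exists x' y', G x' y' /\
  vnorm V (vsub V x x') < eps /\ vnorm W (vsub W y y') < eps.

Let Hadd x y x' y' : H x y -> H x' y' -> H (vadd V x x') (vadd W y y').
Proof.
  intros H1 H2 eps He.
  destruct (H1 (eps / 2)) as (a & b & Hab & Ha & Hb); [lra|].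
  destruct (H2 (eps / 2)) as (a' & b' & Hab' & Ha' & Hb'); [lra|].
  exists (vadd V a a'), (vadd W b b'). split; [auto|].
  replace (vsub V (vadd V x x') (vadd V a a'))
    with (vadd V (vsub V x a) (vsub V x' a')) by vring V.
  replace (vsub W (vadd W y y') (vadd W b b'))
    with (vadd W (vsub W y b) (vsub W y' b')) by vring W.
  pose proof (vnorm_triangle V (vsub V x a) (vsub V x' a')).
  pose proof (vnorm_triangle W (vsub W y b) (vsub W y' b')). lra.
Qed.

Let Hscal c x y : H x y -> H (vscal V c x) (vscal W c y).
Proof.
  intros H1 eps He. pose proof (Cnorm_nonneg c).
  destruct (H1 (eps / (Cnorm c + 1))) as (a & b & Hab & Ha & Hb); [apply Rdiv_lt_0_compat; lra|].
  exists (vscal V c a), (vscal W c b). split; [auto|].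
  replace (vsub V (vscal V c x) (vscal V c a)) with (vscal V c (vsub V x a)) by vring V.
  replace (vsub W (vscal W c y) (vscal W c b)) with (vscal W c (vsub W y b)) by vring W.
  rewrite !vnorm_scal. pose proof (vnorm_nonneg V (vsub V x a)).
  pose proof (vnorm_nonneg W (vsub W y b)).
  assert (eps / (Cnorm c + 1) * (Cnorm c + 1) = eps) by (field; lra). split; nra.
Qed.

Let Hbound x y : H x y -> vnorm W y <= C * vnorm V x.
Proof.
  intros H1. apply le_of_small with (C := 1 + C). intros eps He.
  destruct (H1 eps) as (a & b & Hab & Ha & Hb); [lra|].
  pose proof (Gbound _ _ Hab). pose proof (vnorm_le_sub y b). pose proof (vnorm_le_sub a x).
  rewrite (vnorm_sub_sym a x) in *. nra.
Qed.

Let Hunique x y y' : H x y -> H x y' -> y = y'.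
Proof.
  intros H1 H2. apply vsub_eq_zero, vnorm_zero.
  assert (H (vsub V x x) (vsub W y y')) as H3.
  { unfold vsub. rewrite !vopp_scal. now apply Hadd; [|apply Hscal]. }
  apply Hbound in H3. rewrite vsub_diag, vnorm_vzero in H3.
  pose proof (vnorm_nonneg W (vsub W y y')). lra.
Qed.

Let Gdiff_bound x y x' y' :
  G x y -> G x' y' -> vnorm W (vsub W y y') <= C * vnorm V (vsub V x x').
Proof.
  intros H1 H2. apply Gbound. unfold vsub. rewrite !vopp_scal. now apply Gadd; [|apply Gscal].
Qed.

Let Htotal x : exists y, H x y.
Proof.
  assert (forall n, exists p : V * W, G (fst p) (snd p) /\
    vnorm V (vsub V x (fst p)) < / INR (S n)) as Hn.
  { intros n. destruct (Gdense x (/ INR (S n))) as (a & b & Hab & Ha).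
    - apply Rinv_0_lt_compat, lt_0_INR; lia.
    - now exists (a, b). }
  set (u := fun n => proj1_sig (constructive_indefinite_description _ (Hn n))).
  assert (forall n, G (fst (u n)) (snd (u n)) /\
    vnorm V (vsub V x (fst (u n))) < / INR (S n)) as Hu.
  { intros n. unfold u. apply (proj2_sig (constructive_indefinite_description _ (Hn n))). }
  destruct (HW (fun n => snd (u n))) as [y Hy].
  - intros eps He. destruct (inv_INR_small (eps / (2 * (C + 1)))) as [N HN].
    { apply Rdiv_lt_0_compat; lra. }
    exists N. intros m k Hm Hk. destruct (Hu m) as [Gm Hm']. destruct (Hu k) as [Gk Hk'].
    pose proof (Gdiff_bound _ _ _ _ Gm Gk) as Hd.
    pose proof (vnorm_sub_trans (fst (u m)) x (fst (u k))) as Ht.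
    rewrite (vnorm_sub_sym (fst (u m)) x) in Ht.
    specialize (HN m Hm) as HNm. specialize (HN k Hk) as HNk.
    assert (eps / (2 * (C + 1)) * (2 * (C + 1)) = eps) by (field; lra).
    pose proof (vnorm_nonneg V (vsub V (fst (u m)) (fst (u k)))). nra.
  - exists y. intros eps He. destruct (Hy eps He) as [N1 H1].
    destruct (inv_INR_small eps He) as [N2 H2].
    destruct (Hu (N1 + N2)%nat) as [HG Hx].
    exists (fst (u (N1 + N2)%nat)), (snd (u (N1 + N2)%nat)).
    split; [assumption|]. split.
    + specialize (H2 (N1 + N2)%nat). eapply Rlt_trans; [exact Hx|apply H2; lia].
    + rewrite vnorm_sub_sym. apply H1. lia.
Qed.

(** A relation is extended, not a function, because the data are formal combinations and a vector
    may have several. The closure [H] of [G] is single-valued by its bound at zero and total by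
    completeness of [W]. *)
Lemma graph_extension : exists psi : V -> W, vlinear psi /\
  (forall x, vnorm W (psi x) <= C * vnorm V x) /\
  (forall x y, G x y -> psi x = y).
Proof.
  set (psi := fun x => proj1_sig (constructive_indefinite_description _ (Htotal x))).
  assert (forall x, H x (psi x)) as Hpsi.
  { intros x. apply (proj2_sig (constructive_indefinite_description _ (Htotal x))). }
  exists psi. repeat split.
  - intros x y. eapply Hunique; [apply Hpsi|apply Hadd; apply Hpsi].
  - intros c x. eapply Hunique; [apply Hpsi|apply Hscal; apply Hpsi].
  - intros x. apply Hbound, Hpsi.
  - intros x y Hxy. eapply Hunique; [apply Hpsi|]. intros eps He. exists x, y.
    rewrite !vsub_diag, !vnorm_vzero. auto.
Qed.
End Extension.

(** Makes the lemmas on [vsum] and [vlinear] available for sums of scalars and for functionals. *)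
Definition Cspace : NormedSpace.
Proof.
  refine {| carrier := Cpx; vzero := C0; vadd := Cadd; vopp := Copp; vscal := Cmul; vnorm := Cnorm |};
    try (intros; ring).
  - exact Cnorm_nonneg.
  - exact Cnorm_eq_0.
  - exact Cnorm_mul.
  - exact Cnorm_triangle.
Defined.

Lemma vscal_csum {I : Type} {V : NormedSpace} (g : I -> Cpx) (w : V) (l : list I) :
  vscal V (@vsum I Cspace g l) w = vsum (fun i => vscal V (g i) w) l.
Proof.
  induction l as [|i l IH]; simpl; [apply vscal_C0|]. rewrite vscal_distr_r. f_equal. exact IH.
Qed.

Lemma rsum_filter_le {I : Type} (p : I -> bool) (g : I -> R) (l : list I) :
  (forall i, In i l -> 0 <= g i) -> rsum g (filter p l) <= rsum g l.
Proof.
  intros H. rewrite (rsum_filter p g l).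
  assert (0 <= rsum g (filter (fun i => negb (p i)) l)); [|lra].
  apply rsum_nonneg; intros i Hi. apply filter_In in Hi. apply H, Hi.
Qed.

Definition decide (P : Prop) : bool := if excluded_middle_informative P then true else false.

Lemma decide_true (P : Prop) : decide P = true <-> P.
Proof. unfold decide. destruct (excluded_middle_informative P); easy. Qed.

Lemma decide_false (P : Prop) : negb (decide P) = true <-> ~ P.
Proof. unfold decide. destruct (excluded_middle_informative P); easy. Qed.

(** * Almost maximal decompositions *)

Section Decompositions.
Context {E : NormedSpace} (J : E -> R).
Hypothesis J_neg : forall v, J v <= 0.

Definition vtotal (l : list E) : E := vsum (fun v => v) l.

(** The gain is measured relative to the norm of [v], so that splitting all unstable pieces gains at
    least [w] times their total mass. *)
Definition unstable (w : R) (v : E) : Prop :=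
  exists p, vtotal p = v /\ rsum J p > J v + w * vnorm E v.

(* Choquet's argument: in a decomposition almost maximising the sum of J, splitting a piece further
   gains little, except for pieces of small total mass. *)
Lemma almost_stable_decomposition (x : E) (w eta : R) : w > 0 -> eta > 0 ->
  exists l, vtotal l = x /\ J x <= rsum J l /\
    rsum (fun v => if decide (unstable w v) then vnorm E v else 0) l <= eta.
Proof.
  intros Hw Heta.
  destruct (completeness (fun t => exists l, vtotal l = x /\ t = rsum J l)) as [s [Hs1 Hs2]].
  { exists 0. intros t (l & _ & ->). clear - J_neg.
    induction l as [|v l IH]; simpl; [lra|]. specialize (J_neg v). lra. }
  { exists (J x), [x]. unfold vtotal; simpl. rewrite vadd_zero. split; [reflexivity|ring]. }
  assert (exists l, vtotal l = x /\ J x <= rsum J l /\ s - w * eta < rsum J l) as (l & Hl & HJ & Hls).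
  { assert (s - w * eta < s) by nra.
    (* The decomposition must be almost optimal and also at least as good as [[x]]. If [[x]] is
       almost optimal it is taken; otherwise any almost optimal one beats it. *)
    destruct (Rlt_le_dec (s - w * eta) (J x)) as [Hlt|Hle].
    - exists [x]. unfold vtotal; simpl. rewrite vadd_zero. repeat split; lra.
    - apply NNPP. intros Hn. apply (Rlt_not_le s (s - w * eta)); [assumption|].
      apply Hs2. intros t (l & Hl & ->). apply Rnot_lt_le. intros Hlt. apply Hn.
      exists l. repeat split; [assumption|lra|lra]. }
  exists l. split; [assumption|]. split; [assumption|].
  assert (forall v, exists p, vtotal p = v /\
    J v + w * (if decide (unstable w v) then vnorm E v else 0) <= rsum J p) as Hp.
  { intros v. unfold decide. destruct (excluded_middle_informative (unstable w v)) as [(p & Hp & HJp)|].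
    - exists p. split; [assumption|lra].
    - exists [v]. unfold vtotal; simpl. rewrite vadd_zero. split; [reflexivity|lra]. }
  apply choice in Hp. destruct Hp as [h Hh].
  (* Splitting every unstable piece gives another decomposition of [x], which cannot exceed the
     supremum; so the gain is less than [w * eta]. *)
  assert (rsum J (flat_map h l) <= s) as Hfin.
  { apply Hs1. exists (flat_map h l). split; [|reflexivity].
    unfold vtotal. rewrite vsum_flat_map, <- Hl. apply vsum_ext; intros; apply Hh. }
  rewrite rsum_flat_map in Hfin.
  assert (rsum (fun v => 1 * J v + w * (if decide (unstable w v) then vnorm E v else 0)) l
    <= rsum (fun v => rsum J (h v)) l) as Hle.
  { apply rsum_le; intros v _. destruct (Hh v). lra. }
  rewrite rsum_lin in Hle. apply Rmult_le_reg_l with w; lra.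
Qed.
End Decompositions.

(** * Near-atoms *)

(** For [d = 0] this says that sending [x] to [f x] times [e] is an L-projection of rank one. *)
Definition near_atom {E : NormedSpace} (d : R) (e : E) (f : E -> Cpx) : Prop :=
  vnorm E e = 1 /\ clinear f /\ Cnorm (Csub C1 (f e)) <= d /\
  forall x, Cnorm (f x) + vnorm E (vsub E x (vscal E (f x) e)) <= (1 + d) * vnorm E x.

(** Coordinates of a section of the map from l1 that sends the unit vectors to the [b i]. Its norm
    bound is recorded through finite lists only: mass on [L] plus the norm in [E] of what [L]
    misses. *)
Definition approx_section {I : Type} {E : NormedSpace} (b : I -> E) (eps : R)
    (phi : I -> E -> Cpx) : Prop :=
  (forall i, clinear (phi i)) /\
  (forall L y, NoDup L -> fsum (fun i => phi i y) L
     + vnorm E (vsub E y (wsum b (fun i => phi i y) L)) <= (1 + eps) * vnorm E y) /\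
  (forall y eta, eta > 0 -> exists L, NoDup L /\
     vnorm E (vsub E y (wsum b (fun i => phi i y) L)) < eta).

Section Functional.
Context {I : Type} {E : NormedSpace} (b : I -> E) (phi : I -> E -> Cpx) (eps nu : R).
Hypotheses (Hb : forall i, vnorm E (b i) <= 1) (Hphi : approx_section b eps phi)
  (Heps : eps <= nu) (Hnu : 0 < nu <= 1).
Context (v : E) (L : list I) (alpha : I -> R).
Hypotheses (Hv : 0 < vnorm E v) (HL : NoDup L)
  (Hrem : vnorm E (vsub E v (wsum b (fun i => phi i v) L)) <= nu * vnorm E v)
  (Hconc : rsum (fun i => vnorm E (vsub E (vscal E (phi i v) (b i)) (vscal E (Cre (alpha i)) v))) L
     <= nu * nu * vnorm E v).

(** Markov's inequality: by [Hconc] the bad indices carry mass at most [nu] times the norm of [v].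
    For a good index, division by [phi i v] puts [b i] within [nu] of [beta i] times [v]. *)
Let good (i : I) : Prop := phi i v <> C0 /\
  vnorm E (vsub E (vscal E (phi i v) (b i)) (vscal E (Cre (alpha i)) v)) <= nu * Cnorm (phi i v).
Let beta (i : I) : Cpx := Cmul (Cre (alpha i)) (Cinv (phi i v)).
Let J := filter (fun i => decide (good i)) L.

Let beta_close i : In i J -> vnorm E (vsub E (b i) (vscal E (beta i) v)) <= nu.
Proof.
  intros Hi. apply filter_In in Hi. destruct Hi as [_ Hi].
  apply (proj1 (decide_true _)) in Hi. destruct Hi as [Hne Hi].
  replace (vsub E (vscal E (phi i v) (b i)) (vscal E (Cre (alpha i)) v))
    with (vscal E (phi i v) (vsub E (b i) (vscal E (beta i) v))) in Hi.
  - rewrite vnorm_scal in Hi. rewrite Rmult_comm in Hi.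
    apply Rmult_le_reg_r in Hi; [assumption|].
    pose proof (Cnorm_nonneg (phi i v)). destruct (Req_dec (Cnorm (phi i v)) 0); [|lra].
    exfalso; now apply Hne, Cnorm_eq_0.
  - vcoeffs E; [|ring]. unfold beta.
    transitivity (Cmul (Cmul (phi i v) (Cinv (phi i v))) (Copp (Cre (alpha i)))); [ring|].
    rewrite Cinv_r by assumption. ring.
Qed.

Let f (x : E) : Cpx := @vsum I Cspace (fun i => Cmul (phi i x) (beta i)) J.

Let f_scal x w : vscal E (f x) w = vsum (fun i => vscal E (Cmul (phi i x) (beta i)) w) J.
Proof.
  apply vscal_csum.
Qed.

Let remainder x : vsub E x (vscal E (f x) v)
  = vadd E (vsub E x (wsum b (fun i => phi i x) J))
      (vsum (fun i => vscal E (phi i x) (vsub E (b i) (vscal E (beta i) v))) J).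
Proof.
  rewrite f_scal. unfold wsum.
  rewrite (vsum_ext (fun i => vscal E (phi i x) (vsub E (b i) (vscal E (beta i) v)))
    (fun i => vsub E (vscal E (phi i x) (b i)) (vscal E (Cmul (phi i x) (beta i)) v))).
  - rewrite vsum_sub. set (A := vsum _ J). set (A' := vsum _ J). vring E.
  - intros i _. vring E.
Qed.

Let remainder_sum x :
  vnorm E (vsum (fun i => vscal E (phi i x) (vsub E (b i) (vscal E (beta i) v))) J)
  <= nu * fsum (fun i => phi i x) J.
Proof.
  eapply Rle_trans; [apply vnorm_vsum|]. rewrite fsum_rsum, <- rsum_scal.
  apply rsum_le; intros i Hi. rewrite vnorm_scal. pose proof (beta_close i Hi).
  pose proof (Cnorm_nonneg (phi i x)). nra.
Qed.

Let HJ : NoDup J.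
Proof. apply NoDup_filter, HL. Qed.

(** In the good part of the expansion of [x], [f] replaces each [b i] by its neighbour on the line
    of [v]. The bound on coefficients plus remainder in [approx_section] becomes one on the
    coefficient along [v] plus its remainder; the factor [(1 + 2 * nu) * (1 + nu)] leads to the
    constant 5. *)
Lemma concentrated_functional : exists g : E -> Cpx, clinear g /\
  Cnorm (Csub C1 (g v)) <= 5 * nu /\
  forall x, Cnorm (g x) * vnorm E v + vnorm E (vsub E x (vscal E (g x) v))
    <= (1 + 5 * nu) * vnorm E x.
Proof.
  destruct Hphi as (Hlin & Hbd & _). exists f. split; [|split].
  - split.
    + intros x y. unfold f. rewrite <- (@vsum_add I Cspace). apply (@vsum_ext I Cspace); intros i _.
      rewrite (proj1 (Hlin i)). simpl; ring.
    + intros c x. unfold f. rewrite <- (@vsum_scal I Cspace). apply (@vsum_ext I Cspace); intros i _.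
      rewrite (proj2 (Hlin i)). simpl; ring.
  - apply Rmult_le_reg_r with (vnorm E v); [assumption|].
    rewrite <- vnorm_scal.
    replace (vscal E (Csub C1 (f v)) v) with (vsub E v (vscal E (f v) v)) by vring E.
    rewrite remainder. eapply Rle_trans; [apply vnorm_triangle|].
    pose proof (remainder_sum v) as H1. pose proof (Hbd J v HJ) as H2.
    pose proof (vnorm_nonneg E (vsub E v (wsum b (fun i => phi i v) J))).
    set (J' := filter (fun i => negb (decide (good i))) L).
    (* Markov's inequality for the bad indices; one with [phi i v = C0] is harmless, having no
       mass. *)
    assert (vnorm E (wsum b (fun i => phi i v) J') <= nu * vnorm E v) as H3.
    { eapply Rle_trans; [apply vnorm_wsum; intros; apply Hb|]. rewrite fsum_rsum.
      apply Rmult_le_reg_l with nu; [lra|]. rewrite <- rsum_scal, <- Rmult_assoc.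
      eapply Rle_trans; [|exact Hconc]. eapply Rle_trans; [|apply (rsum_filter_le
        (fun i => negb (decide (good i)))); intros; apply vnorm_nonneg].
      apply rsum_le; intros i Hi. apply filter_In in Hi. destruct Hi as [_ Hi].
      apply (proj1 (decide_false _)) in Hi. apply Rnot_lt_le; intros Hlt. apply Hi. split; [|lra].
      intros H0. rewrite H0, Cnorm_0, Rmult_0_r in Hlt. revert Hlt. apply Rle_not_lt.
      apply vnorm_nonneg. }
    assert (vsub E v (wsum b (fun i => phi i v) J) = vadd E
      (vsub E v (wsum b (fun i => phi i v) L)) (wsum b (fun i => phi i v) J')) as ->.
    { unfold wsum. rewrite (vsum_filter (fun i => decide (good i)) _ L). fold J. fold J'.
      set (A := vsum _ J). set (A' := vsum _ J'). vring E. }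
    pose proof (vnorm_triangle E (vsub E v (wsum b (fun i => phi i v) L))
      (wsum b (fun i => phi i v) J')).
    assert (fsum (fun i => phi i v) J <= 2 * vnorm E v) by nra. nra.
  - intros x. rewrite remainder. pose proof (remainder_sum x) as H1. pose proof (Hbd J x HJ) as H2.
    pose proof (vnorm_triangle E (vsub E x (wsum b (fun i => phi i x) J))
      (vsum (fun i => vscal E (phi i x) (vsub E (b i) (vscal E (beta i) v))) J)).
    assert (Cnorm (f x) * vnorm E v <= (1 + nu) * fsum (fun i => phi i x) J).
    { rewrite <- vnorm_scal, f_scal. eapply Rle_trans; [apply vnorm_vsum|].
      rewrite fsum_rsum, <- rsum_scal. apply rsum_le; intros i Hi.
      rewrite <- vscal_assoc, vnorm_scal. pose proof (beta_close i Hi).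
      pose proof (vnorm_le_sub (vscal E (beta i) v) (b i)) as H5.
      rewrite (vnorm_sub_sym _ (b i)) in H5. specialize (Hb i).
      pose proof (Cnorm_nonneg (phi i x)). nra. }
    pose proof (vnorm_nonneg E x).
    pose proof (vnorm_nonneg E (vsub E x (wsum b (fun i => phi i x) J))).
    assert (0 <= fsum (fun i => phi i x) J)
      by (rewrite fsum_rsum; apply rsum_nonneg; intros; apply Cnorm_nonneg).
    set (T := fsum _ J) in *. set (r := vnorm E (vsub E x (wsum _ _ J))) in *.
    set (X := vnorm E x) in *.
    assert (T + r <= (1 + nu) * X) by nra.
    assert ((1 + 2 * nu) * (T + r) <= (1 + 2 * nu) * ((1 + nu) * X))
      by (apply Rmult_le_compat_l; lra).
    assert ((1 + 2 * nu) * ((1 + nu) * X) <= (1 + 5 * nu) * X).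
    { replace ((1 + 2 * nu) * ((1 + nu) * X)) with ((1 + 3 * nu + 2 * (nu * nu)) * X) by ring.
      apply Rmult_le_compat_r; [assumption|nra]. }
    nra.
Qed.
End Functional.

(** * Concentration of stable vectors *)

(* A strictly convex functional (the l2-norm of finitely many coordinates of one section) is almost
   additive on the pieces into which a second, better section splits a stable vector v; hence the
   pieces are almost real multiples of v. *)
Section Concentration.
Context {I : Type} {E : NormedSpace} (b : I -> E) (phi : I -> E -> Cpx) (F : list I).
Hypothesis Hlin : forall i, clinear (phi i).

(** The real part of the Hermitian product of the [F]-coordinates, so that projection coefficients
    are real. *)
Definition coord_ip (v w : E) : R :=
  rsum (fun i => fst (phi i v) * fst (phi i w) + snd (phi i v) * snd (phi i w)) F.
Definition coord_l2 (v : E) : R := sqrt (coord_ip v v).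
Definition coord_l1 (v : E) : R := fsum (fun i => phi i v) F.

Local Notation ip := coord_ip.
Local Notation N := coord_l2.
Local Notation Q := coord_l1.

Lemma ip_nonneg v : 0 <= ip v v.
Proof. apply rsum_nonneg; intros; nra. Qed.

Lemma l2_sq v : N v * N v = ip v v.
Proof. apply sqrt_sqrt, ip_nonneg. Qed.

Lemma l2_nonneg v : 0 <= N v.
Proof. apply sqrt_pos. Qed.

Lemma ip_sub_r v x y : ip v (vsub E x y) = ip v x - ip v y.
Proof.
  unfold coord_ip. rewrite <- (Rmult_1_l (rsum _ F)), <- (Rmult_1_l (rsum _ F)) at 1.
  transitivity (1 * ip v x + (-1) * ip v y); [|unfold coord_ip; ring].
  unfold coord_ip. rewrite <- rsum_lin, Rmult_1_l, Rmult_1_l. apply rsum_ext; intros i _.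
  rewrite clinear_sub by apply Hlin. unfold Csub, Cadd, Copp; simpl; ring.
Qed.

Lemma ip_scal_r v t x : ip v (vscal E (Cre t) x) = t * ip v x.
Proof.
  unfold coord_ip. rewrite <- rsum_scal. apply rsum_ext; intros i _.
  rewrite (proj2 (Hlin i)). unfold Cmul, Cre; simpl; ring.
Qed.

Lemma ip_sym v w : ip v w = ip w v.
Proof. apply rsum_ext; intros; ring. Qed.

Lemma ip_vsum v {K : Type} (g : K -> E) l : ip v (vsum g l) = rsum (fun k => ip v (g k)) l.
Proof.
  induction l as [|k l IH]; simpl.
  - rewrite <- (vscal_C0 vzero). change C0 with (Cre 0). rewrite ip_scal_r. ring.
  - rewrite <- IH. replace (vadd E (g k) (vsum g l))
      with (vsub E (g k) (vscal E (Cre (-1)) (vsum g l))).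
    + rewrite ip_sub_r, ip_scal_r. ring.
    + vcoeffs E; cpx.
Qed.

(** Pythagoras for the Euclidean seminorm. Through it the defect in Cauchy-Schwarz bounds the
    distance from [w] to the real line of [v]. *)
Lemma l2_projection v w : 0 < N v ->
  N (vsub E w (vscal E (Cre (ip v w / (N v * N v))) v)) *
  N (vsub E w (vscal E (Cre (ip v w / (N v * N v))) v))
  = N w * N w - (ip v w / N v) * (ip v w / N v).
Proof.
  intros Hn. rewrite (l2_sq (vsub _ _ _)). set (t := ip v w / (N v * N v)).
  rewrite ip_sub_r, ip_scal_r, ip_sym, ip_sub_r, ip_scal_r.
  rewrite (ip_sym (vsub _ _ _) v), ip_sub_r, ip_scal_r, (ip_sym w v), <- (l2_sq v), <- (l2_sq w).
  unfold t. field. lra.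
Qed.

Lemma l2_cauchy v w : 0 < N v -> Rabs (ip v w / N v) <= N w.
Proof.
  intros Hn. pose proof (l2_projection v w Hn) as H.
  pose proof (Rle_0_sqr (N (vsub E w (vscal E (Cre (ip v w / (N v * N v))) v)))) as H0.
  unfold Rsqr in H0. pose proof (l2_nonneg w). apply Rabs_le. nra.
Qed.

Lemma l2_le_l1 v : N v <= Q v.
Proof.
  unfold coord_l1. rewrite fsum_rsum.
  assert (ip v v <= rsum (fun i => Cnorm (phi i v)) F * rsum (fun i => Cnorm (phi i v)) F
    /\ 0 <= rsum (fun i => Cnorm (phi i v)) F) as [H H0].
  { unfold coord_ip. induction F as [|i l [IH IH0]]; simpl; [lra|].
    rewrite <- Cnorm_sq. pose proof (Cnorm_nonneg (phi i v)). nra. }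
  pose proof (l2_sq v). pose proof (l2_nonneg v). nra.
Qed.

(** Each coordinate is at most [N v], which suffices here; the [+ 1] keeps the constant positive for
    empty [F], since [stability] divides by it. *)
Lemma l1_le_l2 v : Q v <= (INR (length F) + 1) * N v.
Proof.
  pose proof (l2_nonneg v). unfold coord_l1. rewrite fsum_rsum.
  eapply Rle_trans; [apply rsum_const_le with (t := N v)|nra].
  intros i Hi. pose proof (Cnorm_nonneg (phi i v)). pose proof (l2_sq v) as H1.
  assert (Cnorm (phi i v) * Cnorm (phi i v) <= ip v v); [|nra].
  rewrite Cnorm_sq. apply (rsum_term_le
    (fun i => fst (phi i v) * fst (phi i v) + snd (phi i v) * snd (phi i v))); [|assumption].
  intros; nra.
Qed.

Lemma l1_triangle x y : Q (vadd E x y) <= Q x + Q y.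
Proof.
  unfold coord_l1. rewrite !fsum_rsum.
  rewrite <- (Rmult_1_l (rsum (fun i => Cnorm (phi i x)) F)),
    <- (Rmult_1_l (rsum (fun i => Cnorm (phi i y)) F)), <- rsum_lin.
  apply rsum_le; intros i _. rewrite (proj1 (Hlin i)).
  pose proof (Cnorm_triangle (phi i x) (phi i y)). lra.
Qed.

Lemma l1_vsum {K : Type} (g : K -> E) l : Q (vsum g l) <= rsum (fun k => Q (g k)) l.
Proof.
  induction l as [|k l IH]; simpl.
  - unfold coord_l1. rewrite fsum_rsum, (rsum_ext _ (fun _ => 0 * 0)).
    + rewrite rsum_scal. lra.
    + intros i _. rewrite clinear_zero by apply Hlin. rewrite Cnorm_0; ring.
  - eapply Rle_trans; [apply l1_triangle|lra].
Qed.

Definition tail (v : E) : E := vsub E v (wsum b (fun i => phi i v) F).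

Lemma tail_sub x t y : tail (vsub E x (vscal E t y)) = vsub E (tail x) (vscal E t (tail y)).
Proof.
  unfold tail, wsum.
  rewrite (vsum_ext _ (fun i => vsub E (vscal E (phi i x) (b i))
    (vscal E t (vscal E (phi i y) (b i)))) F).
  - rewrite vsum_sub, vsum_scal. set (A := vsum _ F). set (A' := vsum _ F). vring E.
  - intros i _. rewrite clinear_sub by apply Hlin. rewrite (proj2 (Hlin i)). vring E.
Qed.

Hypothesis Hb : forall i, vnorm E (b i) <= 1.

Lemma vnorm_le_l1_tail v : vnorm E v <= Q v + vnorm E (tail v).
Proof.
  pose proof (vnorm_le_sub v (wsum b (fun i => phi i v) F)).
  pose proof (vnorm_wsum b (fun i => phi i v) F (fun i _ => Hb i)).
  unfold tail, coord_l1. lra.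
Qed.

Context (theta rho : R).
Hypotheses (Htheta : 0 < theta <= rho) (Hrho : rho <= 1 / 2)
  (Hbound : forall y, Q y + vnorm E (tail y) <= (1 + theta) * vnorm E y).
Let k := INR (length F) + 1.
Let kappa := rho / (6 * k).
Definition stability : R := (rho / (6 * (INR (length F) + 1))) * (rho / (6 * (INR (length F) + 1))).
Local Notation omega := stability.

Let Hk : 1 <= k.
Proof. unfold k. pose proof (pos_INR (length F)). lra. Qed.

Let Hkappa : kappa * (6 * k) = rho.
Proof. unfold kappa. field. lra. Qed.

Let kappa_bounds : 0 < kappa /\ kappa <= rho / 6 /\ omega = kappa * kappa.
Proof.
  assert (0 < kappa) by (apply Rdiv_lt_0_compat; lra).
  repeat split; [assumption|nra].
Qed.

Context (B eps : R) (v : E) (K : Type) (w : K -> E) (L : list K).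
Hypotheses (HB : 0 <= B) (Heps : 0 < eps <= rho) (HBeps : B * eps <= omega)
  (Hv : 0 < vnorm E v) (HQ : (1 - rho) * vnorm E v <= Q v)
  (Hstable : ~ unstable (fun y => N y - B * vnorm E y) omega v).
Let r := vsub E v (vsum w L).
Hypotheses (Hr : vnorm E r <= omega * vnorm E v)
  (Hmass : rsum (fun s => vnorm E (w s)) L + vnorm E r <= (1 + eps) * vnorm E v).

Let V := vnorm E v.
Let l2_le y : N y <= 2 * vnorm E y.
Proof.
  pose proof (l2_le_l1 y). pose proof (Hbound y). pose proof (vnorm_nonneg E (tail y)).
  pose proof (vnorm_nonneg E y). nra.
Qed.

Let n_pos : V <= 2 * k * N v.
Proof. pose proof (l1_le_l2 v) as H. fold k in H. unfold V. nra. Qed.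

Let n_pos' : 0 < N v.
Proof. pose proof n_pos. apply Rnot_le_lt; intros H0. assert (0 < V) by exact Hv. nra. Qed.

Let ratio (s : K) : R := ip v (w s) / (N v * N v).
Let a (s : K) : R := ip v (w s) / N v.

(** The pieces together with [r] form a splitting of [v], which gains little by stability. One
    [omega] is the threshold, the other pays for the penalty [B] on the excess mass [eps]. *)
Let sum_l2 : rsum (fun s => N (w s)) L <= N v + 2 * omega * V.
Proof.
  apply Rnot_lt_le. intros Hlt. apply Hstable. exists (r :: map w L). split.
  - unfold vtotal; simpl. rewrite vsum_map. unfold r. set (A := vsum _ L). vring E.
  - simpl. rewrite rsum_map.
    replace (rsum (fun s => N (w s) - B * vnorm E (w s)) L)
      with (rsum (fun s => 1 * N (w s) + (- B) * vnorm E (w s)) L)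
      by (apply rsum_ext; intros; ring).
    rewrite rsum_lin. pose proof (l2_nonneg r). unfold V in Hlt.
    assert (B * (rsum (fun s => vnorm E (w s)) L + vnorm E r) <= B * ((1 + eps) * vnorm E v))
      by (apply Rmult_le_compat_l; lra).
    nra.
Qed.

(** The components along [v] add up to that of [v] minus [r], by linearity. With [sum_l2] this
    bounds the sum of all Cauchy-Schwarz defects by [4 * omega * V]. *)
Let sum_a : N v - 2 * omega * V <= rsum a L.
Proof.
  replace (rsum a L) with (ip v (vsum w L) / N v).
  - replace (vsum w L) with (vsub E v r) by (unfold r; set (A := vsum w L); vring E).
    rewrite ip_sub_r, <- l2_sq.
    replace ((N v * N v - ip v r) / N v) with (N v - ip v r / N v) by (field; lra).
    pose proof (l2_cauchy v r n_pos'). pose proof (Rle_abs (ip v r / N v)).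
    pose proof (l2_le r). fold V in Hr. lra.
  - rewrite ip_vsum. unfold a. unfold Rdiv. rewrite Rmult_comm, <- rsum_scal.
    apply rsum_ext; intros; ring.
Qed.

Let dev (s : K) : E := vsub E (w s) (vscal E (Cre (ratio s)) v).

(* AM-GM applied to |dev|^2 = (N w - a) (N w + a) <= 2 N w (N w - a). *)
Let dev_l2 s : N (dev s) <= kappa * N (w s) + / (2 * kappa) * (N (w s) - a s).
Proof.
  destruct kappa_bounds as (Hk0 & _ & _).
  pose proof (l2_projection v (w s) n_pos') as H. fold (ratio s) in H. fold (dev s) in H.
  fold (a s) in H. pose proof (l2_cauchy v (w s) n_pos') as Hc. fold (a s) in Hc.
  pose proof (Rle_abs (a s)). pose proof (l2_nonneg (w s)). pose proof (l2_nonneg (dev s)).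
  set (g := N (w s) - a s) in *. assert (0 <= g) by (unfold g; lra).
  assert (0 < / (2 * kappa)) by (apply Rinv_0_lt_compat; lra).
  set (c := / (2 * kappa)) in *. assert (kappa * c = 1 / 2) as Hkc by (unfold c; field; lra).
  assert (N (dev s) * N (dev s) <= 2 * N (w s) * g) by (unfold g in *; nra).
  assert (2 * N (w s) * g <= (kappa * N (w s) + c * g) * (kappa * N (w s) + c * g)).
  { pose proof (Rle_0_sqr (kappa * N (w s) - c * g)) as Hs. unfold Rsqr in Hs.
    replace (2 * N (w s) * g) with (4 * (kappa * c) * N (w s) * g) by (rewrite Hkc; field).
    lra. }
  assert (0 <= kappa * N (w s) + c * g) by nra. nra.
Qed.

Let sum_dev_l1 : rsum (fun s => Q (dev s)) L <= rho * V.
Proof.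
  destruct kappa_bounds as (Hk0 & Hk1 & Hom). assert (0 < V) by exact Hv.
  apply Rle_trans with (k * rsum (fun s => N (dev s)) L).
  { rewrite <- rsum_scal. apply rsum_le; intros; apply l1_le_l2. }
  assert (rsum (fun s => N (dev s)) L
    <= kappa * rsum (fun s => N (w s)) L + / (2 * kappa) * (rsum (fun s => N (w s)) L - rsum a L)) as H1.
  { replace (rsum (fun s => N (w s)) L - rsum a L)
      with (1 * rsum (fun s => N (w s)) L + (-1) * rsum a L) by ring.
    rewrite <- rsum_lin, <- rsum_lin.
    apply rsum_le; intros s _. pose proof (dev_l2 s). lra. }
  assert (rsum (fun s => N (w s)) L - rsum a L <= 4 * omega * V) as H2 by lra.
  assert (/ (2 * kappa) * (rsum (fun s => N (w s)) L - rsum a L) <= 2 * kappa * V) as H3.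
  { replace (2 * kappa * V) with (/ (2 * kappa) * (4 * omega * V)) by (rewrite Hom; field; lra).
    apply Rmult_le_compat_l; [|assumption]. apply Rlt_le, Rinv_0_lt_compat; lra. }
  assert (kappa * rsum (fun s => N (w s)) L <= 4 * kappa * V) as H4.
  { replace (4 * kappa * V) with (kappa * (4 * V)) by ring. apply Rmult_le_compat_l; [lra|].
    assert (N v <= 2 * V) by apply l2_le. assert (omega <= 1) by nra. nra. }
  replace (rho * V) with (k * (6 * kappa * V)) by (rewrite <- Hkappa; ring).
  apply Rmult_le_compat_l; lra.
Qed.

(** The Euclidean norm does not see the tails, but the masses on [F] of the pieces add up to at
    least [Q v - Q r], nearly all of the available mass, which leaves little for the tails. *)
Let sum_tail : rsum (fun s => vnorm E (tail (w s))) L <= 5 * rho * V.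
Proof.
  destruct kappa_bounds as (Hk0 & Hk1 & Hom). assert (0 < V) by exact Hv.
  assert (rsum (fun s => vnorm E (tail (w s))) L
    <= (1 + theta) * rsum (fun s => vnorm E (w s)) L + (-1) * rsum (fun s => Q (w s)) L) as H1.
  { rewrite <- rsum_lin. apply rsum_le; intros s _. pose proof (Hbound (w s)). lra. }
  pose proof (l1_vsum w L) as H2. pose proof (l1_triangle (vsum w L) r) as H3.
  replace (vadd E (vsum w L) r) with v in H3 by (unfold r; set (A := vsum w L); vring E).
  assert (Q r <= 2 * vnorm E r) as H4.
  { pose proof (Hbound r). pose proof (vnorm_nonneg E (tail r)). pose proof (vnorm_nonneg E r). nra. }
  fold V in Hr, Hmass, HQ. pose proof (vnorm_nonneg E r).
  assert ((1 + theta) * rsum (fun s => vnorm E (w s)) L <= (1 + theta) * ((1 + eps) * V))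
    by (apply Rmult_le_compat_l; lra).
  assert (theta * eps <= rho / 2) by nra. assert (2 * omega <= rho / 2) by nra.
  assert (((1 + theta) * (1 + eps) - (1 - rho) + 2 * omega) * V <= 5 * rho * V)
    by (apply Rmult_le_compat_r; lra).
  lra.
Qed.

(** Needed because subtracting a multiple of [v] from a piece also subtracts a multiple of the tail
    of [v]. *)
Let sum_ratio : rsum (fun s => Rabs (ratio s)) L <= 2.
Proof.
  destruct kappa_bounds as (Hk0 & Hk1 & Hom). assert (0 < V) by exact Hv.
  apply Rmult_le_reg_l with (N v); [apply n_pos'|]. rewrite <- rsum_scal.
  apply Rle_trans with (rsum (fun s => N (w s)) L).
  - apply rsum_le; intros s _. rewrite <- (Rabs_pos_eq (N v)) at 1 by apply l2_nonneg.
    rewrite <- Rabs_mult. unfold ratio.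
    replace (N v * (ip v (w s) / (N v * N v))) with (ip v (w s) / N v)
      by (field; pose proof n_pos'; lra).
    apply l2_cauchy, n_pos'.
  - assert (2 * omega * V <= N v); [|lra].
    apply Rle_trans with (2 * omega * (2 * k * N v)).
    + apply Rmult_le_compat_l; [nra|apply n_pos].
    + assert (4 * (k * omega) <= 1) by (rewrite Hom; nra). pose proof n_pos'. nra.
Qed.

(** The witness is the orthogonal projection coefficient [ratio]. The constant 10 is 1 for the
    deviations on [F], 5 for the tails of the pieces, and 4 for the multiples of the tail of [v],
    which is at most [2 * rho * V]. *)
Lemma stable_concentration :
  exists alpha : K -> R,
    rsum (fun s => vnorm E (vsub E (w s) (vscal E (Cre (alpha s)) v))) L <= 10 * rho * vnorm E v.
Proof.
  exists ratio. fold V. assert (0 < V) by exact Hv.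
  apply Rle_trans with (1 * rsum (fun s => Q (dev s)) L + 1 * rsum (fun s =>
    1 * vnorm E (tail (w s)) + (2 * rho * V) * Rabs (ratio s)) L).
  - rewrite <- rsum_lin. apply rsum_le; intros s _. fold (dev s).
    pose proof (vnorm_le_l1_tail (dev s)) as H1. unfold dev in H1 at 3. rewrite tail_sub in H1.
    pose proof (vnorm_sub_le (tail (w s)) (vscal E (Cre (ratio s)) (tail v))) as H2.
    rewrite vnorm_scal, Cnorm_re in H2.
    assert (vnorm E (tail v) <= 2 * rho * V) as H3.
    { pose proof (Hbound v). unfold V. nra. }
    pose proof (Rabs_pos (ratio s)). nra.
  - rewrite rsum_lin. pose proof sum_dev_l1. pose proof sum_tail. pose proof sum_ratio.
    assert (2 * rho * V * rsum (fun s => Rabs (ratio s)) L <= 2 * rho * V * 2).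
    { apply Rmult_le_compat_l; [nra|assumption]. }
    lra.
Qed.
End Concentration.

(** * Existence of near-atoms and decompositions into them *)

Section NearAtoms.
Context {I : Type} {E : NormedSpace} (b : I -> E).
Hypotheses (Hb : forall i, vnorm E (b i) <= 1)
  (Hsec : forall eps, eps > 0 -> exists phi, approx_section b eps phi).

Lemma normalized_near_atom (d : R) (v : E) (g : E -> Cpx) : 0 < vnorm E v -> clinear g ->
  Cnorm (Csub C1 (g v)) <= d ->
  (forall x, Cnorm (g x) * vnorm E v + vnorm E (vsub E x (vscal E (g x) v)) <= (1 + d) * vnorm E x) ->
  near_atom d (vscal E (Cre (/ vnorm E v)) v) (fun x => Cmul (Cre (vnorm E v)) (g x)).
Proof.
  intros Hv Hg Hgv Hgx. set (V := vnorm E v) in *.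
  assert (Cmul (Cre V) (Cre (/ V)) = C1) as HV by (apply Cpx_eq; simpl; field; lra).
  repeat split.
  - rewrite vnorm_scal, Cnorm_re, Rabs_pos_eq by (apply Rlt_le, Rinv_0_lt_compat; lra).
    fold V. field; lra.
  - intros x y. rewrite (proj1 Hg). ring.
  - intros c x. rewrite (proj2 Hg). ring.
  - rewrite (proj2 Hg).
    replace (Cmul (Cre V) (Cmul (Cre (/ V)) (g v)))
      with (Cmul (Cmul (Cre V) (Cre (/ V))) (g v)) by ring.
    rewrite HV. replace (Cmul C1 (g v)) with (g v) by ring. exact Hgv.
  - intros x. rewrite vscal_assoc.
    replace (Cmul (Cmul (Cre V) (g x)) (Cre (/ V)))
      with (Cmul (Cmul (Cre V) (Cre (/ V))) (g x)) by ring.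
    rewrite HV. replace (Cmul C1 (g x)) with (g x) by ring.
    rewrite Cnorm_mul, Cnorm_re, Rabs_pos_eq by lra. specialize (Hgx x). lra.
Qed.

(** The coordinates of a finer section [psi] serve twice: they split [v] into pieces concentrated
    near its line, and then provide the functional. The value [nu * nu / 10] makes the bound
    [10 * rho] equal to the [nu * nu] of [concentrated_functional]. *)
Lemma stable_near_atom (nu theta B : R) (phi : I -> E -> Cpx) (F : list I) (v : E) :
  0 < nu <= 1 -> 0 < theta <= nu * nu / 10 -> 0 <= B ->
  approx_section b theta phi -> NoDup F -> 0 < vnorm E v ->
  (1 - nu * nu / 10) * vnorm E v <= coord_l1 phi F v ->
  ~ unstable (fun y => coord_l2 phi F y - B * vnorm E y) (stability F (nu * nu / 10)) v ->
  exists f, near_atom (5 * nu) (vscal E (Cre (/ vnorm E v)) v) f.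
Proof.
  intros Hnu Hth HB (Hlin & Hbd & _) HF Hv HQ Hst.
  set (rho := nu * nu / 10) in *. set (om := stability F rho) in *.
  assert (0 < rho <= nu /\ rho <= 1 / 10) as [Hrho Hrho'] by (unfold rho; nra).
  assert (0 < om <= nu) as Hom.
  { unfold om, stability. pose proof (pos_INR (length F)).
    set (q := rho / (6 * (INR (length F) + 1))).
    assert (q * (6 * (INR (length F) + 1)) = rho) by (unfold q; field; lra).
    assert (0 < q) by (apply Rdiv_lt_0_compat; lra).
    assert (q <= rho) by nra. nra. }
  (* The second term ensures [B * eps <= om]: the excess mass of the splitting must cost less than
     the stability threshold. *)
  set (eps := Rmin rho (om / (B + 1))).
  assert (0 < om / (B + 1)) by (apply Rdiv_lt_0_compat; lra).
  assert (0 < eps) by (apply Rmin_glb_lt; lra).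
  assert (eps <= rho) by apply Rmin_l.
  assert (B * eps <= om).
  { assert (eps <= om / (B + 1)) by apply Rmin_r.
    assert (om / (B + 1) * (B + 1) = om) by (field; lra). nra. }
  destruct (Hsec eps) as [psi Hpsi]; [lra|].
  destruct Hpsi as (Plin & Pbd & Papp).
  destruct (Papp v (om * vnorm E v)) as (L & HL & HLv); [nra|].
  destruct (stable_concentration b phi F Hlin Hb theta rho Hth ltac:(lra)
    (fun y => Hbd F y HF) B eps v I (fun i => vscal E (psi i v) (b i)) L HB ltac:(lra)
    ltac:(assumption) Hv HQ Hst) as [alpha Halpha].
  - apply Rlt_le, HLv.
  - eapply Rle_trans; [|apply (Pbd L v HL)]. apply Rplus_le_compat_r.
    rewrite fsum_rsum. apply rsum_le; intros i _. rewrite vnorm_scal.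
    pose proof (Cnorm_nonneg (psi i v)). specialize (Hb i). nra.
  - destruct (concentrated_functional b psi eps nu Hb (conj Plin (conj Pbd Papp)) ltac:(lra) Hnu
      v L alpha Hv HL) as (g & Hg & Hg1 & Hg2).
    + eapply Rle_trans; [apply Rlt_le, HLv|]. nra.
    + eapply Rle_trans; [exact Halpha|]. unfold rho. lra.
    + eexists. apply normalized_near_atom; eassumption.
Qed.

(** An almost stable decomposition of [x] is cut down to its good pieces, normalized. A discarded
    nonzero piece is unstable or loses a proportion [rho] of its mass on [F]; both kinds have small
    total norm. *)
Lemma near_atom_decomposition (x : E) (d : R) : 0 < d <= 1 ->
  exists l : list (Cpx * E), (forall p, In p l -> exists f, near_atom d (snd p) f) /\
    vnorm E (vsub E x (lcomb (fun v => v) l)) <= d * vnorm E x /\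
    rsum (fun p => Cnorm (fst p)) l <= (1 + d) * vnorm E x.
Proof.
  intros Hd. set (X := vnorm E x).
  destruct (Req_dec X 0) as [HX|HX].
  { exists []. unfold X in *. apply vnorm_zero in HX. subst x.
    unfold lcomb; simpl. rewrite vsub_diag, vnorm_vzero. repeat split; [easy|lra|lra]. }
  assert (0 < X) as HX0 by (pose proof (vnorm_nonneg E x); unfold X in *; lra).
  (* [nu] undoes the factor 5 of [stable_near_atom]. The pieces deficient on [F] have total norm at
     most [4 * theta / rho] times [X], which the choice of [theta] makes [d / 4 * X]. *)
  set (nu := d / 5). assert (0 < nu <= 1 / 5) as Hnu by (unfold nu; lra).
  set (rho := nu * nu / 10). assert (0 < rho <= 1 / 10) as Hrho by (unfold rho; nra).
  set (theta := d * rho / 16). assert (0 < theta <= rho / 16) as Hth by (unfold theta; nra).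
  destruct (Hsec theta) as [phi Hphi]; [lra|].
  pose proof Hphi as (Hlin & Hbd & Happ).
  destruct (Happ x (theta * X)) as (F & HF & HFx); [nra|].
  (* [B >= 2] makes [Jf] nonpositive. Comparison with the trivial decomposition bounds the mass by
     [B / (B - 2)] times [X], and this quotient is [1 + theta]. *)
  set (B := 2 + 2 / theta).
  assert (0 < 2 / theta) by (apply Rdiv_lt_0_compat; lra).
  set (Jf := fun y => coord_l2 phi F y - B * vnorm E y).
  set (om := stability F rho).
  assert (0 < om) as Hom.
  { pose proof (pos_INR (length F)).
    assert (0 < rho / (6 * (INR (length F) + 1))) by (apply Rdiv_lt_0_compat; lra).
    unfold om, stability. nra. }
  assert (forall y, 0 <= (1 + theta) * vnorm E y - coord_l1 phi F y) as Htail.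
  { intros y. pose proof (Hbd F y HF).
    pose proof (vnorm_nonneg E (vsub E y (wsum b (fun i => phi i y) F))).
    unfold coord_l1. lra. }
  assert (forall y, coord_l2 phi F y <= 2 * vnorm E y) as Hl2.
  { intros y. pose proof (l2_le_l1 phi F y). specialize (Htail y). pose proof (vnorm_nonneg E y). nra. }
  destruct (almost_stable_decomposition Jf) with (x := x) (w := om) (eta := d / 2 * X)
    as (l & Hl & HJ & Hun).
  { intros y. unfold Jf, B. specialize (Hl2 y). pose proof (vnorm_nonneg E y). nra. }
  { lra. }
  { nra. }
  assert (rsum (vnorm E) l <= (1 + theta) * X) as Hmass.
  { replace (rsum Jf l) with (1 * rsum (coord_l2 phi F) l + (- B) * rsum (vnorm E) l) in HJ
      by (rewrite <- rsum_lin; apply rsum_ext; intros; unfold Jf; ring).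
    assert (rsum (coord_l2 phi F) l <= 2 * rsum (vnorm E) l).
    { rewrite <- rsum_scal. apply rsum_le; auto. }
    unfold Jf in HJ. fold X in HJ. pose proof (l2_nonneg phi F x).
    assert ((2 / theta) * rsum (vnorm E) l <= (2 / theta) * ((1 + theta) * X)).
    { replace (2 / theta * ((1 + theta) * X)) with (B * X) by (unfold B; field; lra).
      unfold B in *. lra. }
    eapply Rmult_le_reg_l; [|eassumption]. lra. }
  set (good := fun v => 0 < vnorm E v /\ (1 - rho) * vnorm E v <= coord_l1 phi F v /\
    ~ unstable Jf om v).
  set (p := fun v => decide (good v)).
  exists (map (fun v => (Cre (vnorm E v), vscal E (Cre (/ vnorm E v)) v)) (filter p l)).
  assert (forall v, In v (filter p l) -> good v) as Hgood.
  { intros v Hv. apply filter_In in Hv. apply (proj1 (decide_true _)), Hv. }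
  repeat split.
  - intros q Hq. apply in_map_iff in Hq. destruct Hq as (v & <- & Hv).
    destruct (Hgood v Hv) as (Hv0 & HvQ & Hvs). simpl.
    replace d with (5 * nu) by (unfold nu; field).
    eapply stable_near_atom with (B := B); try eassumption; [lra| |].
    + fold rho. lra.
    + unfold B; lra.
  - assert (lcomb (fun v => v) (map (fun v => (Cre (vnorm E v), vscal E (Cre (/ vnorm E v)) v))
      (filter p l)) = vtotal (filter p l)) as ->.
    { unfold lcomb, vtotal. rewrite vsum_map. apply vsum_ext; intros v Hv. simpl.
      destruct (Hgood v Hv) as (Hv0 & _). rewrite vscal_assoc.
      transitivity (vscal E C1 v); [|apply vscal_one]. f_equal.
      apply Cpx_eq; simpl; field; lra. }
    assert (vsub E x (vtotal (filter p l)) = vtotal (filter (fun v => negb (p v)) l)) as ->.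
    { rewrite <- Hl. unfold vtotal. rewrite (vsum_filter p _ l).
      set (A := vsum _ (filter p l)). set (A' := vsum _ _). vring E. }
    eapply Rle_trans; [apply vnorm_vsum|].
    (* A majorant of the norm on discarded pieces: the first term covers unstable ones, and the
       second is at least the norm as soon as the mass on [F] is below [1 - rho] of it. The sums are
       [d / 2 * X] and [d / 4 * X]. *)
    set (h := fun v => 1 * (if decide (unstable Jf om v) then vnorm E v else 0)
      + / rho * ((1 + theta) * vnorm E v + (-1) * coord_l1 phi F v)).
    assert (0 < / rho) by (apply Rinv_0_lt_compat; lra).
    assert (forall v, 0 <= (if decide (unstable Jf om v) then vnorm E v else 0)) as Hif.
    { intros v. destruct (decide _); [apply vnorm_nonneg|lra]. }
    apply Rle_trans with (rsum h (filter (fun v => negb (p v)) l)).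
    { apply rsum_le; intros v Hv. apply filter_In in Hv.
      destruct Hv as [_ Hv]. apply (proj1 (decide_false _)) in Hv. unfold h.
      specialize (Htail v). pose proof (vnorm_nonneg E v) as Hv0.
      assert (0 <= / rho * ((1 + theta) * vnorm E v + -1 * coord_l1 phi F v)) by
        (apply Rmult_le_pos; lra).
      destruct (classic (unstable Jf om v)) as [Hu|Hu].
      - rewrite (proj2 (decide_true _) Hu). lra.
      - specialize (Hif v).
        destruct (Rle_lt_or_eq_dec _ _ Hv0) as [Hv1|Hv1]; [|rewrite <- Hv1 in *; lra].
        destruct (Rle_lt_dec ((1 - rho) * vnorm E v) (coord_l1 phi F v)) as [HQ|HQ].
        + exfalso. apply Hv. now repeat split.
        + assert (/ rho * (rho * vnorm E v) <= / rho * ((1 + theta) * vnorm E v + -1 * coord_l1 phi F v)).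
          { apply Rmult_le_compat_l; [lra|]. nra. }
          replace (/ rho * (rho * vnorm E v)) with (vnorm E v) in * by (field; lra). lra. }
    eapply Rle_trans; [apply rsum_filter_le|].
    { intros v _. unfold h. specialize (Hif v). specialize (Htail v).
      assert (0 <= / rho * ((1 + theta) * vnorm E v + -1 * coord_l1 phi F v)) by
        (apply Rmult_le_pos; lra). lra. }
    unfold h. rewrite rsum_lin, rsum_lin.
    pose proof (l1_vsum phi F Hlin (fun v => v) l) as HQl. fold (vtotal l) in HQl.
    rewrite Hl in HQl.
    assert ((1 - theta) * X <= coord_l1 phi F x) as HQx.
    { pose proof (vnorm_le_sub x (wsum b (fun i => phi i x) F)) as H1.
      pose proof (vnorm_wsum b (fun i => phi i x) F (fun i _ => Hb i)). fold X in H1.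
      unfold coord_l1. lra. }
    assert ((1 + theta) * rsum (vnorm E) l + -1 * rsum (coord_l1 phi F) l <= 4 * theta * X) as H4.
    { assert ((1 + theta) * rsum (vnorm E) l <= (1 + theta) * ((1 + theta) * X))
        by (apply Rmult_le_compat_l; lra).
      change (rsum (fun k => coord_l1 phi F k) l) with (rsum (coord_l1 phi F) l) in HQl.
      assert (theta * theta * X <= theta * X) by (apply Rmult_le_compat_r; nra). lra. }
    assert (/ rho * ((1 + theta) * rsum (vnorm E) l + -1 * rsum (coord_l1 phi F) l)
      <= / rho * (4 * theta * X)) as H5 by (apply Rmult_le_compat_l; lra).
    replace (/ rho * (4 * theta * X)) with (d / 4 * X) in H5 by (unfold theta; field; lra).
    change (fun v : E => vnorm E v) with (vnorm E). nra.
  - rewrite rsum_map. rewrite (rsum_ext _ (vnorm E)).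
    + eapply Rle_trans; [apply rsum_filter_le; intros; apply vnorm_nonneg|].
      eapply Rle_trans; [exact Hmass|]. apply Rmult_le_compat_r; [apply vnorm_nonneg|].
      assert (theta <= d) by (unfold theta; nra). lra.
    + intros v _. simpl. rewrite Cnorm_re. apply Rabs_pos_eq, vnorm_nonneg.
Qed.
End NearAtoms.

Definition l1_independent {V : NormedSpace} (B : V -> Prop) : Prop :=
  forall (L : list V) (f : V -> Cpx), NoDup L -> (forall v, In v L -> B v) ->
    vnorm V (wsum (fun v => v) f L) = fsum f L.

Lemma l1_independent_unit {V : NormedSpace} (B : V -> Prop) (v : V) :
  l1_independent B -> B v -> vnorm V v = 1.
Proof.
  intros HB Hv. pose proof (HB [v] (fun _ => C1)) as H. unfold wsum in H. simpl in H.
  rewrite vadd_zero, vscal_one, Cnorm_1 in H. rewrite H; [lra| |].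
  - constructor; [easy|constructor].
  - now intros w [<-|[]].
Qed.

(** * From near-atoms to atoms *)

Section Atoms.
Context {E : NormedSpace}.

Lemma near_atom_bound (d : R) (e : E) (f : E -> Cpx) : near_atom d e f ->
  forall x, Cnorm (f x) <= (1 + d) * vnorm E x.
Proof.
  intros (_ & _ & _ & H) x. pose proof (vnorm_nonneg E (vsub E x (vscal E (f x) e))).
  specialize (H x). lra.
Qed.

Lemma near_atom_mono (d d' : R) (e : E) (f : E -> Cpx) : d <= d' -> near_atom d e f -> near_atom d' e f.
Proof.
  intros Hd (H1 & H2 & H3 & H4). repeat split; try apply H2; [assumption|lra|].
  intros x. specialize (H4 x). pose proof (vnorm_nonneg E x). nra.
Qed.

Lemma Cnorm_sub_le (z w : Cpx) : Cnorm z <= Cnorm (Csub z w) + Cnorm w.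
Proof. replace z with (Cadd (Csub z w) w) at 1 by ring. apply Cnorm_triangle. Qed.

Lemma near_atom_perturb (d eta : R) (e e' : E) (f : E -> Cpx) : 0 <= d <= 1 -> near_atom d e f ->
  vnorm E e' = 1 -> vnorm E (vsub E e e') <= eta -> near_atom (d + 2 * eta) e' f.
Proof.
  intros Hd Hf He' Hee. pose proof (near_atom_bound _ _ _ Hf) as Hb.
  destruct Hf as (H1 & H2 & H3 & H4). pose proof (vnorm_nonneg E (vsub E e e')).
  repeat split; try apply H2; [assumption| |].
  - pose proof (Hb (vsub E e e')) as H5. rewrite clinear_sub in H5 by assumption.
    replace (Csub C1 (f e')) with (Cadd (Csub C1 (f e)) (Csub (f e) (f e'))) by ring.
    eapply Rle_trans; [apply Cnorm_triangle|]. nra.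
  - intros x. specialize (H4 x). specialize (Hb x).
    replace (vsub E x (vscal E (f x) e'))
      with (vadd E (vsub E x (vscal E (f x) e)) (vscal E (f x) (vsub E e e'))) by vring E.
    pose proof (vnorm_triangle E (vsub E x (vscal E (f x) e)) (vscal E (f x) (vsub E e e'))) as H5.
    rewrite vnorm_scal in H5. pose proof (Cnorm_nonneg (f x)). pose proof (vnorm_nonneg E x).
    assert (Cnorm (f x) * vnorm E (vsub E e e') <= Cnorm (f x) * eta)
      by (apply Rmult_le_compat_l; assumption).
    assert (Cnorm (f x) * eta <= 2 * vnorm E x * eta) by (apply Rmult_le_compat_r; nra).
    lra.
Qed.

Lemma near_atom_phase (d : R) (e : E) (f : E -> Cpx) (u : Cpx) : Cnorm u = 1 -> near_atom d e f ->
  near_atom d (vscal E u e) (fun x => Cmul (Cinv u) (f x)).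
Proof.
  intros Hu (H1 & H2 & H3 & H4).
  assert (u <> C0) as Hu0 by (intros ->; rewrite Cnorm_0 in Hu; lra).
  pose proof (Cinv_r u Hu0) as Hinv.
  repeat split.
  - rewrite vnorm_scal, Hu, H1; ring.
  - intros x y. rewrite (proj1 H2); ring.
  - intros c x. rewrite (proj2 H2); ring.
  - rewrite (proj2 H2). replace (Cmul (Cinv u) (Cmul u (f e))) with (Cmul (Cmul u (Cinv u)) (f e)) by ring.
    rewrite Hinv. now replace (Cmul C1 (f e)) with (f e) by ring.
  - intros x. rewrite vscal_assoc.
    replace (Cmul (Cmul (Cinv u) (f x)) u) with (Cmul (Cmul u (Cinv u)) (f x)) by ring.
    rewrite Hinv, Cnorm_mul, Cnorm_inv, Hu, Rinv_1, Rmult_1_l by assumption.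
    now replace (Cmul C1 (f x)) with (f x) by ring.
Qed.

(* Two L-projections of rank one are either disjoint or have the same range; here up to O(d). *)
Lemma near_atom_rigid (d : R) (e e' : E) (f f' : E -> Cpx) : 0 <= d <= 1 ->
  near_atom d e f -> near_atom d e' f' ->
  Cnorm (f e') * vnorm E (vsub E e (vscal E (f' e) e')) <= 4 * d.
Proof.
  intros Hd (H1 & H2 & H3 & H4) Hf'. pose proof (near_atom_bound _ _ _ Hf') as Hb'.
  destruct Hf' as (H1' & H2' & H3' & H4').
  set (c := f e') in *. set (c' := f' e) in *.
  specialize (H4 e'). fold c in H4. specialize (H4' e). fold c' in H4'.
  rewrite H1 in H4'. rewrite H1' in H4. specialize (Hb' (vsub E e' (vscal E c e))).
  rewrite clinear_sub, (proj2 H2') in Hb' by assumption. fold c' in Hb'.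
  (* Applies [f'] to [e'] split along [e]: the value is near 1, and the part off the line of [e]
     contributes at most [(1 + d) * (1 + d - Cnorm c)]. Inserted in the bound on [e], the terms
     linear in [Cnorm c] cancel and [3 * d + d * d] remains. *)
  assert (1 <= d + Cnorm (Csub (f' e') (Cmul c c')) + Cnorm c * Cnorm c') as H5.
  { rewrite <- Cnorm_mul. pose proof (Cnorm_sub_le C1 (f' e')). rewrite Cnorm_1 in *.
    pose proof (Cnorm_sub_le (f' e') (Cmul c c')). lra. }
  pose proof (Cnorm_nonneg c). pose proof (Cnorm_nonneg c').
  assert (Cnorm c * vnorm E (vsub E e (vscal E c' e')) <= Cnorm c * (1 + d - Cnorm c'))
    by (apply Rmult_le_compat_l; lra).
  assert ((1 + d) * vnorm E (vsub E e' (vscal E c e)) <= (1 + d) * (1 + d - Cnorm c))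
    by (apply Rmult_le_compat_l; lra).
  nra.
Qed.

(** The functional may depend on [d], so no limit of functionals has to be formed. *)
Definition atom (e : E) : Prop := forall d, d > 0 -> exists f, near_atom d e f.

Lemma atom_unit (e : E) : atom e -> vnorm E e = 1.
Proof. intros H. destruct (H 1) as [f Hf]; [lra|]. apply Hf. Qed.

(** By [near_atom_rigid], [f w] is [O(d)] once [v] stays away from the line of [w]. That distance is
    bounded below without compactness: the multiple [c0] read off from a functional of [w] is
    optimal up to the factor 4. *)
Lemma nonproportional_atoms (v w : E) : atom v -> atom w -> ~ (exists c, v = vscal E c w) ->
  exists K, 0 <= K /\ forall d f, 0 < d <= 1 -> near_atom d v f -> Cnorm (f w) <= K * d.
Proof.
  intros Hv Hw Hvw. destruct (Hw (1 / 2)) as [g Hg]; [lra|].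
  pose proof (near_atom_bound _ _ _ Hg) as Hgb. destruct Hg as (Hw1 & Hgl & Hgw & _).
  assert (1 / 2 <= Cnorm (g w)) as Hgw2.
  { pose proof (Cnorm_sub_le C1 (g w)). rewrite Cnorm_1 in *. lra. }
  assert (g w <> C0) as Hgw0 by (intros H0; rewrite H0, Cnorm_0 in Hgw2; lra).
  set (c0 := Cmul (g v) (Cinv (g w))).
  set (D := vnorm E (vsub E v (vscal E c0 w))).
  assert (0 < D) as HD.
  { destruct (vnorm_nonneg E (vsub E v (vscal E c0 w))) as [|H0]; [assumption|].
    exfalso. apply Hvw. exists c0. now apply vsub_eq_zero, vnorm_zero. }
  assert (forall c, D <= 4 * vnorm E (vsub E v (vscal E c w))) as Hdist.
  { intros c. set (m := vnorm E (vsub E v (vscal E c w))).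
    assert (Cnorm (Csub c0 c) <= 3 * m).
    { apply Rmult_le_reg_r with (Cnorm (g w)); [lra|]. rewrite <- Cnorm_mul.
      replace (Cmul (Csub c0 c) (g w)) with (g (vsub E v (vscal E c w))).
      - specialize (Hgb (vsub E v (vscal E c w))). fold m in Hgb.
        pose proof (vnorm_nonneg E (vsub E v (vscal E c w))). fold m in H. nra.
      - rewrite clinear_sub, (proj2 Hgl) by assumption. unfold c0.
        transitivity (Csub (Cmul (g v) (Cmul (g w) (Cinv (g w)))) (Cmul c (g w))); [|ring].
        rewrite Cinv_r by assumption. ring. }
    unfold D. replace (vsub E v (vscal E c0 w))
      with (vsub E (vsub E v (vscal E c w)) (vscal E (Csub c0 c) w)) by vring E.
    eapply Rle_trans; [apply vnorm_sub_le|]. rewrite vnorm_scal, Hw1. fold m. lra. }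
  exists (16 / D). split; [apply Rlt_le, Rdiv_lt_0_compat; lra|].
  intros d f Hd Hf. destruct (Hw d) as [f' Hf']; [lra|].
  pose proof (near_atom_rigid d v w f f' ltac:(lra) Hf Hf') as Hr.
  specialize (Hdist (f' v)). pose proof (Cnorm_nonneg (f w)).
  apply Rmult_le_reg_r with D; [assumption|].
  replace (16 / D * d * D) with (16 * d) by (field; lra). nra.
Qed.

(** Splits off one atom [v]: its functionals almost vanish on the other atoms, so they read off the
    coefficient [f v] up to [O(d)], and the near-atom inequality separates [f v] from the rest in
    norm. *)
Lemma atoms_l1_independent (B : E -> Prop) : (forall v, B v -> atom v) ->
  (forall v w, B v -> B w -> (exists c, v = vscal E c w) -> v = w) -> l1_independent B.
Proof.
  intros HB Hprop L f HL. induction HL as [|v L Hv HL IH]; intros HLB.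
  - apply vnorm_vzero.
  - unfold wsum in *; simpl. set (z := vsum _ L) in *.
    assert (vnorm E z = fsum f L) as Hz by (apply IH; intros; apply HLB; now right).
    assert (atom v) as Hva by (apply HB, HLB; now left).
    apply Rle_antisym.
    + eapply Rle_trans; [apply vnorm_triangle|]. rewrite vnorm_scal, (atom_unit v Hva). lra.
    + assert (exists K, 0 <= K /\ forall d g, 0 < d <= 1 -> near_atom d v g ->
        Cnorm (g z) <= K * d) as (K & HK & HKb).
      { unfold z. clear z Hz IH. induction L as [|w L IHL].
        - exists 0. split; [lra|]. intros d g Hd (_ & Hg & _). simpl.
          rewrite clinear_zero, Cnorm_0 by assumption. lra.
        - assert (v <> w /\ ~ In v L) as [Hvw HvL] by (simpl in Hv; intuition congruence).
          inversion_clear HL. destruct IHL as (K1 & HK1 & HK1b); try assumption.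
          { intros x [<-|Hx]; apply HLB; simpl; auto. }
          destruct (nonproportional_atoms v w) as (K2 & HK2 & HK2b); [assumption| | |].
          { apply HB, HLB; simpl; auto. }
          { intros Hp. apply Hvw, Hprop; [apply HLB; simpl; auto..|assumption]. }
          pose proof (Cnorm_nonneg (f w)).
          exists (Cnorm (f w) * K2 + K1). split; [nra|]. intros d g Hd Hg. simpl.
          specialize (HK1b d g Hd Hg). specialize (HK2b d g Hd Hg). destruct Hg as (_ & Hg & _).
          rewrite (proj1 Hg), (proj2 Hg). eapply Rle_trans; [apply Cnorm_triangle|].
          rewrite Cnorm_mul. nra. }
      set (y := vadd E (vscal E (f v) v) z).
      apply le_of_small with (C := vnorm E y + 2 * Cnorm (f v) + 2 * K). intros d Hd.
      destruct (Hva d) as [g Hg]; [lra|]. specialize (HKb d g Hd Hg).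
      pose proof (atom_unit v Hva) as Hv1. destruct Hg as (_ & Hgl & Hgv & Hgx).
      specialize (Hgx y).
      assert (Cnorm (Csub (f v) (g y)) <= Cnorm (f v) * d + K * d) as Hfg.
      { unfold y. rewrite (proj1 Hgl), (proj2 Hgl).
        replace (Csub (f v) (Cadd (Cmul (f v) (g v)) (g z)))
          with (Cadd (Cmul (f v) (Csub C1 (g v))) (Copp (g z))) by ring.
        eapply Rle_trans; [apply Cnorm_triangle|]. rewrite Cnorm_mul, Cnorm_opp.
        pose proof (Cnorm_nonneg (f v)). nra. }
      pose proof (Cnorm_sub_le (f v) (g y)).
      assert (vnorm E z <= vnorm E (vsub E y (vscal E (g y) v)) + Cnorm (Csub (f v) (g y))) as H5.
      { replace z with (vsub E (vsub E y (vscal E (g y) v)) (vscal E (Csub (f v) (g y)) v)) at 1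
          by (unfold y; vring E).
        eapply Rle_trans; [apply vnorm_sub_le|]. rewrite vnorm_scal, Hv1. lra. }
      rewrite <- Hz. fold y. lra.
Qed.

Definition spanned_by_near_atoms : Prop := forall (x : E) (d : R), 0 < d <= 1 ->
  exists l : list (Cpx * E), (forall p, In p l -> exists f, near_atom d (snd p) f) /\
    vnorm E (vsub E x (lcomb (fun v => v) l)) <= d * vnorm E x /\
    rsum (fun p => Cnorm (fst p)) l <= (1 + d) * vnorm E x.

Hypotheses (Hcomplete : complete E) (Hspan : spanned_by_near_atoms).

(** Since [f e] is near 1 and the decomposition of [e] has mass near 1, some term [t] has [f t]
    above [1 / 2] in modulus. Rigidity puts [e] within [8 * d] of the line of [t]; normalizing the
    coefficient costs another [8 * d]. *)
Lemma near_atom_improve (d d' : R) (e : E) (f : E -> Cpx) : d <= 1 / 20 -> 0 < d' <= d ->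
  near_atom d e f -> exists e', (exists f', near_atom d' e' f') /\ vnorm E (vsub E e e') <= 16 * d.
Proof.
  intros Hd Hd' Hf. destruct (Hspan e d') as (l & Hl & Hle & Hlm); [lra|].
  pose proof (near_atom_bound _ _ _ Hf) as Hfb.
  pose proof Hf as (He & Hfl & Hfe & _). rewrite He in *.
  assert (exists p, In p l /\ 1 / 2 < Cnorm (f (snd p))) as (p & Hp & Hfp).
  { apply NNPP. intros Hn.
    assert (Cnorm (f (lcomb (fun v => v) l)) <= 1 / 2 * rsum (fun p => Cnorm (fst p)) l) as H1.
    { unfold lcomb. rewrite (@vlinear_vsum _ E Cspace f) by exact Hfl.
      eapply Rle_trans; [apply (@vnorm_vsum _ Cspace)|]. rewrite <- rsum_scal.
      apply rsum_le; intros p Hp. simpl. rewrite (proj2 Hfl), Cnorm_mul.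
      pose proof (Cnorm_nonneg (fst p)).
      assert (Cnorm (f (snd p)) <= 1 / 2); [|nra].
      apply Rnot_lt_le; intros H0. apply Hn. now exists p. }
    specialize (Hfb (vsub E e (lcomb (fun v => v) l))). rewrite clinear_sub in Hfb by assumption.
    pose proof (Cnorm_sub_le C1 (f e)). rewrite Cnorm_1 in *.
    pose proof (Cnorm_sub_le (f e) (f (lcomb (fun v => v) l))). nra. }
  destruct (Hl p Hp) as [g Hg]. set (t := snd p) in *.
  assert (0 <= d) by lra.
  pose proof (near_atom_rigid d e t f g ltac:(lra) Hf (near_atom_mono _ _ _ _ (proj2 Hd') Hg)) as Hr.
  set (c := g e) in *.
  assert (vnorm E (vsub E e (vscal E c t)) <= 8 * d) as H8
    by (pose proof (vnorm_nonneg E (vsub E e (vscal E c t))); nra).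
  assert (vnorm E t = 1) as Ht by apply Hg.
  assert (Rabs (Cnorm c - 1) <= 8 * d) as Hc.
  { pose proof (vnorm_le_sub e (vscal E c t)). pose proof (vnorm_le_sub (vscal E c t) e).
    rewrite (vnorm_sub_sym (vscal E c t)) in *. rewrite vnorm_scal in *. rewrite Ht, He in *.
    apply Rabs_le. lra. }
  assert (0 < Cnorm c) as Hc0 by (pose proof (Rle_abs (- (Cnorm c - 1))); rewrite Rabs_Ropp in *; lra).
  set (u := Cmul (Cre (/ Cnorm c)) c).
  assert (Cnorm u = 1) as Hu.
  { unfold u. rewrite Cnorm_mul, Cnorm_re, Rabs_pos_eq by (apply Rlt_le, Rinv_0_lt_compat; lra).
    field; lra. }
  exists (vscal E u t). split.
  - eexists. apply near_atom_phase; [exact Hu|exact Hg].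
  - replace (vsub E e (vscal E u t)) with (vadd E (vsub E e (vscal E c t))
      (vscal E (Cmul (Cre (Cnorm c - 1)) u) t)).
    + eapply Rle_trans; [apply vnorm_triangle|]. rewrite vnorm_scal, Cnorm_mul, Cnorm_re, Hu, Ht. lra.
    + vcoeffs E; [|ring]. unfold u. apply Cpx_eq; simpl; field; lra.
Qed.

(** Halving [d] at each improvement gives a Cauchy sequence, with [16 * d] summing to [32 * d]. The
    functional of stage [n] also serves the limit, with error [dn n + 2 * (32 * dn n)]; hence the
    divisor 65. *)
Lemma near_atom_close_to_atom (d : R) (e : E) (f : E -> Cpx) : 0 < d <= 1 / 20 ->
  near_atom d e f -> exists e', atom e' /\ vnorm E (vsub E e e') <= 32 * d.
Proof.
  intros Hd Hf. set (dn := fun n => d * (1 / 2) ^ n).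
  assert (forall n, 0 < dn n <= d) as Hdn.
  { intros n. unfold dn. assert (0 < (1 / 2) ^ n) by (apply pow_lt; lra).
    assert ((1 / 2) ^ n <= 1) by (induction n as [|n IHn]; simpl in *; [lra|];
      assert (0 < (1 / 2) ^ n) by (apply pow_lt; lra); specialize (IHn ltac:(assumption)); lra).
    split; [apply Rmult_lt_0_compat; lra|]. rewrite <- (Rmult_1_r d) at 2.
    apply Rmult_le_compat_l; lra. }
  assert (forall n, dn (S n) = dn n / 2) as HdS by (intros; unfold dn; simpl; field).
  set (P := fun n (x : E) => exists g, near_atom (dn n) x g).
  assert (forall q : nat * E, exists y, P (fst q) (snd q) ->
    P (S (fst q)) y /\ vnorm E (vsub E (snd q) y) <= 16 * dn (fst q)) as Hstep.
  { intros [n x]. simpl. destruct (classic (P n x)) as [[g Hg]|Hn].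
    - destruct (near_atom_improve (dn n) (dn (S n)) x g) as (y & Hy & Hxy).
      + specialize (Hdn n); lra.
      + rewrite HdS. specialize (Hdn n); lra.
      + assumption.
      + now exists y.
    - now exists x. }
  apply choice in Hstep. destruct Hstep as [step Hstep].
  set (s := fix s n := match n with O => e | S m => step (m, s m) end).
  assert (forall n, P n (s n)) as HP.
  { induction n as [|n IH].
    - exists f. unfold dn; simpl. now rewrite Rmult_1_r.
    - now apply (Hstep (n, s n)). }
  assert (forall m n, vnorm E (vsub E (s n) (s (n + m)%nat)) <= 32 * dn n) as Hdist.
  { induction m as [|m IH]; intros n.
    - rewrite Nat.add_0_r, vsub_diag, vnorm_vzero. specialize (Hdn n); lra.
    - pose proof (vnorm_sub_trans (s n) (s (S n)) (s (n + S m)%nat)) as Ht.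
      replace (n + S m)%nat with (S n + m)%nat in * by lia. specialize (IH (S n)).
      rewrite HdS in IH. destruct (Hstep (n, s n) (HP n)) as [_ H1]. simpl fst in H1. simpl snd in H1.
      change (step (n, s n)) with (s (S n)) in H1. lra. }
  assert (forall eps, eps > 0 -> exists n, forall m, (m >= n)%nat -> dn m < eps) as Hsmall.
  { intros eps He. destruct (pow_lt_1_zero (1 / 2)) with (y := eps) as [n Hn].
    - rewrite Rabs_pos_eq; lra.
    - assumption.
    - exists n. intros m Hm. specialize (Hn m Hm). rewrite Rabs_pos_eq in Hn by (apply pow_le; lra).
      unfold dn. assert (0 < (1 / 2) ^ m) by (apply pow_lt; lra). nra. }
  destruct (Hcomplete s) as [e' He'].
  { intros eps He. destruct (Hsmall (eps / 64)) as [n Hn]; [lra|]. exists n. intros m k Hm Hk.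
    pose proof (Hdist (m - n)%nat n) as H1. pose proof (Hdist (k - n)%nat n) as H2.
    replace (n + (m - n))%nat with m in H1 by lia. replace (n + (k - n))%nat with k in H2 by lia.
    pose proof (vnorm_sub_trans (s m) (s n) (s k)). rewrite (vnorm_sub_sym (s m) (s n)) in *.
    specialize (Hn n (le_n n)). lra. }
  assert (forall n, vnorm E (vsub E (s n) e') <= 32 * dn n) as Hlim.
  { intros n. apply le_of_small with (C := 1). intros eps He. destruct (He' eps) as [N HN]; [lra|].
    specialize (HN (n + N)%nat ltac:(lia)). specialize (Hdist N n).
    pose proof (vnorm_sub_trans (s n) (s (n + N)%nat) e'). lra. }
  assert (vnorm E e' = 1) as He1.
  { assert (forall n, vnorm E (s n) = 1) as Hs1 by (intros n; destruct (HP n) as [g Hg]; apply Hg).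
    apply Rle_antisym; apply le_of_small with (C := 1); intros eps He;
      destruct (Hsmall (eps / 32)) as [n Hn]; try lra; specialize (Hn n (le_n n));
      specialize (Hlim n); specialize (Hs1 n).
    - pose proof (vnorm_le_sub e' (s n)). rewrite (vnorm_sub_sym e') in *. lra.
    - pose proof (vnorm_le_sub (s n) e'). lra. }
  exists e'. split.
  - intros d' Hd'. destruct (Hsmall (d' / 65)) as [n Hn]; [lra|]. specialize (Hn n (le_n n)).
    destruct (HP n) as [g Hg]. exists g. apply near_atom_mono with (dn n + 2 * (32 * dn n)); [lra|].
    specialize (Hdn n). apply near_atom_perturb with (e := s n); [lra|assumption..|apply Hlim].
  - specialize (Hlim O). unfold dn in Hlim. simpl in Hlim. lra.
Qed.

Let same_line (e e' : E) : Prop := atom e' /\ exists c, e = vscal E c e'.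
(** Proportional atoms have the same predicate [same_line] by extensionality, so [epsilon] selects
    the same vector for both. This picks one atom on each line. *)
Let representative (e : E) : E := epsilon (inhabits e) (same_line e).
Let basis (v : E) : Prop := atom v /\ v = representative v.

Let representative_spec e : atom e -> same_line e (representative e).
Proof.
  intros He. apply epsilon_spec. exists e. split; [assumption|]. exists C1. now rewrite vscal_one.
Qed.

Let representative_eq e e' c : atom e -> e = vscal E c e' ->
  representative e = representative e'.
Proof.
  intros He Hc.
  assert (c <> C0) as Hc0.
  { intros ->. apply atom_unit in He. rewrite Hc, vscal_C0, vnorm_vzero in He. lra. }
  assert (e' = vscal E (Cinv c) e) as Hc'.
  { rewrite Hc, vscal_assoc. replace (Cmul (Cinv c) c) with (Cmul c (Cinv c)) by ring.
    now rewrite Cinv_r, vscal_one. }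
  assert (same_line e = same_line e') as Hs.
  { apply functional_extensionality; intros x. apply propositional_extensionality.
    split; intros (Hx & c' & Hc1); (split; [assumption|]).
    - exists (Cmul (Cinv c) c'). now rewrite <- vscal_assoc, <- Hc1.
    - exists (Cmul c c'). now rewrite <- vscal_assoc, <- Hc1. }
  unfold representative. rewrite Hs. f_equal. apply proof_irrelevance.
Qed.

Lemma atomic_l1_basis : exists B : E -> Prop, l1_independent B /\ forall x, in_closed_span B x.
Proof.
  exists basis. split.
  - apply atoms_l1_independent; [now intros v [Hv _]|].
    intros v w [Hv Hvr] [Hw Hwr] [c Hc]. rewrite Hvr, Hwr. now apply representative_eq with c.
  - intros x. apply closed_span_lim. intros eps Heps. pose proof (vnorm_nonneg E x) as Hx.
    (* The total error is [d] from the decomposition and [32 * d * 2] from replacing near-atoms by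
       atoms, relative to the norm of [x]; 100 exceeds 65. *)
    set (d := Rmin (1 / 20) (eps / (100 * (vnorm E x + 1)))).
    assert (0 < eps / (100 * (vnorm E x + 1))) by (apply Rdiv_lt_0_compat; lra).
    assert (0 < d <= 1 / 20) as Hd by (split; [apply Rmin_glb_lt; lra|apply Rmin_l]).
    assert (d * (100 * (vnorm E x + 1)) <= eps) as Hde.
    { replace eps with (eps / (100 * (vnorm E x + 1)) * (100 * (vnorm E x + 1))) by (field; lra).
      apply Rmult_le_compat_r; [lra|apply Rmin_r]. }
    destruct (Hspan x d) as (l & Hl & Hlx & Hlm); [lra|].
    assert (forall t, exists e', (exists f, near_atom d t f) ->
      atom e' /\ vnorm E (vsub E t e') <= 32 * d) as Hnear.
    { intros t. destruct (classic (exists f, near_atom d t f)) as [[f Hf]|Hn].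
      - destruct (near_atom_close_to_atom d t f Hd Hf) as (e' & He'). now exists e'.
      - now exists t. }
    apply choice in Hnear. destruct Hnear as [near Hnear].
    exists (lcomb near l). split.
    + apply closed_span_vsum. intros p Hp. apply closed_span_scal.
      destruct (Hnear (snd p) (Hl p Hp)) as [Ha _].
      destruct (representative_spec _ Ha) as (Hra & c & Hc). rewrite Hc.
      apply closed_span_scal, closed_span_elem. split; [assumption|].
      now apply representative_eq with c.
    + assert (vnorm E (vsub E (lcomb (fun v => v) l) (lcomb near l))
        <= 32 * d * rsum (fun p => Cnorm (fst p)) l) as H1.
      { unfold lcomb. rewrite <- vsum_sub. eapply Rle_trans; [apply vnorm_vsum|].
        rewrite <- rsum_scal. apply rsum_le; intros p Hp.
        replace (vsub E (vscal E (fst p) (snd p)) (vscal E (fst p) (near (snd p))))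
          with (vscal E (fst p) (vsub E (snd p) (near (snd p)))) by vring E.
        rewrite vnorm_scal. destruct (Hnear (snd p) (Hl p Hp)) as [_ Ha].
        pose proof (Cnorm_nonneg (fst p)). nra. }
      pose proof (vnorm_sub_trans x (lcomb (fun v => v) l) (lcomb near l)).
      assert (32 * d * rsum (fun p => Cnorm (fst p)) l <= 32 * d * (2 * vnorm E x))
        by (apply Rmult_le_compat_l; nra).
      nra.
Qed.
End Atoms.

(* Grothendieck's theorem on Banach spaces with the metric lifting property. *)
Theorem sections_l1_basis {I : Type} {E : NormedSpace} (b : I -> E) : complete E ->
  (forall i, vnorm E (b i) <= 1) ->
  (forall eps, eps > 0 -> exists phi, approx_section b eps phi) ->
  exists B : E -> Prop, l1_independent B /\ forall x, in_closed_span B x.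
Proof.
  intros HE Hb Hsec. apply atomic_l1_basis; [assumption|].
  intros x d Hd. exact (near_atom_decomposition b Hb Hsec x d Hd).
Qed.

Lemma bounded_agree {V W : NormedSpace} (f g : V -> W) (C : R) : vlinear f -> vlinear g ->
  (forall x, vnorm W (f x) <= C * vnorm V x) -> (forall x, vnorm W (g x) <= C * vnorm V x) ->
  (forall x eps, eps > 0 -> exists x', f x' = g x' /\ vnorm V (vsub V x x') < eps) ->
  forall x, f x = g x.
Proof.
  intros Hf Hg Hfb Hgb Hd x. apply vnorm_small_eq with (C := 2 * Rabs C). intros eps He.
  destruct (Hd x eps He) as (x' & Heq & Hx').
  specialize (Hfb (vsub V x x')). specialize (Hgb (vsub V x x')).
  rewrite vlinear_sub in Hfb, Hgb by assumption. rewrite Heq in Hfb.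
  pose proof (vnorm_sub_trans (f x) (g x') (g x)).
  rewrite (vnorm_sub_sym (g x') (g x)) in *.
  pose proof (Rle_abs C). pose proof (vnorm_nonneg V (vsub V x x')).
  assert (C * vnorm V (vsub V x x') <= Rabs C * eps) by (pose proof (Rabs_pos C); nra). lra.
Qed.

(** * The space l1 *)

Section L1.
Context {Lam : Type}.
Implicit Types (f g : Lam -> Cpx) (L : list Lam).

Definition l1norm (f : Lam -> Cpx) : R := epsilon (inhabits 0) (is_l1norm f).

Lemma fsum_nonneg f L : 0 <= fsum f L.
Proof. rewrite fsum_rsum. apply rsum_nonneg; intros; apply Cnorm_nonneg. Qed.

Lemma l1norm_spec f : in_l1 f -> is_l1norm f (l1norm f).
Proof.
  intros [B HB]. unfold l1norm. apply epsilon_spec.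
  destruct (completeness (fun t => exists L, NoDup L /\ t = fsum f L)) as [r [Hr1 Hr2]].
  - exists B. intros t (L & HL & ->). now apply HB.
  - exists 0, []. split; [constructor|reflexivity].
  - exists r. split.
    + intros L HL. apply Hr1. now exists L.
    + intros B' HB'. apply Hr2. intros t (L & HL & ->). now apply HB'.
Qed.

Lemma fsum_le_l1norm f L : in_l1 f -> NoDup L -> fsum f L <= l1norm f.
Proof. intros Hf. now apply l1norm_spec. Qed.

Lemma l1norm_le f B : l1_bound f B -> l1norm f <= B.
Proof. intros HB. apply l1norm_spec; [now exists B|assumption]. Qed.

Lemma l1norm_approx f eps : in_l1 f -> eps > 0 ->
  exists L, NoDup L /\ l1norm f - eps < fsum f L.
Proof.
  intros Hf He. apply NNPP. intros Hn.
  assert (l1norm f <= l1norm f - eps); [|lra].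
  apply l1norm_le. intros L HL. apply Rnot_lt_le. intros H. apply Hn. now exists L.
Qed.

Lemma l1norm_unique f r : in_l1 f -> is_l1norm f r -> l1norm f = r.
Proof.
  intros Hf [H1 H2]. apply Rle_antisym; [now apply l1norm_le|].
  apply H2. intros L HL. now apply fsum_le_l1norm.
Qed.

Lemma l1norm_nonneg f : in_l1 f -> 0 <= l1norm f.
Proof. intros Hf. apply (fsum_le_l1norm f []); [assumption|constructor]. Qed.

Lemma fsum_fadd f g L : fsum (fadd f g) L <= fsum f L + fsum g L.
Proof.
  induction L as [|i L IH]; simpl; [lra|].
  pose proof (Cnorm_triangle (f i) (g i)). unfold fadd in *. lra.
Qed.

Lemma fsum_fscal c f L : fsum (fscal c f) L = Cnorm c * fsum f L.
Proof. induction L as [|i L IH]; simpl; [ring|]. rewrite IH. unfold fscal. rewrite Cnorm_mul. ring. Qed.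

Lemma l1_bound_fadd f g a b : l1_bound f a -> l1_bound g b -> l1_bound (fadd f g) (a + b).
Proof.
  intros Hf Hg L HL. pose proof (fsum_fadd f g L). specialize (Hf L HL). specialize (Hg L HL). lra.
Qed.

Lemma l1_bound_fscal c f a : l1_bound f a -> l1_bound (fscal c f) (Cnorm c * a).
Proof.
  intros Hf L HL. rewrite fsum_fscal. apply Rmult_le_compat_l; [apply Cnorm_nonneg|auto].
Qed.

Lemma in_l1_fadd f g : in_l1 f -> in_l1 g -> in_l1 (fadd f g).
Proof. intros [a Ha] [b Hb]. exists (a + b). now apply l1_bound_fadd. Qed.

Lemma in_l1_fscal c f : in_l1 f -> in_l1 (fscal c f).
Proof. intros [a Ha]. exists (Cnorm c * a). now apply l1_bound_fscal. Qed.

Lemma l1norm_fadd f g : in_l1 f -> in_l1 g -> l1norm (fadd f g) <= l1norm f + l1norm g.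
Proof. intros Hf Hg. apply l1norm_le, l1_bound_fadd; now apply l1norm_spec. Qed.

Lemma l1norm_fscal c f : in_l1 f -> l1norm (fscal c f) = Cnorm c * l1norm f.
Proof.
  intros Hf. apply Rle_antisym; [apply l1norm_le, l1_bound_fscal, l1norm_spec, Hf|].
  pose proof (Cnorm_nonneg c) as [Hc|Hc].
  - apply Rmult_le_reg_l with (/ Cnorm c); [now apply Rinv_0_lt_compat|].
    replace (/ Cnorm c * (Cnorm c * l1norm f)) with (l1norm f) by (field; lra).
    apply l1norm_le. intros L HL. apply Rmult_le_reg_l with (Cnorm c); [assumption|].
    rewrite <- fsum_fscal. rewrite <- Rmult_assoc, Rinv_r, Rmult_1_l by lra.
    apply fsum_le_l1norm; [now apply in_l1_fscal|assumption].
  - rewrite <- Hc, Rmult_0_l. now apply l1norm_nonneg, in_l1_fscal.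
Qed.

Lemma l1norm_eq_0 f : in_l1 f -> l1norm f = 0 -> f = fun _ => C0.
Proof.
  intros Hf H0. apply functional_extensionality; intros i. apply Cnorm_eq_0.
  pose proof (fsum_le_l1norm f [i] Hf) as H. simpl in H. pose proof (Cnorm_nonneg (f i)).
  assert (NoDup [i]) by (constructor; [easy|constructor]). specialize (H H2). lra.
Qed.

Lemma in_l1_zero : in_l1 (fun _ : Lam => C0).
Proof.
  exists 0. intros L _. induction L as [|i L IH]; simpl; [lra|]. rewrite Cnorm_0. lra.
Qed.

Lemma l1_sig_eq (x y : {f : Lam -> Cpx | in_l1 f}) :
  (forall i, proj1_sig x i = proj1_sig y i) -> x = y.
Proof.
  destruct x as [f Hf], y as [g Hg]; simpl. intros H.
  assert (f = g) as -> by (apply functional_extensionality, H).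
  f_equal. apply proof_irrelevance.
Qed.

Definition l1space : NormedSpace.
Proof.
  refine {|
    carrier := {f : Lam -> Cpx | in_l1 f};
    vzero := exist _ (fun _ => C0) in_l1_zero;
    vadd := fun x y => exist _ (fadd (proj1_sig x) (proj1_sig y))
      (in_l1_fadd _ _ (proj2_sig x) (proj2_sig y));
    vopp := fun x => exist _ (fscal (Copp C1) (proj1_sig x)) (in_l1_fscal _ _ (proj2_sig x));
    vscal := fun c x => exist _ (fscal c (proj1_sig x)) (in_l1_fscal _ _ (proj2_sig x));
    vnorm := fun x => l1norm (proj1_sig x) |};
    try (intros; apply l1_sig_eq; intros; simpl; unfold fadd, fscal; ring).
  - intros x. apply l1norm_nonneg, proj2_sig.
  - intros x H. apply l1_sig_eq. intros i. now rewrite (l1norm_eq_0 _ (proj2_sig x) H).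
  - intros c x. apply l1norm_fscal, proj2_sig.
  - intros x y. apply l1norm_fadd; apply proj2_sig.
Defined.

Lemma l1_coord_sub (x y : l1space) i :
  proj1_sig (vsub l1space x y) i = Csub (proj1_sig x i) (proj1_sig y i).
Proof. simpl. unfold fadd, fscal. ring. Qed.

Lemma l1_coord_le (x : l1space) i : Cnorm (proj1_sig x i) <= vnorm l1space x.
Proof.
  pose proof (fsum_le_l1norm (proj1_sig x) [i] (proj2_sig x)) as H. simpl in *.
  assert (NoDup [i]) as HN by (constructor; [easy|constructor]). specialize (H HN). lra.
Qed.

Lemma Cpx_complete (z : nat -> Cpx) :
  (forall eps, eps > 0 -> exists N, forall m k, (m >= N)%nat -> (k >= N)%nat ->
     Cnorm (Csub (z m) (z k)) < eps) ->
  exists l, forall eps, eps > 0 -> exists N, forall m, (m >= N)%nat -> Cnorm (Csub (z m) l) < eps.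
Proof.
  intros H.
  destruct (R_complete (fun n => fst (z n))) as [a Ha].
  { intros eps He. destruct (H eps He) as [N HN]. exists N. intros m k Hm Hk.
    eapply Rle_lt_trans; [apply (Cnorm_re_le (Csub (z m) (z k)))|auto]. }
  destruct (R_complete (fun n => snd (z n))) as [b Hb].
  { intros eps He. destruct (H eps He) as [N HN]. exists N. intros m k Hm Hk.
    eapply Rle_lt_trans; [apply (Cnorm_im_le (Csub (z m) (z k)))|auto]. }
  exists (a, b). intros eps He.
  destruct (Ha (eps / 2)) as [N HN]; [lra|]. destruct (Hb (eps / 2)) as [M HM]; [lra|].
  exists (N + M)%nat. intros m Hm. eapply Rle_lt_trans; [apply Cnorm_le_abs|].
  specialize (HN m ltac:(lia)). specialize (HM m ltac:(lia)).
  unfold Rdist, Csub, Cadd, Copp in *; simpl. unfold Rminus in *. lra.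
Qed.

Lemma l1space_complete : complete l1space.
Proof.
  intros u Hu.
  assert (forall i, exists l, forall eps, eps > 0 -> exists N, forall m, (m >= N)%nat ->
    Cnorm (Csub (proj1_sig (u m) i) l) < eps) as Hpt.
  { intros i. apply Cpx_complete. intros eps He. destruct (Hu eps He) as [N HN]. exists N.
    intros m k Hm Hk. rewrite <- l1_coord_sub.
    eapply Rle_lt_trans; [apply l1_coord_le|auto]. }
  apply choice in Hpt. destruct Hpt as [l Hl].
  assert (forall eps, eps > 0 -> exists N, forall m, (m >= N)%nat ->
    l1_bound (fun i => Csub (proj1_sig (u m) i) (l i)) eps) as Hlim.
  { intros eps He. destruct (Hu eps He) as [N HN]. exists N. intros m Hm L HL.
    apply le_of_small with (C := 1). intros eta Heta.
    (* On a fixed finite list coordinatewise convergence is uniform, so the Cauchy bound passes to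
       the limit on each list separately. *)
    assert (forall L', exists K, forall k, (k >= K)%nat ->
      fsum (fun i => Csub (proj1_sig (u k) i) (l i)) L' < eta) as HK.
    { assert (forall L' eta, eta > 0 -> exists K, forall k, (k >= K)%nat ->
        fsum (fun i => Csub (proj1_sig (u k) i) (l i)) L' < eta) as HK; [|intros; apply HK; lra].
      clear - Hl. induction L' as [|i L' IH]; intros eta He; [exists O; intros; simpl; lra|].
      destruct (IH (eta / 2)) as [K1 HK1]; [lra|]. destruct (Hl i (eta / 2)) as [K2 HK2]; [lra|].
      exists (K1 + K2)%nat. intros k Hk. specialize (HK1 k ltac:(lia)). specialize (HK2 k ltac:(lia)).
      simpl. lra. }
    destruct (HK L) as [K HKL]. specialize (HKL (N + K)%nat ltac:(lia)).
    specialize (HN m (N + K)%nat Hm ltac:(lia)).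
    pose proof (fsum_le_l1norm _ L (proj2_sig (vsub l1space (u m) (u (N + K)%nat))) HL) as H1.
    assert (fsum (fun i => Csub (proj1_sig (u m) i) (l i)) L <=
      fsum (proj1_sig (vsub l1space (u m) (u (N + K)%nat))) L +
      fsum (fun i => Csub (proj1_sig (u (N + K)%nat) i) (l i)) L) as H2.
    { eapply Rle_trans; [|apply fsum_fadd]. rewrite !fsum_rsum. apply Req_le, rsum_ext.
      intros i _. f_equal. unfold fadd. rewrite l1_coord_sub. ring. }
    change (l1norm (proj1_sig (vsub l1space (u m) (u (N + K)%nat)))) with
      (vnorm l1space (vsub l1space (u m) (u (N + K)%nat))) in H1. lra. }
  assert (in_l1 l) as Hin.
  { destruct (Hlim 1) as [N HN]; [lra|]. specialize (HN N (le_n N)).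
    replace l with (fadd (proj1_sig (u N)) (fscal (Copp C1) (fun i => Csub (proj1_sig (u N) i) (l i)))).
    - apply in_l1_fadd; [apply proj2_sig|]. apply in_l1_fscal. now exists 1.
    - apply functional_extensionality; intros i. unfold fadd, fscal. ring. }
  exists (exist _ l Hin). intros eps He. destruct (Hlim (eps / 2)) as [N HN]; [lra|].
  exists N. intros m Hm. apply Rle_lt_trans with (eps / 2); [|lra].
  apply l1norm_le. intros L HL. eapply Rle_trans; [|apply (HN m Hm L HL)].
  rewrite !fsum_rsum. apply Req_le, rsum_ext. intros i _. f_equal. apply l1_coord_sub.
Qed.

Definition delta_fun (i : Lam) : Lam -> Cpx :=
  fun j => if excluded_middle_informative (j = i) then C1 else C0.

Lemma fsum_supported f L : (forall i, In i L -> f i = C0) -> fsum f L = 0.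
Proof.
  induction L as [|i L IH]; simpl; intros H; [reflexivity|].
  rewrite (H i), IH, Cnorm_0 by auto. ring.
Qed.

Lemma delta_bound i : l1_bound (delta_fun i) 1.
Proof.
  intros L HL. induction HL as [|j L Hj HL IH]; simpl; [lra|].
  unfold delta_fun at 1. destruct (excluded_middle_informative (j = i)) as [->|_].
  - rewrite fsum_supported, Cnorm_1; [lra|]. intros k Hk. unfold delta_fun.
    destruct (excluded_middle_informative (k = i)) as [->|]; [contradiction|reflexivity].
  - rewrite Cnorm_0. lra.
Qed.

Definition delta (i : Lam) : l1space := exist _ (delta_fun i) (ex_intro _ 1 (delta_bound i)).

Lemma delta_norm_le i : vnorm l1space (delta i) <= 1.
Proof. apply l1norm_le, delta_bound. Qed.

Lemma wsum_delta_cons f i L j : proj1_sig (wsum delta f (i :: L)) j =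
  Cadd (Cmul (f i) (delta_fun i j)) (proj1_sig (wsum delta f L) j).
Proof. reflexivity. Qed.

Lemma wsum_delta_out f L j : ~ In j L -> proj1_sig (wsum delta f L) j = C0.
Proof.
  induction L as [|i L IH]; intros H; [reflexivity|]. rewrite wsum_delta_cons.
  rewrite IH by (intros Hj; apply H; now right). unfold delta_fun.
  destruct (excluded_middle_informative (j = i)) as [->|]; [|ring].
  exfalso; apply H; now left.
Qed.

Lemma wsum_delta_in f L j : NoDup L -> In j L -> proj1_sig (wsum delta f L) j = f j.
Proof.
  intros HL. induction HL as [|i L Hi HL IH]; [easy|]. intros Hj. rewrite wsum_delta_cons.
  unfold delta_fun. destruct (excluded_middle_informative (j = i)) as [->|Hji].
  - rewrite wsum_delta_out by assumption. ring.
  - destruct Hj as [->|Hj]; [contradiction|]. rewrite IH by assumption. ring.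
Qed.

Lemma fsum_le_norm_wsum f L : NoDup L -> fsum f L <= vnorm l1space (wsum delta f L).
Proof.
  intros HL. eapply Rle_trans; [|apply (fsum_le_l1norm _ L (proj2_sig (wsum delta f L)) HL)].
  rewrite !fsum_rsum. apply Req_le, rsum_ext. intros i Hi. now rewrite wsum_delta_in.
Qed.

(** The l1-norm is additive over disjoint index sets. This is the source of the mass-plus-remainder
    bound in [approx_section]. *)
Lemma l1_truncation (x : l1space) L : NoDup L ->
  vnorm l1space (vsub l1space x (wsum delta (proj1_sig x) L))
  <= vnorm l1space x - fsum (proj1_sig x) L.
Proof.
  intros HL. apply l1norm_le. intros L' HL'.
  set (M := filter (fun i => negb (decide (In i L))) L').
  assert (fsum (proj1_sig (vsub l1space x (wsum delta (proj1_sig x) L))) L'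
    <= fsum (proj1_sig x) M) as H1.
  { rewrite !fsum_rsum. rewrite (rsum_filter (fun i => decide (In i L)) _ L'). fold M.
    rewrite (rsum_ext _ (fun _ => 0 * 0) (filter _ _)).
    - rewrite rsum_scal, Rmult_0_l, Rplus_0_l. apply Req_le, rsum_ext. intros i Hi.
      apply filter_In in Hi. destruct Hi as [_ Hi]. apply (proj1 (decide_false _)) in Hi.
      rewrite l1_coord_sub, wsum_delta_out by assumption. f_equal. ring.
    - intros i Hi. apply filter_In in Hi. destruct Hi as [_ Hi].
      apply (proj1 (decide_true _)) in Hi. rewrite l1_coord_sub, wsum_delta_in by assumption.
      replace (Csub (proj1_sig x i) (proj1_sig x i)) with C0 by ring. rewrite Cnorm_0. ring. }
  assert (NoDup (M ++ L)) as H2.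
  { apply NoDup_app; [apply NoDup_filter, HL'|assumption|].
    intros i Hi. apply filter_In in Hi. destruct Hi as [_ Hi]. now apply (proj1 (decide_false _)) in Hi. }
  pose proof (fsum_le_l1norm _ _ (proj2_sig x) H2) as H3. rewrite !fsum_rsum, rsum_app in *.
  simpl vnorm. lra.
Qed.

Lemma l1_approx (x : l1space) eps : eps > 0 ->
  exists L, NoDup L /\ vnorm l1space (vsub l1space x (wsum delta (proj1_sig x) L)) < eps.
Proof.
  intros He. destruct (l1norm_approx (proj1_sig x) eps (proj2_sig x) He) as (L & HL & H).
  exists L. split; [assumption|]. pose proof (l1_truncation x L HL). simpl vnorm in *. lra.
Qed.

(** * The canonical map from l1 onto a Banach space *)

Section Cover.
Context {E : NormedSpace} (b : Lam -> E).
Hypotheses (HE : complete E) (Hb : forall i, vnorm E (b i) <= 1).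

Lemma l1_cover : exists q : l1space -> E, vlinear q /\
  (forall x, vnorm E (q x) <= vnorm l1space x) /\ (forall i, q (delta i) = b i).
Proof.
  destruct (graph_extension (fun x y => exists l : list (Cpx * Lam),
    x = lcomb delta l /\ y = lcomb b l) 1) as (q & Hq & Hqb & Hqd); try assumption.
  - lra.
  - intros x y x' y' (l & -> & ->) (l' & -> & ->). exists (l ++ l').
    unfold lcomb. now rewrite !vsum_app.
  - intros c x y (l & -> & ->). eexists. now rewrite <- !lcomb_scal.
  - intros x y (l & -> & ->). destruct (lcomb_collect (fun _ => True) l) as (L & f & HL & _ & H);
      [easy|]. rewrite !H. pose proof (fsum_le_norm_wsum f L HL).
    pose proof (vnorm_wsum b f L (fun i _ => Hb i)). lra.
  - intros x eps He. destruct (l1_approx x eps He) as (L & _ & H).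
    exists (wsum delta (proj1_sig x) L), (wsum b (proj1_sig x) L). split; [|assumption].
    exists (map (fun i => (proj1_sig x i, i)) L). now rewrite !wsum_lcomb.
  - exists q. split; [assumption|]. split.
    + intros x. specialize (Hqb x). lra.
    + intros i. apply Hqd. exists [(C1, i)]. unfold lcomb. cbn [vsum fst snd].
      now rewrite !vscal_one, !vadd_zero.
Qed.

Lemma cover_wsum (q : l1space -> E) : vlinear q -> (forall i, q (delta i) = b i) ->
  forall f L, q (wsum delta f L) = wsum b f L.
Proof.
  intros Hq Hd f L. unfold wsum. rewrite vlinear_vsum by assumption.
  apply vsum_ext; intros. now rewrite (proj2 Hq), Hd.
Qed.

(** As [q] is contractive, truncation of [psi y] in l1 bounds the remainder of [y] in [E]. *)
Lemma approx_section_of_lifting (q : l1space -> E) (psi : E -> l1space) (eps : R) :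
  vlinear q -> (forall x, vnorm E (q x) <= vnorm l1space x) -> (forall i, q (delta i) = b i) ->
  vlinear psi -> (forall y, q (psi y) = y) ->
  (forall y, vnorm l1space (psi y) <= (1 + eps) * vnorm E y) ->
  approx_section b eps (fun i y => proj1_sig (psi y) i).
Proof.
  intros Hq Hqb Hd Hp Hqp Hpb.
  assert (forall L y, vnorm E (vsub E y (wsum b (proj1_sig (psi y)) L)) <=
    vnorm l1space (vsub l1space (psi y) (wsum delta (proj1_sig (psi y)) L))) as H.
  { intros L y. rewrite <- (Hqp y) at 1. rewrite <- (cover_wsum q Hq Hd), <- vlinear_sub by assumption.
    apply Hqb. }
  split; [|split].
  - intros i. split; intros; [now rewrite (proj1 Hp)|now rewrite (proj2 Hp)].
  - intros L y HL. specialize (H L y). pose proof (l1_truncation (psi y) L HL). specialize (Hpb y).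
    change (fun i => proj1_sig (psi y) i) with (proj1_sig (psi y)). lra.
  - intros y eta He. destruct (l1_approx (psi y) eta He) as (L & HL & H1).
    exists L. split; [assumption|]. specialize (H L y).
    change (fun i => proj1_sig (psi y) i) with (proj1_sig (psi y)). lra.
Qed.
End Cover.
End L1.
Arguments l1space Lam : clear implicits.

Lemma l1_basis_isometry {E : NormedSpace} (B : E -> Prop) : complete E -> l1_independent B ->
  (forall x, in_closed_span B x) ->
  exists q : l1space {v : E | B v} -> E, vlinear q /\
    (forall x, vnorm E (q x) = vnorm (l1space _) x) /\ forall y, exists x, q x = y.
Proof.
  intros HE HB Hspan. set (b := fun i : {v : E | B v} => proj1_sig i).
  assert (forall i, vnorm E (b i) <= 1) as Hb.
  { intros [v Hv]. apply Req_le. now apply (l1_independent_unit B). }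
  destruct (l1_cover b HE Hb) as (q & Hq & Hqb & Hqd).
  assert (forall f L, NoDup L -> vnorm E (wsum b f L) = fsum f L) as Hfin.
  { intros f L HL.
    (* [l1_independent] takes coefficients on all of [E], so [f] is extended by zero outside [B]. *)
    set (g := fun v => match excluded_middle_informative (B v) with
      | left H => f (exist _ v H) | right _ => C0 end).
    assert (forall i, g (b i) = f i) as Hg.
    { intros [v Hv]. unfold g, b; simpl. destruct (excluded_middle_informative (B v)) as [H|]; [|easy].
      do 2 f_equal. apply proof_irrelevance. }
    pose proof (HB (map b L) g) as H. unfold wsum in *. rewrite vsum_map, fsum_rsum, rsum_map in H.
    rewrite fsum_rsum, (rsum_ext _ (fun i => Cnorm (g (b i)))) by (intros; now rewrite Hg).
    rewrite <- H.
    - f_equal. apply vsum_ext; intros; now rewrite Hg.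
    - apply Injective_map_NoDup; [|assumption]. intros [v Hv] [w Hw]; unfold b; simpl.
      intros ->. f_equal. apply proof_irrelevance.
    - intros v Hv. apply in_map_iff in Hv. destruct Hv as ([w Hw] & <- & _). exact Hw. }
  assert (forall x, vnorm E (q x) = vnorm (l1space _) x) as Hiso.
  { intros x. apply Rle_antisym; [apply Hqb|]. apply le_of_small with (C := 2). intros eps He.
    destruct (l1_approx x eps) as (L & HL & H); [lra|].
    set (y := wsum delta (proj1_sig x) L) in *.
    pose proof (vnorm_le_sub x y). pose proof (vnorm_le_sub (q y) (q x)) as H1.
    rewrite vnorm_sub_sym, <- vlinear_sub in H1 by assumption. specialize (Hqb (vsub _ x y)).
    assert (vnorm _ y <= vnorm E (q y)); [|lra].
    unfold y. rewrite (cover_wsum b q Hq Hqd), Hfin by assumption.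
    apply vnorm_wsum; intros; apply delta_norm_le. }
  exists q. split; [assumption|]. split; [assumption|].
  (* Surjectivity comes from extending the inverse of [q] off its dense range, which is possible
     because [q] is isometric and l1 is complete. *)
  destruct (graph_extension (fun y x => y = q x) 1) as (psi & Hp & Hpb & Hpq).
  - lra.
  - apply (@l1space_complete {v : E | B v}).
  - intros y x y' x' -> ->. symmetry. apply (proj1 Hq).
  - intros c y x ->. symmetry. apply (proj2 Hq).
  - intros y x ->. rewrite Hiso. lra.
  - intros y eps He. destruct (Hspan y eps He) as (l & Hl & Hly).
    exists (lcomb (fun v => v) l).
    assert (exists x, lcomb (fun v => v) l = q x) as [x Hx]; [|now exists x].
    clear - Hl Hq Hqd. induction l as [|[c v] l IH].
    + exists vzero. symmetry. now apply vlinear_zero.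
    + destruct IH as [x Hx]; [intros; apply Hl; now right|].
      assert (B v) as Hv by (apply (Hl (c, v)); now left).
      exists (vadd _ (vscal _ c (delta (exist _ v Hv))) x).
      rewrite (proj1 Hq), (proj2 Hq), Hqd, <- Hx. reflexivity.
  - intros y. exists (psi y).
    apply (bounded_agree (fun y => q (psi y)) (fun y => y) 1).
    + split; intros; [now rewrite (proj1 Hp), (proj1 Hq)|now rewrite (proj2 Hp), (proj2 Hq)].
    + split; reflexivity.
    + intros z. rewrite Hiso. apply Hpb.
    + intros z. lra.
    + intros z eps He. destruct (Hspan z eps He) as (l & Hl & Hlz).
      exists (lcomb (fun v => v) l). split; [|assumption].
      unfold lcomb. rewrite vlinear_vsum by assumption. rewrite vlinear_vsum by assumption.
      apply vsum_ext. intros [c v] Hv. simpl. rewrite (proj2 Hp), (proj2 Hq). f_equal.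
      assert (B v) as HBv by (apply (Hl (c, v)), Hv).
      rewrite (Hpq v (delta (exist _ v HBv))); now rewrite Hqd.
Qed.

(** * Coordinates in modules over a sequence algebra *)

Section Coordinates.
Context {A : SeqAlg}.

Lemma pvec_in (n : nat) : inA A (pvec n).
Proof.
  apply inA_c00. exists (S n). intros k Hk. unfold pvec.
  destruct (Nat.eqb_spec k n); [lia|reflexivity].
Qed.

Lemma pvec_same (n : nat) : pvec n n = C1.
Proof. unfold pvec. now rewrite Nat.eqb_refl. Qed.

Lemma pvec_other (n m : nat) : m <> n -> pvec n m = C0.
Proof. intros H. unfold pvec. now destruct (Nat.eqb_spec m n). Qed.

Lemma smul_pvec_l (a : cseq) (n : nat) : smul (pvec n) a = sscal (a n) (pvec n).
Proof.
  apply functional_extensionality; intros k. unfold smul, sscal, pvec.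
  destruct (Nat.eqb_spec k n) as [->|]; ring.
Qed.

Lemma smul_pvec_r (a : cseq) (n : nat) : smul a (pvec n) = sscal (a n) (pvec n).
Proof.
  apply functional_extensionality; intros k. unfold smul, sscal, pvec.
  destruct (Nat.eqb_spec k n) as [->|]; ring.
Qed.

Lemma coefficient_le_normA (a : cseq) (n : nat) : inA A a -> Cnorm (a n) <= normA A a.
Proof.
  intros Ha. pose proof (normA_mul A _ _ (pvec_in n) Ha) as H.
  rewrite smul_pvec_l, normA_scal, normA_pvec in H by apply pvec_in. lra.
Qed.

Section OneModule.
Context (X : AModule A).

Lemma act_coord (a : cseq) (n : nat) (x : X) : inA A a ->
  act X a (coord X n x) = vscal X (a n) (coord X n x).
Proof.
  intros Ha. unfold coord. rewrite <- act_mul by (assumption || apply pvec_in).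
  now rewrite smul_pvec_r, act_scal_l by apply pvec_in.
Qed.

Lemma coord_act (a : cseq) (n : nat) (x : X) : inA A a ->
  coord X n (act X a x) = vscal X (a n) (coord X n x).
Proof.
  intros Ha. unfold coord. rewrite <- act_mul by (assumption || apply pvec_in).
  now rewrite smul_pvec_l, act_scal_l by apply pvec_in.
Qed.

Lemma coord_coord_same (n : nat) (x : X) : coord X n (coord X n x) = coord X n x.
Proof. unfold coord at 1. rewrite act_coord, pvec_same by apply pvec_in. apply vscal_one. Qed.

Lemma coord_coord_other (n m : nat) (x : X) : n <> m -> coord X m (coord X n x) = vzero.
Proof.
  intros H. unfold coord at 1. rewrite act_coord, pvec_other by (apply pvec_in || assumption).
  apply vscal_C0.
Qed.

Lemma coord_linear (n : nat) : @vlinear X X (coord X n).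
Proof.
  split; intros; [apply act_add_r|apply act_scal_r]; apply pvec_in.
Qed.

Lemma coord_norm_le (n : nat) (x : X) : vnorm X (coord X n x) <= vnorm X x.
Proof.
  unfold coord. eapply Rle_trans; [apply act_contractive, pvec_in|]. rewrite normA_pvec. lra.
Qed.

Lemma in_coord_iff (n : nat) (y : X) : in_coord_subspace X n y <-> coord X n y = y.
Proof.
  split; [intros [x ->]; apply coord_coord_same|intros H; now exists y].
Qed.

Lemma coord_fix_add (n : nat) (x y : X) :
  coord X n x = x -> coord X n y = y -> coord X n (vadd X x y) = vadd X x y.
Proof. intros Hx Hy. now rewrite (proj1 (coord_linear n)), Hx, Hy. Qed.

Lemma coord_fix_scal (n : nat) (c : Cpx) (x : X) :
  coord X n x = x -> coord X n (vscal X c x) = vscal X c x.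
Proof. intros Hx. now rewrite (proj2 (coord_linear n)), Hx. Qed.

Lemma coord_sig_eq (n : nat) (x y : {x : X | coord X n x = x}) :
  proj1_sig x = proj1_sig y -> x = y.
Proof.
  destruct x as [x Hx], y as [y Hy]; simpl. intros ->. f_equal. apply proof_irrelevance.
Qed.

Definition coord_space (n : nat) : NormedSpace.
Proof.
  refine {|
    carrier := {x : X | coord X n x = x};
    vzero := exist _ vzero (vlinear_zero _ (coord_linear n));
    vadd := fun x y => exist _ (vadd X (proj1_sig x) (proj1_sig y))
      (coord_fix_add n _ _ (proj2_sig x) (proj2_sig y));
    vopp := fun x => exist _ (vscal X (Copp C1) (proj1_sig x))
      (coord_fix_scal n _ _ (proj2_sig x));
    vscal := fun c x => exist _ (vscal X c (proj1_sig x)) (coord_fix_scal n c _ (proj2_sig x));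
    vnorm := fun x => vnorm X (proj1_sig x) |};
    try solve [intros; apply coord_sig_eq; simpl; vring X].
  - intros x. apply vnorm_nonneg.
  - intros x H. apply coord_sig_eq. simpl. now apply vnorm_zero.
  - intros c x. apply vnorm_scal.
  - intros x y. apply vnorm_triangle.
Defined.

Lemma coord_space_sub (n : nat) (x y : coord_space n) :
  proj1_sig (vsub (coord_space n) x y) = vsub X (proj1_sig x) (proj1_sig y).
Proof. simpl. vring X. Qed.

Lemma coord_space_complete (n : nat) : complete X -> complete (coord_space n).
Proof.
  intros HX u Hu. destruct (HX (fun k => proj1_sig (u k))) as [l Hl].
  { intros eps He. destruct (Hu eps He) as [N HN]. exists N. intros m k Hm Hk.
    rewrite <- coord_space_sub. now apply HN. }
  assert (coord X n l = l) as Hfix.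
  { apply vnorm_small_eq with (C := 2). intros eps He. destruct (Hl eps He) as [N HN].
    specialize (HN N (le_n N)). set (y := proj1_sig (u N)) in *.
    assert (coord X n y = y) as Hy by apply (proj2_sig (u N)).
    pose proof (vnorm_sub_trans (coord X n l) y l). rewrite <- Hy in H at 1.
    rewrite <- (vlinear_sub _ (coord_linear n)) in H.
    pose proof (coord_norm_le n (vsub X l y)). rewrite (vnorm_sub_sym l y) in *. lra. }
  exists (exist (fun x => coord X n x = x) l Hfix). intros eps He. destruct (Hl eps He) as [N HN]. exists N. intros m Hm.
  change (vnorm X (proj1_sig (vsub (coord_space n) (u m) (exist (fun x => coord X n x = x) l Hfix))) < eps).
  rewrite coord_space_sub. now apply HN.
Qed.
End OneModule.

(** Embeds Banach spaces into modules: only the [n]-th coordinate is nonzero, and it is the whole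
    space. Homogeneity is then immediate, and bounded linear maps are module maps. *)
Definition eval_module (n : nat) (V : NormedSpace) : AModule A.
Proof.
  refine {| msp := V; act := fun a v => vscal V (a n) v |}; intros; unfold sadd, sscal, smul.
  - vring V.
  - vring V.
  - vring V.
  - vring V.
  - vring V.
  - rewrite vnorm_scal. apply Rmult_le_compat_r; [apply vnorm_nonneg|now apply coefficient_le_normA].
Defined.

Lemma eval_module_Hbar (n : nat) (V : NormedSpace) : complete V -> in_Hbar (eval_module n V).
Proof.
  intros HV. split; [exact HV|]. split.
  - intros x eps He. exists [(pvec n, x)]. split.
    + constructor; [apply pvec_in|constructor].
    + cbn [act_sum]. simpl. rewrite pvec_same, vscal_one, vadd_zero, vsub_diag, vnorm_vzero. exact He.
  - intros x y H. specialize (H n). unfold coord in H. simpl in *.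
    now rewrite pvec_same, !vscal_one in H.
Qed.
End Coordinates.

(** The least bound is an infimum, obtained as a supremum of negated bounds. *)
Lemma opnorm_exists {X Y : NormedSpace} (f : X -> Y) (M : R) : op_bound f M ->
  exists r, is_opnorm f r.
Proof.
  intros HM. destruct (completeness (fun t => op_bound f (- t))) as [m [Hm1 Hm2]].
  - exists 0. intros t [Ht _]. lra.
  - exists (- M). now rewrite Ropp_involutive.
  - exists (- m). split.
    + split.
      * assert (m <= 0); [|lra]. apply Hm2. intros t [Ht _]. lra.
      * intros x. pose proof (vnorm_nonneg X x) as [Hx|Hx].
        -- assert (m <= - (vnorm Y (f x) / vnorm X x)) as H.
           { apply Hm2. intros t [_ Ht]. specialize (Ht x).
             assert (vnorm Y (f x) / vnorm X x <= - t); [|lra].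
             apply Rmult_le_reg_r with (vnorm X x); [assumption|].
             replace (vnorm Y (f x) / vnorm X x * vnorm X x) with (vnorm Y (f x)) by (field; lra).
             assumption. }
           replace (vnorm Y (f x)) with (vnorm Y (f x) / vnorm X x * vnorm X x) by (field; lra).
           apply Rmult_le_compat_r; lra.
        -- destruct HM as [_ HM]. specialize (HM x). rewrite <- Hx in *. lra.
    + intros M' HM'. assert (- M' <= m); [|lra]. apply Hm1. now rewrite Ropp_involutive.
Qed.

(** * Necessity: from projectivity to l1-coordinates *)

Section Necessity.
Context {A : SeqAlg} (X : AModule A) (n : nat).
Hypotheses (HX : complete X) (Hproj : extremely_projective_Hbar X).

Let E := coord_space X n.
(** The generators are the unit ball of [E]. Indexing by all of [E], with zero outside the ball,
    avoids a subtype. *)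
Let b (v : E) : E := if excluded_middle_informative (vnorm E v <= 1) then v else vzero.

Let b_norm v : vnorm E (b v) <= 1.
Proof.
  unfold b. destruct (excluded_middle_informative (vnorm E v <= 1)); [assumption|].
  rewrite vnorm_vzero. lra.
Qed.

Let sections (eps : R) : eps > 0 -> exists phi, approx_section b eps phi.
Proof.
  intros He. pose proof (coord_space_complete X n HX) as HE.
  destruct (l1_cover b HE b_norm) as (q & Hq & Hqb & Hqd).
  set (phi := fun x : X => exist (fun x => coord X n x = x) (coord X n x) (coord_coord_same X n x) : E).
  assert (op_bound (Y := E) phi 1) as Hphi1.
  { split; [lra|]. intros x. simpl. pose proof (coord_norm_le X n x). lra. }
  destruct (opnorm_exists _ _ Hphi1) as [r Hr].
  destruct (Hproj (eval_module n (l1space E)) (eval_module n E)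
    (eval_module_Hbar n _ l1space_complete) (eval_module_Hbar n _ HE) q) with (phi := phi) (eps := eps)
    as (psi & (Hpa & Hps & _ & _) & Hlift & Hnorm).
  - split; [apply (proj1 Hq)|]. split; [apply (proj2 Hq)|]. split.
    + intros a x _. apply (proj2 Hq).
    + exists 1. split; [lra|]. intros x. specialize (Hqb x). simpl in *. lra.
  - split.
    + split; [lra|]. intros x. specialize (Hqb x). simpl in *. lra.
    + intros x eta Heta. change (exists y : l1space E, q y = x /\ vnorm (l1space E) y < vnorm E x + eta).
      destruct (Req_dec (vnorm E x) 0) as [H0|H0].
      * exists vzero. rewrite vlinear_zero, vnorm_vzero by assumption.
        split; [symmetry; now apply vnorm_zero|lra].
      * assert (0 < vnorm E x) as Hx by (pose proof (vnorm_nonneg E x); lra).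
        (* The multiple of [delta u] by the norm of [x] lifts [x] without loss of norm. *)
        set (u := vscal E (Cre (/ vnorm E x)) x).
        assert (vnorm E u = 1) as Hu.
        { unfold u. rewrite vnorm_scal, Cnorm_re, Rabs_pos_eq; [field; lra|].
          apply Rlt_le, Rinv_0_lt_compat, Hx. }
        exists (vscal _ (Cre (vnorm E x)) (delta u)). split.
        -- rewrite (proj2 Hq), Hqd. unfold b.
           destruct (excluded_middle_informative (vnorm E u <= 1)); [|lra].
           unfold u. rewrite vscal_assoc. transitivity (vscal E C1 x); [|apply vscal_one].
           f_equal. apply Cpx_eq; simpl; field; exact H0.
        -- rewrite vnorm_scal, Cnorm_re, Rabs_pos_eq by lra. pose proof (delta_norm_le u). nra.
  - repeat split.
    + intros x y. apply (coord_sig_eq X n). apply (proj1 (coord_linear X n)).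
    + intros c x. apply (coord_sig_eq X n). apply (proj2 (coord_linear X n)).
    + intros a x Ha. apply (coord_sig_eq X n). now apply coord_act.
    + now exists 1.
  - exact He.
  - destruct (Hnorm r Hr) as (s & [[Hs0 Hs] _] & Hsr).
    (* The coordinate projection is contractive, so the lifting has norm below [1 + eps]; restricted
       to [E] it is a section of [q]. *)
    assert (r <= 1) as Hr1 by (apply Hr, Hphi1).
    exists (fun i (y : E) => proj1_sig (psi (proj1_sig y) : l1space E) i).
    apply (approx_section_of_lifting b q (fun y : E => psi (proj1_sig y)) eps Hq Hqb Hqd).
    + split; intros; [apply Hpa|apply Hps].
    + intros y. rewrite Hlift. apply (coord_sig_eq X n). exact (proj2_sig y).
    + intros y. eapply Rle_trans; [apply Hs|].
      apply Rmult_le_compat_r; [apply vnorm_nonneg|lra].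
Qed.

Lemma projective_coord_iso_l1 : exists (Lam : Type) (T : (Lam -> Cpx) -> X), coord_iso_l1 X n T.
Proof.
  pose proof (coord_space_complete X n HX) as HE.
  destruct (sections_l1_basis b HE b_norm sections) as (B & HB & Hspan).
  destruct (l1_basis_isometry B HE HB Hspan) as (q & Hq & Hiso & Hsurj).
  (* [T] must be defined on all functions; its value zero off l1 is arbitrary. *)
  exists {v : E | B v}, (fun f => match excluded_middle_informative (in_l1 f) with
    | left H => proj1_sig (q (exist _ f H)) | right _ => vzero end).
  assert (forall f (H : in_l1 f), match excluded_middle_informative (in_l1 f) with
    | left H => proj1_sig (q (exist _ f H)) | right _ => vzero end = proj1_sig (q (exist _ f H))) as HT.
  { intros f H. destruct (excluded_middle_informative (in_l1 f)) as [H'|]; [|contradiction].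
    do 3 f_equal. apply proof_irrelevance. }
  split; [|split; [|split; [|split]]].
  - intros f g Hf Hg. rewrite (HT f Hf), (HT g Hg), (HT _ (in_l1_fadd f g Hf Hg)).
    exact (f_equal (@proj1_sig _ _) (proj1 Hq (exist _ f Hf) (exist _ g Hg))).
  - intros c f Hf. rewrite (HT f Hf), (HT _ (in_l1_fscal c f Hf)).
    exact (f_equal (@proj1_sig _ _) (proj2 Hq c (exist _ f Hf))).
  - intros f Hf. rewrite (HT f Hf). apply in_coord_iff. exact (proj2_sig (q (exist _ f Hf))).
  - intros y Hy. apply in_coord_iff in Hy. destruct (Hsurj (exist (fun x => coord X n x = x) y Hy)) as [[f Hf] Hqf].
    exists f. split; [assumption|]. rewrite (HT f Hf). exact (f_equal (@proj1_sig _ _) Hqf).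
  - intros f r Hf Hr. rewrite (HT f Hf). rewrite <- (l1norm_unique f r Hf Hr).
    exact (Hiso (exist _ f Hf)).
Qed.
End Necessity.

(** * l1-bases of the coordinate subspaces and their joint span *)

Section Bases.
Context {A : SeqAlg} (X : AModule A).

Definition coord_basis (n : nat) (B : X -> Prop) : Prop :=
  (forall v, B v -> coord X n v = v) /\ l1_independent B /\
  (forall x, coord X n x = x -> in_closed_span B x).

(** The basis consists of the images of the unit functions. As a set of vectors of [X] it no longer
    mentions [Lam], so bases for all [n] can be chosen in one type. *)
Lemma coord_iso_basis (n : nat) {Lam : Type} (T : (Lam -> Cpx) -> X) :
  coord_iso_l1 X n T -> exists B, coord_basis n B.
Proof.
  intros (Tadd & Tscal & Tin & Tsurj & Tnorm).
  set (q := fun x : l1space Lam => T (proj1_sig x)).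
  set (b := fun i : Lam => T (delta_fun i)).
  assert (@vlinear (l1space Lam) X q) as Hq.
  { split; intros; [apply Tadd|apply Tscal]; apply proj2_sig. }
  assert (forall x, vnorm X (q x) = vnorm (l1space Lam) x) as Hiso.
  { intros x. apply Tnorm; [apply proj2_sig|apply l1norm_spec, proj2_sig]. }
  assert (forall f L, q (wsum delta f L) = wsum b f L) as Hqw by (now apply cover_wsum).
  exists (fun v => exists i, v = b i). split; [|split].
  - intros v [i ->]. apply in_coord_iff, Tin, (proj2_sig (delta i)).
  - intros L f HL HLB.
    assert (exists L', L = map b L') as [L' ->].
    { clear HL. induction L as [|v L IH]; [now exists []|].
      destruct IH as [L' ->]; [intros; apply HLB; now right|].
      destruct (HLB v (or_introl eq_refl)) as [i ->]. now exists (i :: L'). }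
    apply NoDup_map_inv in HL.
    assert (wsum (fun v => v) f (map b L') = q (wsum delta (fun i => f (b i)) L')) as ->.
    { rewrite Hqw. unfold wsum. now rewrite vsum_map. }
    rewrite Hiso, fsum_rsum, rsum_map, <- (fsum_rsum (fun i => f (b i))).
    apply Rle_antisym; [apply vnorm_wsum; intros; apply delta_norm_le|now apply fsum_le_norm_wsum].
  - intros x Hx. apply in_coord_iff in Hx. destruct (Tsurj x Hx) as (f & Hf & <-).
    apply closed_span_lim. intros eps He. destruct (l1_approx (exist _ f Hf) eps He) as (L & HL & H).
    exists (q (wsum delta f L)). split.
    + rewrite Hqw. apply closed_span_vsum. intros i _. apply closed_span_scal, closed_span_elem.
      now exists i.
    + change (T f) with (q (exist _ f Hf)). rewrite <- vlinear_sub by assumption. now rewrite Hiso.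
Qed.

Context (B : nat -> X -> Prop).
Hypotheses (HB : forall n, coord_basis n (B n)) (Hess : essential X).

Let any (v : X) : Prop := exists n, B n v.

Let span_coord n x : in_closed_span any (coord X n x).
Proof.
  apply closed_span_trans with (B := B n).
  - intros v Hv. apply closed_span_elem. now exists n.
  - apply (HB n), coord_coord_same.
Qed.

Let span_finite x N : forall a, (forall k, (k >= N)%nat -> a k = C0) ->
  in_closed_span any (act X a x).
Proof.
  induction N as [|N IH]; intros a Ha.
  (* The zero sequence is written as a multiple of [pvec 0] so that [act_scal_l] applies. *)
  - replace a with (sscal C0 (pvec 0)).
    + rewrite act_scal_l by apply pvec_in. apply closed_span_scal, span_coord.
    + apply functional_extensionality; intros k. rewrite Ha by lia. unfold sscal. ring.
  - set (a' := fun k => if Nat.eqb k N then C0 else a k).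
    assert (forall k, (k >= N)%nat -> a' k = C0) as Ha'.
    { intros k Hk. unfold a'. destruct (Nat.eqb_spec k N); [reflexivity|]. apply Ha. lia. }
    replace a with (sadd a' (sscal (a N) (pvec N))).
    + rewrite act_add_l, act_scal_l.
      * apply closed_span_add; [now apply IH|]. apply closed_span_scal, span_coord.
      * apply pvec_in.
      * apply inA_c00. now exists N.
      * apply inA_scal, pvec_in.
    + apply functional_extensionality; intros k. unfold sadd, sscal, a', pvec.
      destruct (Nat.eqb_spec k N) as [->|]; ring.
Qed.

Let span_act a x : inA A a -> in_closed_span any (act X a x).
Proof.
  intros Ha. apply closed_span_lim. intros eps He. pose proof (vnorm_nonneg X x) as Hx.
  destruct (@c00_dense A a Ha (eps / (vnorm X x + 1))) as (c & Hc & Hac).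
  { apply Rdiv_lt_0_compat; lra. }
  exists (act X c x). split; [destruct Hc as [N HN]; now apply span_finite with N|].
  apply inA_c00 with (s := A) in Hc.
  assert (sopp c = sscal (Copp C1) c) as Hopp
    by (apply functional_extensionality; intros k; unfold sopp, sscal; ring).
  assert (inA A (sopp c)) as Hc' by (rewrite Hopp; now apply inA_scal).
  replace (vsub X (act X a x) (act X c x)) with (act X (sadd a (sopp c)) x).
  - eapply Rle_lt_trans; [apply act_contractive; now apply inA_add|].
    assert (eps / (vnorm X x + 1) * (vnorm X x + 1) = eps) by (field; lra).
    pose proof (normA_nonneg A _ (inA_add A _ _ Ha Hc')). nra.
  - rewrite act_add_l, Hopp, act_scal_l by assumption. vring X.
Qed.

(** A finite sequence acts as a finite combination of coordinate projections; density of c00 extends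
    this to all of [A], and essentiality to all of [X]. *)
Lemma essential_span (x : X) : in_closed_span (fun v => exists n, B n v) x.
Proof.
  apply closed_span_lim. intros eps He. destruct (Hess x eps He) as (l & Hl & Hx).
  exists (act_sum X l). split; [|assumption]. clear Hx. fold any.
  induction Hl as [|[a y] l Ha Hl IH]; [apply closed_span_zero|].
  cbn [act_sum]. apply closed_span_add; [now apply span_act|assumption].
Qed.
End Bases.

(** * Liftings between homogeneous modules *)

Section Lifting.
Context {A : SeqAlg} (X Y Z : AModule A) (B : nat -> X -> Prop).
Hypotheses (HX : in_Hbar X) (HY : in_Hbar Y) (HB : forall n, coord_basis X n (B n)).
Context (tau : Y -> Z) (phi : X -> Z) (r kappa : R).
Hypotheses (Htau : morphism tau) (Hco : coisometric tau) (Hphi : morphism phi)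
  (Hr : op_bound phi r) (Hk : 1 < kappa).

Let tau_linear : @vlinear Y Z tau.
Proof. destruct Htau as (H1 & H2 & _). now split. Qed.
Let phi_linear : @vlinear X Z phi.
Proof. destruct Hphi as (H1 & H2 & _). now split. Qed.
Let tau_coord n y : tau (coord Y n y) = coord Z n (tau y).
Proof. destruct Htau as (_ & _ & H & _). apply H, pvec_in. Qed.
Let phi_coord n x : phi (coord X n x) = coord Z n (phi x).
Proof. destruct Hphi as (_ & _ & H & _). apply H, pvec_in. Qed.

(* [e] almost attains the norm of phi on the n-th coordinate subspace; comparing lifts with
   [phi e] is what lets homogeneity of Y control the norm of the assembled lifting. *)
Let norming_vector n : exists e : X, vnorm X e <= 1 /\ coord X n e = e /\
  forall v, B n v -> exists y : Y, tau y = phi v /\ coord Y n y = y /\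
    vnorm Y y <= kappa * kappa * vnorm Z (phi e).
Proof.
  destruct (HB n) as (Bfix & Bind & _).
  destruct (classic (exists v, B n v /\ 0 < vnorm Z (phi v))) as [(v1 & Hv1 & Hpos)|Hn].
  - destruct (completeness (fun t => exists v, B n v /\ t = vnorm Z (phi v))) as [s [Hs1 Hs2]].
    { exists r. intros t (v & Hv & ->). destruct Hr as [_ H]. specialize (H v).
      rewrite (l1_independent_unit (B n) v Bind Hv) in H. lra. }
    { exists (vnorm Z (phi v1)), v1. now split. }
    assert (0 < s) as Hs by (apply Rlt_le_trans with (1 := Hpos), Hs1; now exists v1).
    assert (exists v0, B n v0 /\ s < kappa * vnorm Z (phi v0)) as (v0 & Hv0 & Hsv).
    { apply NNPP. intros Hn. assert (s <= s / kappa) as H.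
      { apply Hs2. intros t (v & Hv & ->). apply Rnot_lt_le. intros Hlt. apply Hn.
        exists v. split; [assumption|].
        replace s with (kappa * (s / kappa)) by (field; lra). apply Rmult_lt_compat_l; lra. }
      assert (kappa * (s / kappa) = s) by (field; lra). nra. }
    exists v0. rewrite (l1_independent_unit (B n) v0 Bind Hv0).
    split; [lra|]. split; [now apply Bfix|]. intros v Hv.
    assert (vnorm Z (phi v) <= s) as Hvs by (apply Hs1; now exists v).
    destruct Hco as [_ Hlift]. pose proof (vnorm_nonneg Z (phi v0)).
    (* One factor [kappa] pays for [v0] only almost attaining the supremum, the other leaves
       positive room for the coisometric lift. *)
    destruct (Hlift (phi v) (kappa * kappa * vnorm Z (phi v0) - vnorm Z (phi v))) as (y & Hy & Hyn).
    { nra. }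
    (* Projecting the lift to its [n]-th coordinate keeps it a lift, as [v] lies in the [n]-th
       coordinate subspace, and does not increase its norm. *)
    exists (coord Y n y). rewrite tau_coord, Hy, <- phi_coord, Bfix by assumption.
    split; [reflexivity|]. split; [apply coord_coord_same|].
    pose proof (coord_norm_le Y n y). lra.
  - exists vzero. rewrite vnorm_vzero. split; [lra|]. split; [apply vlinear_zero, coord_linear|].
    intros v Hv. exists vzero. rewrite vnorm_vzero, (vlinear_zero tau tau_linear).
    split; [|split].
    + symmetry. apply vnorm_zero. pose proof (vnorm_nonneg Z (phi v)) as [H|H]; [|easy].
      exfalso. apply Hn. now exists v.
    + apply vlinear_zero, coord_linear.
    + pose proof (vnorm_nonneg Z (phi vzero)). nra.
Qed.

Let coord_wsum (W : AModule A) (g : nat * X -> W) f L m :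
  (forall i, In i L -> coord W (fst i) (g i) = g i) ->
  coord W m (wsum g f L) = wsum g f (filter (fun i => Nat.eqb (fst i) m) L).
Proof.
  intros Hg. unfold wsum. rewrite (vlinear_vsum _ _ L (coord_linear W m)).
  rewrite (vsum_filter (fun i => Nat.eqb (fst i) m) _ L).
  rewrite (vsum_zero _ (filter (fun i => negb (Nat.eqb (fst i) m)) L)).
  - rewrite vadd_zero. apply vsum_ext. intros i Hi. apply filter_In in Hi.
    destruct Hi as [Hi Him]. apply Nat.eqb_eq in Him. subst m.
    now rewrite (proj2 (coord_linear W (fst i))), Hg.
  - intros i Hi. apply filter_In in Hi. destruct Hi as [Hi Him].
    apply Bool.negb_true_iff, Nat.eqb_neq in Him.
    rewrite (proj2 (coord_linear W m)), <- Hg, coord_coord_other by assumption.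
    apply vscal_vzero.
Qed.

(** Within a fibre the first components agree, so [snd] is injective there and independence of [B m]
    applies. *)
Let fiber_norm L m f : NoDup L -> (forall i, In i L -> B (fst i) (snd i)) ->
  vnorm X (wsum snd f (filter (fun i => Nat.eqb (fst i) m) L))
  = fsum f (filter (fun i => Nat.eqb (fst i) m) L).
Proof.
  intros HL HLB. set (M := filter _ L).
  assert (forall i, In i M -> i = (m, snd i) /\ B m (snd i)) as HM.
  { intros i Hi. apply filter_In in Hi. destruct Hi as [Hi Him]. apply Nat.eqb_eq in Him.
    specialize (HLB i Hi). destruct i as [k v]; simpl in *. now subst. }
  assert (NoDup M) as HMN by apply NoDup_filter, HL.
  assert (NoDup (map snd M)) as HMS.
  { clearbody M. clear HL HLB. induction HMN as [|i M Hi HMN IH]; simpl; constructor.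
    - intros H. apply in_map_iff in H. destruct H as (j & Hj & HjM). apply Hi.
      rewrite (proj1 (HM i (or_introl eq_refl))), <- Hj.
      now rewrite <- (proj1 (HM j (or_intror HjM))).
    - apply IH. intros; apply HM; now right. }
  destruct (HB m) as (_ & Bind & _).
  assert (vnorm X (wsum (fun v => v) (fun v => f (m, v)) (map snd M))
    = fsum (fun v => f (m, v)) (map snd M)) as H.
  { apply Bind; [assumption|]. intros v Hv. apply in_map_iff in Hv. destruct Hv as (i & <- & Hi).
    now apply HM. }
  unfold wsum in *. rewrite vsum_map, fsum_rsum, rsum_map in H. rewrite fsum_rsum.
  rewrite (vsum_ext _ (fun i => vscal X (f (m, snd i)) (snd i))), H.
  - apply rsum_ext. intros i Hi. now rewrite <- (proj1 (HM i Hi)).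
  - intros i Hi. now rewrite <- (proj1 (HM i Hi)).
Qed.

Lemma homogeneous_lifting : exists psi : X -> Y, morphism psi /\
  op_bound psi (kappa * kappa * r) /\ forall x, tau (psi x) = phi x.
Proof.
  destruct HX as (_ & HXe & HXh). destruct HY as (HYc & _ & HYh).
  apply choice in norming_vector. destruct norming_vector as [e He].
  assert (forall i : nat * X, exists y : Y, B (fst i) (snd i) -> tau y = phi (snd i) /\
    coord Y (fst i) y = y /\ vnorm Y y <= kappa * kappa * vnorm Z (phi (e (fst i)))) as Hlift.
  { intros i. destruct (classic (B (fst i) (snd i))) as [Hi|Hi].
    - destruct (He (fst i)) as (_ & _ & H). destruct (H _ Hi) as [y Hy]. now exists y.
    - now exists vzero. }
  apply choice in Hlift. destruct Hlift as [yl Hyl].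
  set (valid := fun i : nat * X => B (fst i) (snd i)).
  set (G := fun (x : X) (y : Y) => exists l : list (Cpx * (nat * X)),
    (forall p, In p l -> valid (snd p)) /\ x = lcomb snd l /\ y = lcomb yl l).
  assert (0 <= r) as Hr0 by apply Hr.
  assert (forall x y, G x y -> vnorm Y y <= kappa * kappa * r * vnorm X x) as Gbound.
  { intros x y (l & Hl & -> & ->). destruct (lcomb_collect valid l Hl) as (L & f & HL & HLv & Hc).
    rewrite !Hc. clear l Hl Hc.
    set (x := wsum snd f L). set (y := wsum yl f L).
    set (fib := fun m => filter (fun i : nat * X => Nat.eqb (fst i) m) L).
    (* Taking absolute values of the coefficients prevents cancellation: coordinate [m] of [x'] is
       the full mass of the fibre times [e m], and that mass is the norm of coordinate [m] of
       [x]. *)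
    set (x' := wsum (fun i => e (fst i)) (fun i => Cre (Cnorm (f i))) L).
    assert (forall m, vnorm X (coord X m x) = fsum f (fib m)) as Hxm.
    { intros m. unfold x. rewrite coord_wsum; [now apply fiber_norm|].
      intros i Hi. apply HB, HLv, Hi. }
    assert (forall m, coord X m x' = vscal X (Cre (fsum f (fib m))) (e m)) as Hx'm.
    { intros m. unfold x'. rewrite coord_wsum; [|intros; apply He]. fold (fib m).
      assert (forall i, In i (fib m) -> fst i = m) as Hfib.
      { intros i Hi. apply filter_In in Hi. now apply Nat.eqb_eq. }
      induction (fib m) as [|i M IH]; unfold wsum in *; simpl.
      - change (Cre 0) with C0. now rewrite vscal_C0.
      - rewrite IH by (intros; apply Hfib; now right).
        rewrite (Hfib i (or_introl eq_refl)), <- vscal_distr_r.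
        f_equal. cpx. }
    assert (forall m, 0 <= fsum f (fib m)) as Hpos by (intros; apply fsum_nonneg).
    assert (vnorm X x' <= vnorm X x) as Hx'x.
    { apply HXh. intros m. rewrite Hxm, Hx'm, vnorm_scal, Cnorm_re, Rabs_pos_eq by apply Hpos.
      destruct (He m) as (He1 & _). specialize (Hpos m). nra. }
    apply le_of_small with (C := kappa * kappa). intros eps Heps.
    destruct Hco as [[_ Htb] Hlift]. destruct (Hlift (phi x') eps) as (y' & Hy' & Hyn); [lra|].
    (* Coordinatewise, the norm of [y] is at most [kappa * kappa] times that of [phi] at coordinate
       [m] of [x']; this is the image under [tau] of coordinate [m] of [y'], and [tau] is
       contractive. *)
    assert (vnorm Y y <= vnorm Y (vscal Y (Cre (kappa * kappa)) y')) as Hyy'.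
    { apply HYh. intros m. rewrite (proj2 (coord_linear Y m)), vnorm_scal, Cnorm_re, Rabs_pos_eq by nra.
      assert (fsum f (fib m) * vnorm Z (phi (e m)) <= vnorm Y (coord Y m y')) as H1.
      { specialize (Htb (coord Y m y')).
        rewrite tau_coord, Hy', <- phi_coord, Hx'm, (proj2 phi_linear), vnorm_scal, Cnorm_re,
          Rabs_pos_eq in Htb by apply Hpos. lra. }
      assert (vnorm Y (coord Y m y) <= kappa * kappa * vnorm Z (phi (e m)) * fsum f (fib m)) as H2.
      { unfold y. rewrite coord_wsum by (intros i Hi; apply Hyl, HLv, Hi). fold (fib m).
        unfold wsum. eapply Rle_trans; [apply vnorm_vsum|]. rewrite fsum_rsum, <- rsum_scal.
        apply rsum_le. intros i Hi. apply filter_In in Hi. destruct Hi as [Hi Him].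
        apply Nat.eqb_eq in Him. rewrite vnorm_scal, Rmult_comm.
        apply Rmult_le_compat_r; [apply Cnorm_nonneg|]. rewrite <- Him. apply Hyl, HLv, Hi. }
      assert (0 <= kappa * kappa) by nra.
      assert (kappa * kappa * (fsum f (fib m) * vnorm Z (phi (e m)))
        <= kappa * kappa * vnorm Y (coord Y m y')) by (apply Rmult_le_compat_l; assumption).
      lra. }
    rewrite vnorm_scal, Cnorm_re, Rabs_pos_eq in Hyy' by nra.
    destruct Hr as [_ Hrb]. specialize (Hrb x').
    assert (r * vnorm X x' <= r * vnorm X x) by (apply Rmult_le_compat_l; assumption).
    assert (kappa * kappa * vnorm Y y' <= kappa * kappa * (r * vnorm X x + eps))
      by (apply Rmult_le_compat_l; nra).
    lra. }
  assert (forall x y, G x y -> tau y = phi x) as Gtau.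
  { intros x y (l & Hl & -> & ->). unfold lcomb.
    rewrite (vlinear_vsum tau _ l tau_linear), (vlinear_vsum phi _ l phi_linear).
    apply vsum_ext. intros p Hp. rewrite (proj2 tau_linear), (proj2 phi_linear). f_equal.
    apply (Hyl (snd p)), (Hl p Hp). }
  (* On the [n]-th coordinate subspaces [a] acts as the scalar [a n] in both modules, so it rescales
     the coefficients of both combinations alike. *)
  assert (forall a x y, inA A a -> G x y -> G (act X a x) (act Y a y)) as Gact.
  { intros a x y Ha (l & Hl & -> & ->).
    exists (map (fun p => (Cmul (a (fst (snd p))) (fst p), snd p)) l). split; [|split].
    - intros p Hp. apply in_map_iff in Hp. destruct Hp as (p' & <- & Hp'). exact (Hl p' Hp').
    - unfold lcomb. rewrite vsum_map.
      rewrite (@vlinear_vsum _ X X (act X a)) by (split; intros; [now apply act_add_r|now apply act_scal_r]).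
      apply vsum_ext. intros p Hp. simpl. rewrite act_scal_r by assumption.
      assert (coord X (fst (snd p)) (snd (snd p)) = snd (snd p)) as Hc by apply HB, (Hl p Hp).
      rewrite <- Hc, act_coord, vscal_assoc by assumption. f_equal. ring.
    - unfold lcomb. rewrite vsum_map.
      rewrite (@vlinear_vsum _ Y Y (act Y a)) by (split; intros; [now apply act_add_r|now apply act_scal_r]).
      apply vsum_ext. intros p Hp. simpl. rewrite act_scal_r by assumption.
      assert (coord Y (fst (snd p)) (yl (snd p)) = yl (snd p)) as Hc by (apply Hyl, (Hl p Hp)).
      rewrite <- Hc, act_coord, vscal_assoc by assumption. f_equal. ring. }
  assert (forall x eps, eps > 0 -> exists x' y', G x' y' /\ vnorm X (vsub X x x') < eps) as Gdense.
  { intros x eps Heps. destruct (essential_span X B HB HXe x eps Heps) as (l & Hl & Hlx).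
    assert (exists l' : list (Cpx * (nat * X)), (forall p, In p l' -> valid (snd p)) /\
      lcomb snd l' = lcomb (fun v => v) l) as (l' & Hl' & Heq).
    { clear Hlx. induction l as [|[c v] l IH]; [now exists []|].
      destruct IH as (l' & Hl' & Heq); [intros; apply Hl; now right|].
      destruct (Hl (c, v) (or_introl eq_refl)) as [n Hn]. exists ((c, (n, v)) :: l'). split.
      - intros p [<-|Hp]; [exact Hn|auto].
      - unfold lcomb in *. simpl. now rewrite Heq. }
    exists (lcomb snd l'), (lcomb yl l'). split; [now exists l'|]. now rewrite Heq. }
  destruct (graph_extension G (kappa * kappa * r)) as (psi & Hpl & Hpb & HpG); try assumption.
  - nra.
  - intros x y x' y' (l & Hl & -> & ->) (l' & Hl' & -> & ->). exists (l ++ l').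
    unfold lcomb. rewrite !vsum_app. split; [|easy].
    intros p Hp. apply in_app_or in Hp. destruct Hp; auto.
  - intros c x y (l & Hl & -> & ->). eexists. rewrite <- !lcomb_scal. split; [|split; reflexivity].
    intros p Hp. apply in_map_iff in Hp. destruct Hp as (p' & <- & Hp'). exact (Hl p' Hp').
  - assert (op_bound psi (kappa * kappa * r)) as Hop by (split; [nra|assumption]).
    exists psi. split; [|split].
    + split; [apply Hpl|]. split; [apply Hpl|]. split; [|now exists (kappa * kappa * r)].
      intros a x Ha. pose proof (normA_nonneg A a Ha) as Hna. revert x.
      apply (@bounded_agree X Y) with (C := normA A a * (kappa * kappa * r)).
      * split; intros.
        -- now rewrite act_add_r, (proj1 Hpl).
        -- now rewrite act_scal_r, (proj2 Hpl).
      * split; intros.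
        -- now rewrite (proj1 Hpl), act_add_r.
        -- now rewrite (proj2 Hpl), act_scal_r.
      * intros x. eapply Rle_trans; [apply Hpb|].
        replace (normA A a * (kappa * kappa * r) * vnorm X x)
          with (kappa * kappa * r * (normA A a * vnorm X x)) by ring.
        apply Rmult_le_compat_l; [apply Hop|now apply act_contractive].
      * intros x. eapply Rle_trans; [now apply act_contractive|].
        rewrite Rmult_assoc. now apply Rmult_le_compat_l.
      * intros x eps Heps. destruct (Gdense x eps Heps) as (x' & y' & HG & Hx').
        exists x'. split; [|assumption]. rewrite (HpG _ _ HG). apply HpG. now apply Gact.
    + assumption.
    + apply (@bounded_agree X Z) with (C := kappa * kappa * r).
      * split; intros.
        -- now rewrite (proj1 Hpl), (proj1 tau_linear).
        -- now rewrite (proj2 Hpl), (proj2 tau_linear).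
      * exact phi_linear.
      * intros x. destruct Hco as [[_ Htb] _]. specialize (Htb (psi x)). specialize (Hpb x). lra.
      * intros x. destruct Hr as [_ Hrb]. specialize (Hrb x). pose proof (vnorm_nonneg X x).
        eapply Rle_trans; [exact Hrb|]. apply Rmult_le_compat_r; [assumption|].
        rewrite <- (Rmult_1_l r) at 1. apply Rmult_le_compat_r; nra.
      * intros x eps Heps. destruct (Gdense x eps Heps) as (x' & y' & HG & Hx').
        exists x'. split; [|assumption]. rewrite (HpG _ _ HG). now apply Gtau.
Qed.
End Lifting.

(** * Sufficiency, and the equivalence *)

Lemma coord_basis_projective {A : SeqAlg} (X : AModule A) (B : nat -> X -> Prop) :
  in_Hbar X -> (forall n, coord_basis X n (B n)) -> extremely_projective_Hbar X.
Proof.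
  intros HX HB Y Z HY _ tau Htau Hco phi Hphi eps He.
  pose proof Hphi as (_ & _ & _ & M & HM). destruct (opnorm_exists phi M HM) as [r Hr].
  assert (0 <= r) as Hr0 by apply Hr.
  (* For [eta <= 1] the square of [1 + eta] exceeds 1 by at most [3 * eta], so the norm grows by at
     most [eps / 2]. *)
  set (eta := Rmin 1 (eps / (6 * (r + 1)))).
  assert (0 < eps / (6 * (r + 1))) by (apply Rdiv_lt_0_compat; lra).
  assert (0 < eta <= 1) as Heta by (split; [apply Rmin_glb_lt; lra|apply Rmin_l]).
  assert (eta * (6 * (r + 1)) <= eps) as Heta2.
  { replace eps with (eps / (6 * (r + 1)) * (6 * (r + 1))) by (field; lra).
    apply Rmult_le_compat_r; [lra|apply Rmin_r]. }
  destruct (homogeneous_lifting X Y Z B HX HY HB tau phi r (1 + eta) Htau Hco Hphi (proj1 Hr))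
    as (psi & Hpsi & Hbound & Hlift); [lra|].
  exists psi. split; [assumption|]. split; [assumption|].
  intros rphi Hrphi. destruct (opnorm_exists psi _ Hbound) as [s Hs].
  exists s. split; [assumption|].
  assert (r <= rphi) by (apply Hr, Hrphi).
  assert (s <= (1 + eta) * (1 + eta) * r) by (apply Hs, Hbound). nra.
Qed.

Theorem mainTheorem2 (A : SeqAlg) (X : AModule A) (HX : in_Hbar X) :
  extremely_projective_Hbar X <->
  (forall n : nat, exists (Lam : Type) (T : (Lam -> Cpx) -> X), coord_iso_l1 X n T).
Proof.
  split.
  - intros Hproj n. apply projective_coord_iso_l1; [apply HX|assumption].
  - intros H.
    assert (forall n, exists B, coord_basis X n B) as HB.
    { intros n. destruct (H n) as (Lam & T & HT). exact (coord_iso_basis X n T HT). }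
    apply choice in HB. destruct HB as [B HB]. exact (coord_basis_projective X B HX HB).
Qed.
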